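(* Let $a>0$ and write $\mathbf z=(\boldsymbol\rho,\zeta)\in\mathbb R^2\times\mathbb C$ with $\zeta=\xi-ia$, $\xi\in\mathbb R$, $\rho=|\boldsymbol\rho|$, and let $\tilde r=\sqrt{\rho^2+\zeta^2}$ with branch $\operatorname{Re}\tilde r\ge0$ (branch cut on $\{\xi=0,\ \rho\le a\}$). For real $\omega\ne0$ define the time-harmonic complex-source beam $B_\omega(\mathbf z)=\frac{e^{i\omega\tilde r}}{4\pi\tilde r}$. For $\omega>0$ and $\xi>0$ define $$U^+(\mathbf z,\omega)=\int_{\mathbb R^2}\frac{d\mathbf h}{(2\pi)^2}\,\frac{1}{2\mu}\,e^{i\mathbf h\cdot\boldsymbol\rho-\mu\zeta}=U^+_{\rm prop}(\mathbf z,\omega)+U^+_{\rm evan}(\mathbf z,\omega),$$ where $h=|\mathbf h|$, $\mu=-i\sqrt{\omega^2-h^2}$ for $h\le\omega$ and $\mu=\sqrt{h^2-\omega^2}$ for $h\ge\omega$, and $$U^+_{\rm prop}(\mathbf z,\omega)=i\int_0^\omega\frac{h\,dh}{2\pi}\,\frac{J_0(h\rho)}{2\sqrt{\omega^2-h^2}}\,e^{i\zeta\sqrt{\omega^2-h^2}},\qquad U^+_{\rm evan}(\mathbf z,\omega)=\int_\omega^\infty\frac{h\,dh}{2\pi}\,\frac{J_0(h\rho)}{2\sqrt{h^2-\omega^2}}\,e^{-\zeta\sqrt{h^2-\omega^2}}.$$ Then $$B_\omega(\mathbf z)=\begin{cases}U^+(\mathbf z,\omega),&\omega>0,\ \xi>0,\\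 U^+(-\mathbf z,\omega),&\omega>0,\ \xi<0,\\ U^+(\mathbf z^*,|\omega|)^*,&\omega<0,\ \xi>0,\\ U^+(-\mathbf z^*,|\omega|)^*,&\omega<0,\ \xi<0,\end{cases}$$ where $\mathbf z^*=(\boldsymbol\rho,\xi+ia)$ and $U^+$ is given by the same integral formula at these arguments. The components $U^+(\mathbf z,\omega)$ and $U^+(-\mathbf z,\omega)$ are analytic continuations of one another across the plane $\xi=0$, with equal boundary values on that plane for $\rho>a$. The jump across the branch cut is $$J(\boldsymbol\rho,\omega):=\lim_{\varepsilon\searrow0}\big\{B_\omega(\boldsymbol\rho,\varepsilon-ia)-B_\omega(\boldsymbol\rho,-\varepsilon-ia)\big\}=i\,\frac{\Theta(a-\rho)}{2\pi\sqrt{a^2-\rho^2}}\cosh\!\big(\omega\sqrt{a^2-\rho^2}\big),$$ with spectral decomposition $$J(\boldsymbol\rho,\omega)=i\int_{\mathbb R^2}\frac{d\mathbf h}{(2\pi)^2}\,e^{i\mathbf h\cdot\boldsymbol\rho}\,\frac{\sin(\mu a)}{\mu}=i\int_0^\infty\frac{h\,dh}{2\pi}\,J_0(h\rho)\,\frac{\sin(\mu a)}{\mu}.$$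
   Context: $J_0$ is the Bessel function of order zero, $\Theta$ the Heaviside function. Here $\mathbf z=\mathbf x-i\mathbf y$ with $\mathbf y=a\hat{\mathbf e}_3$, $\boldsymbol\rho$ the components of $\mathbf x$ transverse to $\mathbf y$ and $\xi$ the component along $\mathbf y$, so $\tilde r$ is the complex distance $\sqrt{(\mathbf x-i\mathbf y)^2}$.
   Formalization: The jump formula is stated for ρ≠a (at ρ=a the limit diverges), and its spectral decompositions for ρ≠0, ρ≠a, as limits of integrals over |h|<T and [0,T] (at ρ=0 these have no limit); analytic continuation is in ζ near −ia for each fixed ρ>a. *)

(* Defs.v *)
From HB Require Import structures.
From mathcomp Require Import all_boot all_order all_algebra.
From mathcomp Require Import all_classical all_reals all_analysis.
From mathcomp Require Export complex.
Export ComplexField.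
Set Implicit Arguments.
Unset Strict Implicit.
Unset Printing Implicit Defensive.
Import Order.TTheory GRing.Theory Num.Theory.
Import numFieldNormedType.Exports.
Local Open Scope ring_scope.
Local Open Scope classical_set_scope.
Local Open Scope complex_scope.

(* The complex plane as a normed space over itself (topology = usual one). *)
Notation CC R := ((R[i])^o).

Section Defs.
Variable R : realType.
Implicit Types (x y a w : R) (z : CC R).

Definition Ci : CC R := 0 +i* 1.
End Defs.
Arguments Ci {R}.
Section Defs2.
Variable R : realType.
Implicit Types (x y a w : R) (z : CC R).

Definition cre z : R := complex.Re z.
Definition cim z : R := complex.Im z.
Definition cconj z : CC R := conjc z.

Definition cexp z : CC R :=
  (expR (cre z))%:C * (cos (cim z) +i* sin (cim z)).
Definition csin z : CC R :=
  (cexp (Ci * z) - cexp (- (Ci * z))) / (2 * Ci).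
Definition cosh x : R := (expR x + expR (- x)) / 2.

Definition heaviside x : R := if 0 <= x then 1 else 0.

(* Principal complex square root, branch Re >= 0
   (for z on the negative real axis the value i*sqrt|z| is taken). *)
Definition csqrt z : CC R :=
  let m := Num.sqrt (cre z ^+ 2 + cim z ^+ 2) in
  (Num.sqrt ((m + cre z) / 2))
    +i* ((if cim z < 0 then -1 else 1) * Num.sqrt ((m - cre z) / 2)).

Definition besselJ0 x : R :=
  limn (fun n : nat =>
    \sum_(0 <= k < n) ((-1) ^+ k * (x / 2) ^+ (2 * k) / (k`!%:R ^+ 2))).

Definition dot2 (u v : R * R) : R := u.1 * v.1 + u.2 * v.2.
Definition norm2 (u : R * R) : R := Num.sqrt (u.1 ^+ 2 + u.2 ^+ 2).
Definition opp2 (u : R * R) : R * R := (- u.1, - u.2).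

Definition rtilde (rho : R * R) (zeta : CC R) : CC R :=
  csqrt ((norm2 rho ^+ 2)%:C + zeta ^+ 2).

Definition beamB w (rho : R * R) (zeta : CC R) : CC R :=
  cexp (Ci * w%:C * rtilde rho zeta) / ((4 * pi)%:C * rtilde rho zeta).

Definition muf (h w : R) : CC R :=
  if h <= `|w| then - Ci * (Num.sqrt (w ^+ 2 - h ^+ 2))%:C
  else (Num.sqrt (h ^+ 2 - w ^+ 2))%:C.

Definition cintegrable d (T : measurableType d)
    (mu : {measure set T -> \bar R}) (D : set T) (f : T -> CC R) : Prop :=
  mu.-integrable D (fun t => (cre (f t))%:E) /\
  mu.-integrable D (fun t => (cim (f t))%:E).

Definition cintegral d (T : measurableType d)
    (mu : {measure set T -> \bar R}) (D : set T) (f : T -> CC R) : CC R :=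
  (Rintegral mu D (fun t => cre (f t))) +i* (Rintegral mu D (fun t => cim (f t))).

Definition leb2 := ((@lebesgue_measure R) \x (@lebesgue_measure R))%E.

Definition Uplus_integrand w (rho : R * R) (zeta : CC R) (h : R * R) : CC R :=
  ((2 * pi) ^+ 2)%:C^-1 * (2 * muf (norm2 h) w)^-1 *
  cexp (Ci * (dot2 h rho)%:C - muf (norm2 h) w * zeta).

Definition Uplus w (rho : R * R) (zeta : CC R) : CC R :=
  cintegral leb2 setT (Uplus_integrand w rho zeta).

Definition Uprop_integrand w (rho : R * R) (zeta : CC R) (h : R) : CC R :=
  Ci * (h / (2 * pi))%:C *
  (besselJ0 (h * norm2 rho) / (2 * Num.sqrt (w ^+ 2 - h ^+ 2)))%:C *
  cexp (Ci * zeta * (Num.sqrt (w ^+ 2 - h ^+ 2))%:C).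

Definition Uevan_integrand w (rho : R * R) (zeta : CC R) (h : R) : CC R :=
  (h / (2 * pi))%:C *
  (besselJ0 (h * norm2 rho) / (2 * Num.sqrt (h ^+ 2 - w ^+ 2)))%:C *
  cexp (- zeta * (Num.sqrt (h ^+ 2 - w ^+ 2))%:C).

Definition Uprop w rho zeta : CC R :=
  cintegral (@lebesgue_measure R) `]0, w[ (Uprop_integrand w rho zeta).
Definition Uevan w rho zeta : CC R :=
  cintegral (@lebesgue_measure R) `]w, +oo[ (Uevan_integrand w rho zeta).

Definition jumpJ (rho : R * R) (a w : R) : CC R :=
  Ci * (heaviside (a - norm2 rho) /
          (2 * pi * Num.sqrt (a ^+ 2 - norm2 rho ^+ 2)))%:C *
  (cosh (w * Num.sqrt (a ^+ 2 - norm2 rho ^+ 2)))%:C.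

Definition J2_integrand (rho : R * R) (a w : R) (h : R * R) : CC R :=
  ((2 * pi) ^+ 2)%:C^-1 * cexp (Ci * (dot2 h rho)%:C) *
  (csin (muf (norm2 h) w * a%:C) / muf (norm2 h) w).
Definition J1_integrand (rho : R * R) (a w : R) (h : R) : CC R :=
  (h / (2 * pi))%:C * (besselJ0 (h * norm2 rho))%:C *
  (csin (muf h w * a%:C) / muf h w).

End Defs2.

(* Main.v *)
(** Weyl's identity behind the plane-wave representation reads
      r^-1 e^{i w r} = i \int_0^w j((w^2 - m^2) s^2) e^{i zeta m} dm
                       + \int_0^oo j((w^2 + m^2) s^2) e^{- zeta m} dm
    with r^2 = s^2 + zeta^2 and J_0(x) = j(x^2).  Its right-hand side is constant
    along the path (t, z(t)) with t^2 + z(t)^2 = r^2: by Bessel's equation the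
    t-derivative of either integrand is an exact m-derivative, and the boundary
    terms at m = 0 cancel.  At t = 0 both integrals are elementary.  Polar
    coordinates (with the tangent of the angle as coordinate) and the substitution
    m = sqrt |h^2 - w^2| turn the integral over R^2 into this one.

    For the spectral form of the jump, f(m) = j((w^2 + m^2) s^2) satisfies
    f'' + s^2 f = O(m^{-3/2}), because an energy estimate for Bessel's equation
    gives J_0' = O(x^{-1/2}).  Two integrations by parts then express
    (s^2 + z^2) \int f e^{-zm} dm through an absolutely convergent integral, both
    for the truncated integral at z = -ia and for z = eps - ia, and show that the
    limits of the two coincide. *)
Require Import Defs.
From HB Require Import structures.
From mathcomp Require Import all_boot all_order all_algebra.
From mathcomp Require Import all_classical all_reals all_analysis.
From mathcomp Require Import complex.
From mathcomp Require Import measurable_realfun ring lra.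
Import ComplexField.
Import Order.TTheory GRing.Theory Num.Theory.
Import numFieldNormedType.Exports.
Local Open Scope ring_scope.
Local Open Scope classical_set_scope.
Local Open Scope complex_scope.
Set Implicit Arguments.
Unset Strict Implicit.
Unset Printing Implicit Defensive.

(** * Change of variables and polar coordinates *)

(** No contour is deformed: the rotation of (t, z) is a real one-parameter family, so the identity
    needs only differentiation under a real integral. This requires a decay rate that is uniform
    near each t. Along the path z^2 keeps the nonzero imaginary part Im zeta^2, so Re z never
    vanishes, and it decreases in |t|. The t-derivatives are dominated by means of |j| <= 1 and |j'|
    <= 1/4 on the half-line. Neither bound is visible in the power series: the first comes from
    writing J_0 as an angular average of cosines, the second from Bessel's equation. The same
    average evaluates the angular part of the integral over R^2. The spectral integrals converge
    only conditionally, their integrand in m decaying like m^{-1/2}. The jump of the beam determines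
    only the limit along zeta = eps - ia, an Abel sum, whereas the claim concerns sharp cutoffs. The
    comparison divides by s^2 + z^2, which tends to s^2 - a^2, and it uses the decay of f, which is
    absent at s = 0. *)

Section change_of_variables.
Context {R : realType}.
Notation mu := (@lebesgue_measure R).
Import HBNNSimple.
Local Open Scope ereal_scope.

(** The hypothesis on intervals says that the image of g dx under phi agrees with Lebesgue measure
    on half-open intervals; uniqueness extends this to all measurable sets, and simple functions do
    the rest. This form covers scalings of either sign and x|x|, whose derivative vanishes at 0. *)
Lemma ge0_change_of_variables (phi g : R -> R) (f : R -> \bar R) :
  measurable_fun setT phi -> measurable_fun setT g ->
  (forall x, 0 <= g x)%R ->
  (forall a b : R, (a < b)%R ->
     \int[mu]_(x in phi @^-1` `]a, b]) (g x)%:E = (b - a)%:E) ->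
  measurable_fun [set: R] f -> (forall x, 0 <= f x) ->
  \int[mu]_x f x = \int[mu]_x (f (phi x) * (g x)%:E).
Proof.
move=> mphi mg g0 H mf f0.
have mpre (A : set (measurableTypeR R)) :
      measurable A -> measurable (phi @^-1` A).
  by move=> mA; rewrite -[X in measurable X]setTI; exact: mphi.
have gint A : measurable A ->
    mu A = \int[mu]_(x in phi @^-1` A) (g x)%:E.
  move=> mA.
  pose m (B : set (measurableTypeR R)) := \int[mu]_(x in phi @^-1` B) (g x)%:E.
  have m0 : m set0 = 0 by rewrite /m preimage_set0 integral_set0.
  have mge0 B : 0 <= m B.
    by apply: integral_ge0 => x _; rewrite lee_fin.
  have msig : semi_sigma_additive m.
    move=> F mF tF mUF.
    rewrite /m preimage_bigcup ge0_integral_bigcup//=.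
    - apply: is_cvg_ereal_nneg_natsum_cond => n _ _.
      exact: mge0.
    - by move=> k; exact: mpre.
    - by apply: measurable_funTS; exact/measurable_EFinP.
    - by move=> x _; rewrite lee_fin.
    - apply/trivIsetP => i j _ _ ij; rewrite -preimage_setI.
      by move/trivIsetP : tF => -> //; rewrite preimage_set0.
  pose mx := isMeasure.Build _ _ _ m m0 mge0 msig.
  pose mm : {measure set (measurableTypeR R) -> \bar R} := HB.pack m mx.
  apply: (@lebesgue_measure_unique R mm) => //= _ [[a b]] _ <-.
  rewrite /mm/= /m.
  have [ab|ba] := ltP a b.
    by rewrite H// lebesgue_measure_itv/= lte_fin ab.
  rewrite set_itv_ge ?preimage_set0 ?integral_set0 ?measure0//.
  by rewrite bnd_simp -leNgt.
have mf' : measurable_fun [set: measurableTypeR R] f := mf.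
have mphi' : @measurable_fun _ _ (measurableTypeR R) (measurableTypeR R)
  setT phi := mphi.
have mcomp (k : measurableTypeR R -> R) : measurable_fun setT k ->
    measurable_fun [set: measurableTypeR R] (fun x => (k (phi x))%:E).
  by move=> mk; apply/measurable_EFinP; exact: (measurableT_comp mk mphi').
pose f_ := nnsfun_approx measurableT mf'.
have f_cvg x : (f_ n x)%:E @[n --> \oo] --> f x.
  by apply: cvg_nnsfun_approx.
have lhs : \int[mu]_x f x = limn (fun n => \int[mu]_x (f_ n x)%:E).
  rewrite -monotone_convergence//.
  - by apply: eq_integral => x _; apply/esym/cvg_lim => //; exact: f_cvg.
  - by move=> n; exact/measurable_EFinP/measurable_funTS.
  - by move=> *; rewrite lee_fin.
  - by move=> x _ m n mn; rewrite lee_fin; exact/lefP/nd_nnsfun_approx.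
have rhs : \int[mu]_x (f (phi x) * (g x)%:E) =
    limn (fun n => \int[mu]_x ((f_ n (phi x))%:E * (g x)%:E)).
  rewrite -monotone_convergence//.
  - apply: eq_integral => x _; apply/esym/cvg_lim => //.
    by apply: cvgeZr => //; exact: f_cvg.
  - move=> n; apply: emeasurable_funM; last exact/measurable_EFinP.
    exact: mcomp.
  - by move=> n x _; rewrite mule_ge0// lee_fin.
  - move=> x _ m n mn; rewrite lee_wpmul2r ?lee_fin//.
    by have /lefP/(_ (phi x)) := nd_nnsfun_approx measurableT mf' mn.
rewrite lhs rhs; congr (limn _); apply/funext => n.
have simple (h : {nnsfun (measurableTypeR R) >-> R}) :
    \int[mu]_x (h x)%:E = \int[mu]_x ((h (phi x))%:E * (g x)%:E).
  under eq_integral do rewrite fimfunE// -fsumEFin//.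
  rewrite ge0_integral_fsum//; last 2 first.
  - by move=> r; exact/measurable_EFinP/measurableT_comp.
  - by move=> r x _; rewrite nnfun_muleindic_ge0.
  transitivity (\int[mu]_x (\sum_(y \in range h)
     ((y * \1_(h @^-1` [set y]) (phi x))%:E * (g x)%:E))); last first.
    apply: eq_integral => x _; rewrite [in RHS]fimfunE// -fsumEFin//.
    rewrite ge0_mule_fsuml// => y; rewrite lee_fin.
    by have := nnfun_muleindic_ge0 h y (phi x); rewrite -EFinM lee_fin.
  rewrite ge0_integral_fsum//; last 2 first.
  - move=> r; apply: emeasurable_funM; last exact/measurable_EFinP.
    apply: (mcomp (fun z => r * \1_(h @^-1` [set r]) z)%R).
    by apply: measurable_funM => //.
  - move=> r x _; rewrite mule_ge0// ?lee_fin//.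
    by have := nnfun_muleindic_ge0 h r (phi x); rewrite -EFinM lee_fin.
  apply: eq_fsbigr => r /set_mem [y _ <-].
  rewrite [LHS]integralZl_indic_nnsfun//.
  under [RHS]eq_integral do rewrite EFinM -muleA.
  rewrite [RHS]ge0_integralZl//; last 3 first.
  - apply: emeasurable_funM; last exact/measurable_EFinP.
    exact: mcomp.
  - by move=> x _; rewrite mule_ge0 ?lee_fin.
  - by rewrite lee_fin.
  congr (_ * _); rewrite integral_indic// setIT.
  etransitivity; first exact: gint.
  rewrite [LHS]integral_mkcond; apply: eq_integral => x _.
  rewrite patchE indicE/=; case: ifPn => xA.
  - rewrite mem_set ?mul1e//.
    by move/set_mem : xA.
  - rewrite memNset ?mul0e//; by move/negP: xA => xA xB; apply: xA; rewrite inE.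
exact: simple.
Qed.

Lemma change_of_variables (phi g : R -> R) (f : R -> \bar R) :
  measurable_fun setT phi -> measurable_fun setT g ->
  (forall x, 0 <= g x)%R ->
  (forall a b : R, (a < b)%R ->
     \int[mu]_(x in phi @^-1` `]a, b]) (g x)%:E = (b - a)%:E) ->
  measurable_fun [set: R] f ->
  \int[mu]_x f x = \int[mu]_x (f (phi x) * (g x)%:E).
Proof.
move=> mphi mg g0 H mf.
rewrite integralE [RHS]integralE.
rewrite (ge0_change_of_variables mphi mg g0 H (f := f^\+))//; last first.
  exact: measurable_funepos.
rewrite (ge0_change_of_variables mphi mg g0 H (f := f^\-))//; last first.
  exact: measurable_funeneg.
congr (_ - _); apply: eq_integral => x _; rewrite ?funeposE ?funenegE.
- by rewrite muleC maxeMr ?lee_fin// mule0 muleC.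
- by rewrite muleC maxeMr ?lee_fin// mule0 muleN muleC.
Qed.

Lemma cvg_is_derive (f : R -> R) (x l : R) :
  (h^-1 * (f (x + h) - f x))%R @[h --> 0%R^'] --> l -> is_derive x 1%R f l.
Proof.
move=> fl.
have H : h^-1 *: ((f \o shift x) (h *: 1%R) - f x)%R @[h --> 0%R^'] --> l.
  move: fl; apply: cvg_trans; apply: near_eq_cvg; near=> h.
  by rewrite /= -[_ *: _]/(_ * _)%R [h%:A]mulr1 [(h + x)%R]addrC.
apply: DeriveDef; first by apply/cvg_ex; exists l.
by apply/cvg_lim.
Unshelve. all: by end_near. Qed.

Lemma is_derive_quadratic_bound (f : R -> R) (x l K : R) :
  (forall h, `|f (x + h) - f x - l * h| <= K * h ^+ 2)%R -> is_derive x 1%R f l.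
Proof.
move=> H; apply: cvg_is_derive; apply/cvgrPdist_le => /= e e0.
near=> h.
have h0 : h != 0%R by near: h; exact: nbhs_dnbhs_neq.
have hK : (`|h| <= e / (`|K| + 1))%R.
  near: h; apply: dnbhs0_le; by rewrite divr_gt0// ltr_wpDl.
have -> : (l - h^-1 * (f (x + h) - f x) = - (f (x + h) - f x - l * h) / h)%R.
  by field.
rewrite normrM normrN normfV ler_pdivrMr ?normr_gt0//.
apply: (le_trans (H h)); rewrite -normr_id -real_normK ?num_real// expr2 mulrA.
rewrite normr_id ler_wpM2r//.
apply: (@le_trans _ _ ((`|K| + 1) * `|h|)%R).
  by rewrite ler_wpM2r// (le_trans (ler_norm K))// lerDl.
by rewrite mulrC -ler_pdivlMr// ltr_wpDl.
Unshelve. all: by end_near. Qed.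

Lemma integral_scale (c : R) (f : R -> \bar R) : c != 0%R ->
  measurable_fun [set: R] f ->
  \int[mu]_x f x = \int[mu]_x (f (c * x)%R * `|c|%:E).
Proof.
move=> c0 mf; apply: (change_of_variables (g := cst `|c|%R)) => //.
- move=> a b ab.
  have [c_gt0|c_le0] := ltP 0%R c.
    have -> : *%R c @^-1` `]a, b] = `](a / c)%R, (b / c)%R]%classic.
      apply/seteqP; split => x /=; rewrite !in_itv/= ltr_pdivrMr// ler_pdivlMr//;
        by rewrite (mulrC x).
    rewrite (eq_integral (cst `|c|%:E))// integral_cst//= lebesgue_measure_itv/= lte_fin ltr_pM2r ?invr_gt0//.
    rewrite ab -EFinD -EFinM (gtr0_norm c_gt0) -mulrBl mulrC divfK//.
  have c_lt0 : (c < 0)%R by rewrite lt_neqAle c0.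
  have -> : *%R c @^-1` `]a, b] = `[(b / c)%R, (a / c)%R[%classic.
    apply/seteqP; split => x /=; rewrite !in_itv/= ltr_ndivlMr// ler_ndivrMr//;
        by rewrite (mulrC x) andbC.
  rewrite (eq_integral (cst `|c|%:E))// integral_cst//= lebesgue_measure_itv/= lte_fin ltr_nM2r ?invr_lt0//.
  by rewrite ab -EFinD -EFinM (ltr0_norm c_lt0) -mulrBl mulrC mulrN divfK// opprB.
Qed.

Lemma integral_shift (c : R) (f : R -> \bar R) :
  measurable_fun [set: R] f ->
  \int[mu]_x f x = \int[mu]_x f (x + c)%R.
Proof.
move=> mf.
rewrite (change_of_variables (phi := +%R^~ c) (g := cst 1%R) (f := f))//.
- by apply: eq_integral => x _; rewrite mule1.
- exact: measurable_funD.
- move=> a b ab.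
  have -> : +%R^~ c @^-1` `]a, b] = `](a - c)%R, (b - c)%R]%classic.
    by apply/seteqP; split => x /=; rewrite !in_itv/= ltrBlDr lerBrDr.
  rewrite (eq_integral (cst 1%:E))// integral_cst//= lebesgue_measure_itv/= lte_fin ltrD2r ab mul1e -EFinD.
  by congr EFin; ring.
Qed.

(** Signed square: an increasing bijection of the whole line that is x^2 on the half-line, so that
    quadratic substitutions can be made on R with no endpoint at 0. *)
Definition sgsqr (x : R) : R := (x * `|x|)%R.
Definition sgsqrt (x : R) : R :=
  if (0 <= x)%R then Num.sqrt x else (- Num.sqrt (- x))%R.

Lemma sgsqrtK : cancel sgsqrt sgsqr.
Proof.
move=> x; rewrite /sgsqr /sgsqrt; case: ifPn => [x0|].
  by rewrite ger0_norm ?sqrtr_ge0// -expr2 sqr_sqrtr.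
rewrite -ltNge => x0; rewrite normrN ger0_norm ?sqrtr_ge0// mulNr -expr2.
by rewrite sqr_sqrtr ?opprK// oppr_ge0 ltW.
Qed.

Lemma sgsqr_lt x y : (sgsqr x < sgsqr y)%R = (x < y)%R.
Proof.
have H (u v : R) : (u < v)%R -> (sgsqr u < sgsqr v)%R.
  move=> uv; rewrite /sgsqr.
  by case: (ger0P u) => u0; case: (ger0P v) => v0; nra.
have [xy|yx|->] := ltgtP x y.
- by rewrite H.
- by apply/negbTE; rewrite -leNgt ltW// H.
- by rewrite ltxx.
Qed.

Lemma is_derive_sgsqr (x : R) : is_derive x 1%R sgsqr (2 * `|x|)%R.
Proof.
apply: (@is_derive_quadratic_bound _ _ _ 1%R) => h; rewrite /sgsqr mul1r.
rewrite ler_norml.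
by case: (ger0P x) => x0; case: (ger0P (x + h)%R) => h0; apply/andP; split; nra.
Qed.

Lemma integral_sgsqr (f : R -> \bar R) : measurable_fun [set: R] f ->
  \int[mu]_x f x = \int[mu]_x (f (sgsqr x) * (2 * `|x|)%:E).
Proof.
move=> mf; apply: change_of_variables => //.
- by apply: measurable_funM => //; exact: measurableT_comp.
- by apply: measurable_funM => //; exact: measurableT_comp.
- move=> a b ab.
  have ab' : (sgsqrt a < sgsqrt b)%R by rewrite -sgsqr_lt !sgsqrtK.
  have -> : sgsqr @^-1` `]a, b] = `](sgsqrt a), (sgsqrt b)]%classic.
    apply/seteqP; split => x /=; rewrite !in_itv/=.
      by rewrite -{1}(sgsqrtK a) -{1}(sgsqrtK b) !leNgt !sgsqr_lt.
    by rewrite -{2}(sgsqrtK a) -{2}(sgsqrtK b) !leNgt !sgsqr_lt.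
  have cf : continuous (fun x : R => (2 * `|x|)%R).
    by move=> x; apply: cvgM; [exact: cvg_cst|exact: norm_continuous].
  rewrite integral_itv_obnd_cbnd; last first.
    apply: measurable_funTS; apply/measurable_EFinP.
    by apply: measurable_funM => //; exact: measurableT_comp.
  rewrite (continuous_FTC2 (F := sgsqr))//.
  - by rewrite !sgsqrtK.
  - exact: continuous_subspaceT.
  - have dF x : derivable sgsqr x 1%R by have [] := is_derive_sgsqr x.
    have cF : continuous sgsqr.
      move=> x; apply: differentiable_continuous; exact/derivable1_diffP.
    split => //.
    - by apply: cvg_at_right_filter; exact: cF.
    - by apply: cvg_at_left_filter; exact: cF.
  - by move=> x _; rewrite derive1E; have [_ ->] := is_derive_sgsqr x.
Qed.

End change_of_variables.

Section polar.
Context {R : realType}.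
Notation mR := (measurableTypeR R).
Notation mu := (@lebesgue_measure R).
Local Open Scope ereal_scope.

Lemma measurable_oneDsqr_sqrtV :
  measurable_fun [set: mR] (fun t : mR => (Num.sqrt (1 + t ^+ 2))^-1 : R)%R.
Proof.
apply: continuous_measurable_fun => t.
apply: cvgV.
  by rewrite gt_eqF// sqrtr_gt0 ltr_pwDl// sqr_ge0.
apply: (@continuous_comp _ _ _ (fun t : R => 1 + t ^+ 2)%R Num.sqrt).
  by apply: cvgD; [exact: cvg_cst|exact: sqr_continuous].
exact: sqrt_continuous.
Qed.

(** The point r (cos theta, sin theta) with t = tan theta. The radius is signed: theta runs over a
    half-turn and r over all of R, which covers the plane up to the axis where the first coordinate
    vanishes. *)
Definition polar_map (p : mR * mR) : mR * mR :=
  ((p.1 / Num.sqrt (1 + p.2 ^+ 2))%R, (p.1 * p.2 / Num.sqrt (1 + p.2 ^+ 2))%R).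
Definition polar_jac (p : mR * mR) : R := (`|p.1| / (1 + p.2 ^+ 2))%R.

Lemma polar_jac_ge0 p : (0 <= polar_jac p)%R.
Proof. by rewrite divr_ge0// addr_ge0// sqr_ge0. Qed.

Lemma measurable_polar_map : measurable_fun [set: mR * mR] polar_map.
Proof.
have mc : measurable_fun [set: mR * mR]
    (fun p : mR * mR => (Num.sqrt (1 + p.2 ^+ 2))^-1 : R)%R.
  exact: (measurableT_comp measurable_oneDsqr_sqrtV measurable_snd).
apply: measurable_fun_pair.
- exact: measurable_funM.
- apply: measurable_funM => //.
  exact: (@measurable_funM _ _ R).
Qed.

Lemma measurable_polar_jac : measurable_fun [set: mR * mR] polar_jac.
Proof.
have mc : measurable_fun [set: mR * mR]
    (fun p : mR * mR => (1 + p.2 ^+ 2)^-1 : R)%R.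
  have m1 : measurable_fun [set: mR] (fun t : mR => (1 + t ^+ 2)^-1 : R)%R.
    by apply: continuous_measurable_fun; exact: continuous_oneDsqrV.
  exact: (measurableT_comp m1 measurable_snd).
apply: measurable_funM => //.
by apply: (measurableT_comp (@normr_measurable R setT)).
Qed.

Lemma measurable_shear (f : mR * mR -> \bar R) :
  measurable_fun [set: mR * mR] f -> measurable_fun [set: mR * mR]
    (fun p : mR * mR => f (p.1, (p.1 * p.2)%R) * (`|p.1|%R)%:E).
Proof.
move=> mf; apply: emeasurable_funM.
  have mshear : measurable_fun [set: mR * mR]
      (fun p : mR * mR => (p.1, (p.1 * p.2)%R) : mR * mR).
    by apply: measurable_fun_pair => //; exact: (@measurable_funM _ _ R).
  exact: (measurableT_comp mf mshear).
by apply/measurable_EFinP; apply: (measurableT_comp (@normr_measurable R setT)).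
Qed.

Lemma measurable_polar (f : mR * mR -> \bar R) :
  measurable_fun [set: mR * mR] f -> measurable_fun [set: mR * mR]
    (fun p : mR * mR => f (polar_map p) * (polar_jac p)%:E).
Proof.
move=> mf.
apply: emeasurable_funM; first exact: (measurableT_comp mf measurable_polar_map).
by apply/measurable_EFinP; exact: measurable_polar_jac.
Qed.

(** On the line of abscissa x the scaling y = x t is admissible unless x = 0, hence the statement
    almost everywhere. *)
Lemma shear_ae (f : mR * mR -> \bar R) : measurable_fun [set: mR * mR] f ->
  ae_eq mu setT (fun x => \int[mu]_y f (x, y))
    (fun x => \int[mu]_t (f (x, (x * t)%R) * (`|x|%R)%:E)).
Proof.
move=> mf; exists [set 0%R]; split; [by []|exact: lebesgue_measure_set1|].
move=> x /=; apply: contra_notP => /eqP x0 _.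
by rewrite [LHS](integral_scale (c := x))//; exact: measurable_fun_pair2.
Qed.

Lemma shear_scale (f : mR * mR -> \bar R) (t : mR) :
  measurable_fun [set: mR * mR] f ->
  \int[mu]_x (f (x, (x * t)%R) * (`|x|%R)%:E) =
  \int[mu]_r (f (polar_map (r, t)) * (polar_jac (r, t))%:E).
Proof.
move=> mf.
have st : (0 < 1 + t ^+ 2)%R by rewrite ltr_pwDl// sqr_ge0.
have s0 : (0 < Num.sqrt (1 + t ^+ 2))%R by rewrite sqrtr_gt0.
rewrite [LHS](integral_scale (c := (Num.sqrt (1 + t ^+ 2))^-1)); last 2 first.
- by rewrite invr_eq0 gt_eqF.
- exact: (measurable_fun_pair1 t (measurable_shear mf)).
apply: eq_integral => r _; rewrite /polar_map /polar_jac/= -muleA.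
congr (_ * _).
- by congr (f (_, _)); rewrite -?mulrA mulrC ?mulrA.
- rewrite -EFinM; congr EFin; rewrite normrM normfV (gtr0_norm s0).
  by rewrite mulrAC mulrC -invfM -expr2 sqr_sqrtr// ltW.
Qed.

(** The planar substitution splits into two scalings in one variable: y = x t at fixed x, then,
    after Tonelli, x = r / sqrt (1 + t^2) at fixed t. Their Jacobians multiply to |r| / (1 +
    t^2). *)
Lemma ge0_polar (f : mR * mR -> \bar R) :
  measurable_fun [set: mR * mR] f -> (forall p, 0 <= f p) ->
  \int[mu \x mu]_p f p =
  \int[mu \x mu]_p (f (polar_map p) * (polar_jac p)%:E).
Proof.
move=> mf f0.
have g0 (p : mR * mR) : 0 <= f (p.1, (p.1 * p.2)%R) * (`|p.1|%R)%:E.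
  by rewrite mule_ge0// lee_fin.
have h0 (p : mR * mR) : 0 <= f (polar_map p) * (polar_jac p)%:E.
  by rewrite mule_ge0// lee_fin polar_jac_ge0.
etransitivity; first exact: (@fubini_tonelli1 _ _ _ _ R mu mu f mf f0).
etransitivity.
  apply: (@ae_eq_integral _ _ _ mu setT
    (fubini_F mu (fun p : mR * mR => f (p.1, (p.1 * p.2)%R) * (`|p.1|%R)%:E))
    (fubini_F mu f) measurableT).
  - exact: (@measurable_fun_fubini_tonelli_F _ _ _ _ R mu f mf f0).
  - exact: (@measurable_fun_fubini_tonelli_F _ _ _ _ R mu _ (measurable_shear mf) g0).
  - exact: shear_ae.
etransitivity.
  exact: (@fubini_tonelli _ _ _ _ R mu mu _ (measurable_shear mf) g0).
etransitivity; last first.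
  symmetry.
  exact: (@fubini_tonelli2 _ _ _ _ R mu mu _ (measurable_polar mf) h0).
by apply: eq_integral => t _; exact: shear_scale.
Qed.

Lemma polar (f : mR * mR -> \bar R) : measurable_fun [set: mR * mR] f ->
  \int[mu \x mu]_p f p =
  \int[mu \x mu]_p (f (polar_map p) * (polar_jac p)%:E).
Proof.
move=> mf; rewrite integralE [RHS]integralE.
rewrite (ge0_polar (f := f^\+))//; last exact: measurable_funepos.
rewrite (ge0_polar (f := f^\-))//; last exact: measurable_funeneg.
congr (_ - _); apply: eq_integral => x _; rewrite ?funeposE ?funenegE.
- by rewrite muleC maxeMr ?lee_fin ?polar_jac_ge0// mule0 muleC.
- by rewrite muleC maxeMr ?lee_fin ?polar_jac_ge0// mule0 muleN muleC.
Qed.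

End polar.

(** * Real calculus *)

Section real_derivatives.
Context {R : realType}.
Implicit Types (f g : R -> R) (x : R).

Lemma dEq f x (l l' : R) : is_derive x 1 f l -> l = l' -> is_derive x 1 f l'.
Proof. by move=> H <-. Qed.

Lemma dExt f g x (l : R) : f =1 g -> is_derive x 1 f l -> is_derive x 1 g l.
Proof. by move=> /funext <-. Qed.

Lemma dCst (c x : R) : is_derive x 1 (fun=> c) 0.
Proof. exact: is_derive_cst. Qed.

Lemma dId x : is_derive x 1 (fun y : R => y) 1.
Proof. exact: is_derive_id. Qed.

Lemma dN f x (l : R) : is_derive x 1 f l -> is_derive x 1 (fun y => - f y) (- l).
Proof. by move=> H; exact: is_deriveN. Qed.

Lemma dD f g x (l m : R) : is_derive x 1 f l -> is_derive x 1 g m ->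
  is_derive x 1 (fun y => f y + g y) (l + m).
Proof. by move=> H K; exact: is_deriveD. Qed.

Lemma dB f g x (l m : R) : is_derive x 1 f l -> is_derive x 1 g m ->
  is_derive x 1 (fun y => f y - g y) (l - m).
Proof. by move=> H K; exact: is_deriveB. Qed.

Lemma dM f g x (l m : R) : is_derive x 1 f l -> is_derive x 1 g m ->
  is_derive x 1 (fun y => f y * g y) (l * g x + f x * m).
Proof.
move=> H K; apply: (dEq (is_deriveM H K)).
by rewrite /GRing.scale/= addrC (mulrC l).
Qed.

Lemma dZ f x (c l : R) : is_derive x 1 f l -> is_derive x 1 (fun y => c * f y) (c * l).
Proof. by move=> H; apply: (dEq (dM (dCst c x) H)); rewrite mul0r add0r. Qed.

Lemma dX f x (l : R) n : is_derive x 1 f l ->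
  is_derive x 1 (fun y => f y ^+ n) (n%:R * f x ^+ n.-1 * l).
Proof.
move=> H; elim: n => [|[|n] IH].
- by apply: (dEq (dCst 1 x)); rewrite !mul0r.
- by apply: (dEq H); rewrite mulr1 mul1r.
- have E := dM H IH; apply: (dExt _ (dEq E _)) => [y|/=]; first by rewrite [RHS]exprS.
  by rewrite [f x ^+ n.+1]exprS -[n.+2%:R]natr1; ring.
Qed.

Lemma dV f x (l : R) : is_derive x 1 f l -> f x != 0 ->
  is_derive x 1 (fun y => (f y)^-1) (- (l / f x ^+ 2)).
Proof.
move=> H f0; apply: (dEq (is_deriveV f0 H)).
by rewrite /GRing.scale/= mulNr mulrC.
Qed.

Lemma dComp f g x (l m : R) : is_derive (g x) 1 f l -> is_derive x 1 g m ->
  is_derive x 1 (fun y => f (g y)) (l * m).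
Proof. by move=> H K; exact: (is_derive1_comp H K). Qed.

Lemma dSqrt f x (l : R) : is_derive x 1 f l -> 0 < f x ->
  is_derive x 1 (fun y => Num.sqrt (f y)) (l / (2 * Num.sqrt (f x))).
Proof.
move=> H f0; apply: (dEq (dComp (is_derive1_sqrt f0) H)).
by rewrite mulrC.
Qed.

Lemma dExp f x (l : R) : is_derive x 1 f l ->
  is_derive x 1 (fun y => expR (f y)) (expR (f x) * l).
Proof. by move=> H; exact: (dComp (is_derive_expR (f x)) H). Qed.

Lemma dSin f x (l : R) : is_derive x 1 f l ->
  is_derive x 1 (fun y => sin (f y)) (cos (f x) * l).
Proof. by move=> H; exact: (dComp (is_derive_sin (f x)) H). Qed.

Lemma dCos f x (l : R) : is_derive x 1 f l ->
  is_derive x 1 (fun y => cos (f y)) (- sin (f x) * l).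
Proof. by move=> H; exact: (dComp (is_derive_cos (f x)) H). Qed.

End real_derivatives.

(** * Integration on the line and the weight 1 / (1 + t^2) *)

Section real_integrals.
Context {R : realType}.
Notation mu := (@lebesgue_measure R).

Lemma is_derive_continuous (F f : R -> R) :
  (forall x : R, is_derive x 1 F (f x)) -> continuous F.
Proof.
move=> dF x; apply: differentiable_continuous; apply/derivable1_diffP.
by have [] := dF x.
Qed.

Lemma continuous_integrable_itv (f : R -> R) (a b : R) : continuous f ->
  mu.-integrable `[a, b] (EFin \o f).
Proof.
move=> cf; apply: continuous_compact_integrable; first exact: segment_compact.
exact: continuous_subspaceT.
Qed.

Lemma Rintegral_FTC (F f : R -> R) (a b : R) : a <= b -> continuous f ->
  (forall x : R, is_derive x 1 F (f x)) ->
  Rintegral mu `[a, b] f = F b - F a.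
Proof.
rewrite le_eqVlt => /orP[/eqP <- _ _|ab cf dF].
  by rewrite set_itv1 Rintegral_set1 subrr.
rewrite /Rintegral (continuous_FTC2 (F := F))//.
- exact: continuous_subspaceT.
- have cF := is_derive_continuous dF.
  split.
  - by move=> x _; have [] := dF x.
  - by apply: cvg_at_right_filter; exact: cF.
  - by apply: cvg_at_left_filter; exact: cF.
- by move=> x _; rewrite derive1E; have [_ ->] := dF x.
Qed.

Lemma Rintegral_dominated d (T : measurableType d)
    (nu : {measure set T -> \bar R}) (D : set T)
    (f_ : nat -> T -> R) (f g : T -> R) :
  measurable D -> (forall n, measurable_fun D (f_ n)) ->
  measurable_fun D f ->
  (forall x, D x -> f_ n x @[n --> \oo] --> f x) ->
  nu.-integrable D (EFin \o g) ->
  (forall n x, D x -> `|f_ n x| <= g x) ->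
  Rintegral nu D (f_ n) @[n --> \oo] --> Rintegral nu D f.
Proof.
move=> mD mf_ mf f_f ig fg.
have [|||||intf _ H] := @dominated_convergence _ _ _ nu D mD
  (fun n x => (f_ n x)%:E) (EFin \o f) (EFin \o g).
- by move=> n; apply/measurable_EFinP; exact: mf_.
- exact/measurable_EFinP.
- by apply: aeW => x Dx; apply: cvg_EFin; [exact: nearW|exact: f_f].
- exact: ig.
- by apply: aeW => x n Dx; rewrite lee_fin; exact: fg.
apply: fine_cvg; rewrite fineK; first exact: H.
exact: integrable_fin_num.
Qed.

Lemma cvg_Rintegral_exhaust (D : set R) (u v : nat -> R) (f : R -> R) :
  measurable D -> (forall n, `[u n, v n] `<=` D) ->
  (forall x, D x -> \forall n \near \oo, u n <= x <= v n) ->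
  mu.-integrable D (EFin \o f) ->
  Rintegral mu `[u n, v n] f @[n --> \oo] --> Rintegral mu D f.
Proof.
move=> mD uvD Duv fD.
have mf : measurable_fun D f by apply/measurable_EFinP; exact: (measurable_int mu).
have -> : (fun n => Rintegral mu `[u n, v n] f) =
    (fun n => Rintegral mu D (f \_ `[u n, v n])).
  apply/funext => n; rewrite -Rintegral_mkcondr; congr Rintegral.
  by apply/esym/setIidPr.
apply: (@Rintegral_dominated _ (measurableTypeR R) mu D
  (fun n => f \_ `[u n, v n]) f (Num.norm \o f)) => //.
- move=> n; apply/measurable_restrict => //.
  by apply: measurable_funS mf => //; exact: subIsetl.
- move=> x Dx; have [N _ HN] := Duv x Dx.
  apply: cvg_near_cst; exists N => // n Nn /=.
  by rewrite patchE mem_set//= in_itv/=; exact: HN.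
- exact: integrable_norm.
- by move=> n x Dx; rewrite patchE /=; case: ifP => _; rewrite ?normr0.
Qed.

Lemma Rintegral_FTC_exhaust (D : set R) (u v : nat -> R) (F f : R -> R) (A B : R) :
  measurable D -> (forall n, u n <= v n) -> (forall n, `[u n, v n] `<=` D) ->
  (forall x, D x -> \forall n \near \oo, u n <= x <= v n) ->
  mu.-integrable D (EFin \o f) -> continuous f ->
  (forall x : R, is_derive x 1 F (f x)) ->
  F (u n) @[n --> \oo] --> A -> F (v n) @[n --> \oo] --> B ->
  Rintegral mu D f = B - A.
Proof.
move=> mD uv uvD Duv fD cf dF FA FB.
have H1 := cvg_Rintegral_exhaust mD uvD Duv fD.
have H2 : Rintegral mu `[u n, v n] f @[n --> \oo] --> B - A.
  have -> : (fun n => Rintegral mu `[u n, v n] f) = (fun n => F (v n) - F (u n)).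
    by apply/funext => n; exact: Rintegral_FTC.
  exact: cvgB.
by apply: (cvg_unique _ H1 H2).
Qed.

Lemma Rintegral_FTC_T (F f : R -> R) (A B : R) :
  mu.-integrable setT (EFin \o f) -> continuous f ->
  (forall x : R, is_derive x 1 F (f x)) ->
  F (- n%:R) @[n --> \oo] --> A -> F n%:R @[n --> \oo] --> B ->
  Rintegral mu setT f = B - A.
Proof.
move=> fi cf dF FA FB.
apply: (@Rintegral_FTC_exhaust setT (fun n => - n%:R) (fun n => n%:R) F) => //.
- by move=> n; rewrite (@le_trans _ _ 0)// oppr_le0.
- move=> x _; near=> n.
  rewrite -ler_norml; near: n; exact: nbhs_infty_ger.
Unshelve. all: by end_near. Qed.

Lemma Rintegral_FTC_y (F f : R -> R) (B : R) :
  mu.-integrable `[0, +oo[ (EFin \o f) -> continuous f ->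
  (forall x : R, is_derive x 1 F (f x)) ->
  F n%:R @[n --> \oo] --> B ->
  Rintegral mu `[0, +oo[ f = B - F 0.
Proof.
move=> fi cf dF FB.
apply: (@Rintegral_FTC_exhaust _ (fun n => 0) (fun n => n%:R) F) => //.
- move=> n x /=; rewrite !in_itv/= => /andP[-> _] //.
- move=> x /=; rewrite in_itv/= andbT => x0; near=> n.
  rewrite x0/= (le_trans (ler_norm x))//; near: n; exact: nbhs_infty_ger.
- exact: cvg_cst.
Unshelve. all: by end_near. Qed.

Lemma oneDsqr_gt0' (t : R) : 0 < 1 + t ^+ 2.
Proof. by rewrite ltr_pwDl// sqr_ge0. Qed.

Lemma integrable_oneDsqrV : mu.-integrable setT (EFin \o (fun t : R => (1 + t ^+ 2)^-1)).
Proof.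
have m1 : measurable_fun [set: measurableTypeR R] (fun t : R => (1 + t ^+ 2)^-1).
  by apply: continuous_measurable_fun; exact: continuous_oneDsqrV.
apply/integrableP; split; first exact/measurable_EFinP.
under eq_integral => t _.
  rewrite /= ger0_norm; last by rewrite invr_ge0 ltW// oneDsqr_gt0'.
  over.
rewrite ge0_symfun_integralT//=; last 1 first.
- by move=> t /=; rewrite sqrrN.
- rewrite (_ : [set x | _] = `[0%R, +oo[%classic); last first.
    by apply/seteqP; split=> x /=; rewrite in_itv/= andbT.
  have -> : (\int[mu]_(x in `[0%R, +oo[) ((1 + x ^+ 2)^-1)%:E)%E = (pi / 2)%:E.
    exact: integral0y_oneDsqr.
  by rewrite -EFinM ltry.
- by move=> t; rewrite invr_ge0 ltW// oneDsqr_gt0'.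
- exact: continuous_oneDsqrV.
Qed.

Lemma Rintegral_oneDsqrV : Rintegral mu setT (fun t : R => (1 + t ^+ 2)^-1) = pi.
Proof.
rewrite /Rintegral ge0_symfun_integralT//=.
- rewrite (_ : [set x | _] = `[0%R, +oo[%classic); last first.
    by apply/seteqP; split=> x /=; rewrite in_itv/= andbT.
  have -> : (\int[mu]_(x in `[0%R, +oo[) ((1 + x ^+ 2)^-1)%:E)%E = (pi / 2)%:E.
    exact: integral0y_oneDsqr.
  by rewrite -EFinM /= mulrC divfK.
- by move=> t; rewrite invr_ge0 ltW// oneDsqr_gt0'.
- exact: continuous_oneDsqrV.
- by move=> t /=; rewrite sqrrN.
Qed.

Lemma integrable_bounded_oneDsqrV (k : R -> R) (M : R) :
  measurable_fun setT k -> (forall t, `|k t| <= M) ->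
  mu.-integrable setT (EFin \o (fun t : R => k t / (1 + t ^+ 2))).
Proof.
move=> mk kM.
have m1 : measurable_fun [set: measurableTypeR R] (fun t : R => (1 + t ^+ 2)^-1).
  by apply: continuous_measurable_fun; exact: continuous_oneDsqrV.
apply: (@le_integrable _ _ _ mu setT _ _
   (fun t => M%:E * ((1 + t ^+ 2)^-1)%:E)%E) => //.
- by apply/measurable_EFinP; exact: measurable_funM.
- move=> t _; rewrite /= lee_fin !normrM.
  rewrite ler_wpM2r// (le_trans (kM t))// ler_norm//.
- exact: integrableZl integrable_oneDsqrV.
Qed.

End real_integrals.

(** * The Bessel function J_0 *)

Section angular.
Context {R : realType}.
Notation mu := (@lebesgue_measure R).

(** This is a cos theta + b sin theta for t = tan theta, and dt / (1 + t^2) = d theta.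
    Differentiation in theta therefore replaces (a, b) by (b, -a). *)
Definition circ (a b t : R) : R := (a + b * t) / Num.sqrt (1 + t ^+ 2).

Lemma is_derive_circ (a b t : R) :
  is_derive t 1 (circ a b) (circ b (- a) t / (1 + t ^+ 2)).
Proof.
have s0 : 0 < 1 + t ^+ 2 := oneDsqr_gt0' t.
have q0 : 0 < Num.sqrt (1 + t ^+ 2) by rewrite sqrtr_gt0.
have d1 : is_derive t 1 (fun t : R => 1 + t ^+ 2) (2 * t).
  by apply: (dEq (dD (dCst 1 t) (dX 2 (dId t)))); rewrite add0r mulr1 expr1.
have d4 : is_derive t 1 (fun t : R => a + b * t) b.
  by apply: (dEq (dD (dCst a t) (dZ b (dId t)))); rewrite add0r mulr1.
have d3 := dV (dSqrt d1 s0) (lt0r_neq0 q0).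
apply: (dEq (dM d4 d3)); rewrite /circ/=.
have e : Num.sqrt (1 + t ^+ 2) ^+ 2 = 1 + t ^+ 2 by rewrite sqr_sqrtr// ltW.
rewrite e; field: e.
by rewrite gt_eqF// gt_eqF.
Qed.

Lemma continuous_circ (a b : R) : continuous (circ a b).
Proof. exact: is_derive_continuous (is_derive_circ a b). Qed.

Lemma circ_sqr (a b t : R) : circ a b t ^+ 2 + circ b (- a) t ^+ 2 = a ^+ 2 + b ^+ 2.
Proof.
have s0 : 0 < 1 + t ^+ 2 := oneDsqr_gt0' t.
rewrite /circ !expr_div_n sqr_sqrtr ?ltW// -mulrDl.
have n0 : 1 + t ^+ 2 != 0 by rewrite gt_eqF.
field.
by rewrite gt_eqF.
Qed.

Lemma circ_le (a b t : R) : circ a b t ^+ 2 <= a ^+ 2 + b ^+ 2.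
Proof. by rewrite -(circ_sqr a b t) lerDl sqr_ge0. Qed.

Lemma circN (a b t : R) : circ a b (- t) = circ a (- b) t.
Proof. by rewrite /circ sqrrN mulrN mulNr. Qed.

(** Reflection of the angle in pi/4; it turns the limit at infinity into continuity at 0. *)
Lemma circ_inv (a b t : R) : 0 < t -> circ a b t = circ b a t^-1.
Proof.
move=> t0; have t1 : 0 < t^-1 by rewrite invr_gt0.
have e : 1 + t ^+ 2 = t ^+ 2 * (1 + t^-1 ^+ 2).
  by rewrite mulrDr mulr1 -exprMn divff ?gt_eqF// expr1n addrC.
rewrite /circ e sqrtrM ?sqr_ge0// sqrtr_sqr gtr0_norm//.
have m0 : Num.sqrt (1 + t^-1 ^+ 2) != 0.
  by rewrite gt_eqF// sqrtr_gt0 oneDsqr_gt0'.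
rewrite invfM mulrA; congr (_ / _).
by rewrite mulrDl mulfK ?gt_eqF// addrC.
Qed.

Lemma circ_cvg (a b : R) : circ a b n%:R @[n --> \oo] --> b.
Proof.
have e : circ b a 0 = b.
  by rewrite /circ mulr0 addr0 expr0n addr0 sqrtr1 divr1.
have H : circ b a (n.+1%:R^-1) @[n --> \oo] --> b.
  rewrite -[X in _ --> X]e.
  apply: (@cvg_comp _ _ _ (fun n : nat => n.+1%:R^-1) (circ b a) _ (nbhs 0)).
    exact: cvg_harmonic.
  exact: continuous_circ.
rewrite -cvg_shiftS; move: H; apply: cvg_trans; apply: near_eq_cvg.
by apply: nearW => n /=; rewrite [RHS]circ_inv.
Qed.

Lemma measurable_circ (a b : R) : measurable_fun setT (circ a b).
Proof. by apply: continuous_measurable_fun; exact: continuous_circ. Qed.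

Lemma circ_normX (a b t : R) n : `|circ a b t ^+ n| <= Num.sqrt (a ^+ 2 + b ^+ 2) ^+ n.
Proof.
rewrite normrX; apply: lerXn2r; rewrite ?nnegrE ?sqrtr_ge0//.
by rewrite -sqrtr_sqr ler_wsqrtr// circ_le.
Qed.

Lemma integrable_circX (a b : R) n :
  mu.-integrable setT (EFin \o (fun t : R => circ a b t ^+ n / (1 + t ^+ 2))).
Proof.
apply: (integrable_bounded_oneDsqrV (M := Num.sqrt (a ^+ 2 + b ^+ 2) ^+ n)).
  by apply: measurable_funX; exact: measurable_circ.
by move=> t; exact: circ_normX.
Qed.

Definition circ_moment (a b : R) n : R :=
  Rintegral mu setT (fun t : R => circ a b t ^+ n.*2 / (1 + t ^+ 2)).

(** Wallis recursion. With c = a cos theta + b sin theta and c' its angular derivative, c' c^(2n+1)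
    is integrated over the half-turn. This product is unchanged when theta increases by pi, so its
    limits at both ends agree and the boundary terms cancel. *)
Lemma circ_momentS (a b : R) n :
  n.+1.*2%:R * circ_moment a b n.+1 =
  n.*2.+1%:R * (a ^+ 2 + b ^+ 2) * circ_moment a b n.
Proof.
pose F t := circ b (- a) t * circ a b t ^+ n.*2.+1.
pose f t := n.*2.+1%:R * (a ^+ 2 + b ^+ 2) * (circ a b t ^+ n.*2 / (1 + t ^+ 2))
  - n.+1.*2%:R * (circ a b t ^+ n.+1.*2 / (1 + t ^+ 2)).
have dF (t : R) : is_derive t 1 F (f t).
  have d1 := is_derive_circ b (- a) t.
  have d2 := dX n.*2.+1 (is_derive_circ a b t).
  apply: (dEq (dM d1 d2)); rewrite /f -(circ_sqr a b t) doubleS /=.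
  rewrite (_ : circ (- a) (- b) t = - circ a b t); last first.
    by rewrite /circ mulNr -opprD mulNr.
  rewrite !exprS.
  rewrite -[n.*2.+2%:R]natr1.
  by ring.
have ccX (k : nat) : continuous (fun t : R => circ a b t ^+ k / (1 + t ^+ 2)).
  move=> t; apply: cvgM; last exact: continuous_oneDsqrV.
  apply: (@continuous_comp _ _ _ (circ a b) (fun x => x ^+ k)).
    exact: continuous_circ.
  exact: exprn_continuous.
have cf : continuous f.
  move=> t; apply: cvgB; (apply: cvgM; [exact: cvg_cst|exact: ccX]).
have iZ (k : nat) (c : R) :
    mu.-integrable setT (EFin \o (fun t : R => c * (circ a b t ^+ k / (1 + t ^+ 2)))).
  exact: (integrableZl measurableT c (integrable_circX a b k)).
have fi : mu.-integrable setT (EFin \o f).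
  exact: (integrableB measurableT (iZ _ _) (iZ _ _)).
have FA : F (- n%:R) @[n --> \oo] --> a * (- b) ^+ n.*2.+1.
  rewrite /F; under eq_fun do rewrite !circN opprK.
  apply: cvgM; first exact: circ_cvg.
  apply: (cvg_comp _ (fun x : R => x ^+ n.*2.+1)); first exact: circ_cvg.
  exact: exprn_continuous.
have FB : F n%:R @[n --> \oo] --> - a * b ^+ n.*2.+1.
  apply: cvgM; first exact: circ_cvg.
  apply: (cvg_comp _ (fun x : R => x ^+ n.*2.+1)); first exact: circ_cvg.
  exact: exprn_continuous.
have := Rintegral_FTC_T fi cf dF FA FB.
rewrite exprNn -signr_odd /= odd_double /= expr1 mulN1r mulNr mulrN opprK addNr.
rewrite (RintegralB _ (iZ _ _) (iZ _ _))//.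
rewrite !(RintegralZl _ _ (integrable_circX a b _))//.
by move/eqP; rewrite subr_eq0 => /eqP <-.
Qed.

Lemma circ_momentE (a b : R) n : circ_moment a b n =
  pi * (a ^+ 2 + b ^+ 2) ^+ n * n.*2`!%:R / (4 ^+ n * n`!%:R ^+ 2).
Proof.
elim: n => [|n IH].
  rewrite /circ_moment double0 fact0 !expr0 expr1n !mulr1 divr1.
  rewrite -[RHS]Rintegral_oneDsqrV; apply: eq_Rintegral => t _.
  by rewrite expr0 mul1r.
have n0 : n.+1.*2%:R != 0 :> R by rewrite pnatr_eq0.
apply: (mulfI n0); rewrite circ_momentS IH.
rewrite doubleS !factS !natrM -!mul2n !exprS.
have h1 : n`!%:R != 0 :> R by rewrite pnatr_eq0 -lt0n fact_gt0.
have h2 : n.+1%:R != 0 :> R by rewrite pnatr_eq0.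
have h3 : 4 ^+ n != 0 :> R by rewrite expf_neq0// pnatr_eq0.
rewrite -[(2 * n).+2]/(2 * n).+2 -[(2 * n).+2%:R]natr1 -[(2 * n).+1%:R]natr1 natrM.
rewrite -[n.+1%:R]natr1 in h2 *.
by field; rewrite h1 h2 h3.
Qed.

End angular.

Section bessel_angular.
Context {R : realType}.
Notation mu := (@lebesgue_measure R).

Lemma series_exp_coeff_le (x : R) n : 0 <= x -> series (exp_coeff x) n <= expR x.
Proof.
move=> x0; apply: nondecreasing_cvgn_le; last exact: is_cvg_series_exp_coeff.
apply: nondecreasing_series => k _ _; exact: exp_coeff_ge0.
Qed.

(** Since (2k)! >= k!, the partial sums of cos y are dominated by those of exp (y^2), uniformly in
    n. This is the majorant for integrating the cosine series termwise. *)
Lemma norm_series_cos_coeff'_le (y : R) n :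
  `|series (cos_coeff' y) n| <= expR (y ^+ 2).
Proof.
apply: (le_trans _ (series_exp_coeff_le n (sqr_ge0 y))).
apply: (le_trans (ler_norm_sum _ _ _)); apply: ler_sum => k _.
rewrite /cos_coeff' /exp_coeff -[(-1) ^ k]/((-1) ^+ k) !normrM normrX normrN1.
rewrite expr1n mul1r normfV normr_nat normrX /= -mul2n exprM real_normK ?num_real//.
have yk : 0 <= (y ^+ 2) ^+ k by apply: exprn_ge0; exact: sqr_ge0.
rewrite ler_wpM2l//.
rewrite lef_pV2 ?posrE ?ltr0n ?fact_gt0// ler_nat.
by apply: leq_fact; rewrite mul2n -addnn leq_addr.
Qed.

Definition bessel_term (x : R) (k : nat) : R :=
  (-1) ^+ k * (x / 2) ^+ (2 * k) / k`!%:R ^+ 2.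

(** The even moments of [circ] carry the factor (2n)! / (4^n n!^2), which turns the Taylor
    coefficients of cos into those of J_0. *)
Lemma integral_series_circ (a b x : R) n :
  let S := fun t : R => series (cos_coeff' (x * circ a b t)) n / (1 + t ^+ 2) in
  mu.-integrable setT (EFin \o S) /\
  Rintegral mu setT S =
    pi * series (bessel_term (x * Num.sqrt (a ^+ 2 + b ^+ 2))) n.
Proof.
move=> S; rewrite {}/S; elim: n => [|n [IHi IHE]].
  have -> : (fun t : R => series (cos_coeff' (x * circ a b t)) 0 / (1 + t ^+ 2)) =
      cst 0.
    by apply/funext => t; rewrite /series/= big_geq// mul0r.
  split; first exact: integrable0.
  by rewrite /series/= big_geq// mulr0 Rintegral_cst// mul0r.
pose c := (-1) ^+ n * x ^+ n.*2 / n.*2`!%:R.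
have E : (fun t : R => series (cos_coeff' (x * circ a b t)) n.+1 / (1 + t ^+ 2)) =
  (fun t : R => series (cos_coeff' (x * circ a b t)) n / (1 + t ^+ 2) +
     c * (circ a b t ^+ n.*2 / (1 + t ^+ 2))).
  apply/funext => t; rewrite /series/= big_nat_recr//= mulrDl; congr (_ + _).
  rewrite /cos_coeff' /c exprMn -[(-1) ^ n]/((-1) ^+ n).
  by rewrite -!mulrA; congr (_ * (_ * _)); rewrite mulrCA.
have iZ : mu.-integrable setT
    (EFin \o (fun t : R => c * (circ a b t ^+ n.*2 / (1 + t ^+ 2)))).
  exact: (integrableZl measurableT c (integrable_circX a b n.*2)).
rewrite E; split; first exact: (integrableD measurableT IHi iZ).
rewrite (RintegralD _ IHi iZ)// IHE (RintegralZl _ _ (integrable_circX a b _))//.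
rewrite -/(circ_moment a b n) circ_momentE [in RHS]/series/= big_nat_recr//=.
rewrite mulrDr; congr (_ + _); rewrite /bessel_term /c.
have h1 : n`!%:R != 0 :> R by rewrite pnatr_eq0 -lt0n fact_gt0.
have h2 : n.*2`!%:R != 0 :> R by rewrite pnatr_eq0 -lt0n fact_gt0.
have h3 : 4 ^+ n != 0 :> R by rewrite expf_neq0// pnatr_eq0.
have -> : (x * Num.sqrt (a ^+ 2 + b ^+ 2) / 2) ^+ (2 * n) =
    x ^+ n.*2 * (a ^+ 2 + b ^+ 2) ^+ n / 4 ^+ n.
  have -> : (x * Num.sqrt (a ^+ 2 + b ^+ 2) / 2) ^+ (2 * n) =
      x ^+ (2 * n) * (Num.sqrt (a ^+ 2 + b ^+ 2) ^+ 2) ^+ n * (2^-1 ^+ 2) ^+ n.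
    by rewrite -!exprM -!exprMn.
  rewrite sqr_sqrtr ?addr_ge0 ?sqr_ge0// mul2n -exprVn; congr (_ * _ ^+ _).
  by field.
by field; rewrite h1 h2 h3.
Qed.

Lemma besselJ0_angular_cvg (a b x : R) :
  series (bessel_term (x * Num.sqrt (a ^+ 2 + b ^+ 2))) @ \oo -->
  Rintegral mu setT (fun t : R => cos (x * circ a b t) / (1 + t ^+ 2)) / pi.
Proof.
have cc n : continuous (fun t : R => series (cos_coeff' (x * circ a b t)) n / (1 + t ^+ 2)).
  move=> t; apply: cvgM; last exact: continuous_oneDsqrV.
  rewrite /series/=; apply: (@cvg_big _ _ +%R) => //; first exact: add_continuous.
  move=> k _; rewrite /cos_coeff'.
  apply: cvgM; last exact: cvg_cst.
  apply: cvgM; first exact: cvg_cst.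
  apply: (@continuous_comp _ _ _ (fun t => x * circ a b t) (fun y => y ^+ k.*2)).
    by apply: cvgM; [exact: cvg_cst|exact: continuous_circ].
  exact: exprn_continuous.
have ccos : continuous (fun t : R => cos (x * circ a b t) / (1 + t ^+ 2)).
  move=> t; apply: cvgM; last exact: continuous_oneDsqrV.
  apply: (@continuous_comp _ _ _ (fun t => x * circ a b t) cos).
    by apply: cvgM; [exact: cvg_cst|exact: continuous_circ].
  exact: continuous_cos.
pose g (t : R) := expR (x ^+ 2 * (a ^+ 2 + b ^+ 2)) / (1 + t ^+ 2).
have H := @Rintegral_dominated R _ (measurableTypeR R) mu setT
  (fun n t => series (cos_coeff' (x * circ a b t)) n / (1 + t ^+ 2))
  (fun t => cos (x * circ a b t) / (1 + t ^+ 2)) g measurableT.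
have {}H := H (fun n => continuous_measurable_fun (cc n)) (continuous_measurable_fun ccos).
have H2 : (fun n => Rintegral mu setT (fun t : R => series (cos_coeff' (x * circ a b t)) n
    / (1 + t ^+ 2))) @ \oo -->
    Rintegral mu setT (fun t : R => cos (x * circ a b t) / (1 + t ^+ 2)).
  apply: H.
  - move=> t _; apply: cvgM; last exact: cvg_cst.
    exact: cvg_cos_coeff'.
  - apply: (integrable_bounded_oneDsqrV (k := cst (expR (x ^+ 2 * (a ^+ 2 + b ^+ 2))))
      (M := expR (x ^+ 2 * (a ^+ 2 + b ^+ 2)))) => //.
    by move=> t; rewrite ger0_norm// expR_ge0.
  - move=> n t _.
    have t0 : 0 <= (1 + t ^+ 2)^-1 by rewrite invr_ge0 ltW// oneDsqr_gt0'.
    rewrite /g normrM [X in _ * X]ger0_norm// ler_wpM2r//.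
    apply: (le_trans (norm_series_cos_coeff'_le _ _)).
    by rewrite ler_expR exprMn ler_wpM2l ?sqr_ge0// circ_le.
move: H2; under eq_fun do rewrite (integral_series_circ a b x _).2.
move=> H2.
have H3 : (fun n => pi * series (bessel_term (x * Num.sqrt (a ^+ 2 + b ^+ 2))) n / pi)
    @ \oo -->
    Rintegral mu setT (fun t : R => cos (x * circ a b t) / (1 + t ^+ 2)) / pi.
  by apply: cvgM => //; exact: cvg_cst.
move: H3; apply: cvg_trans; apply: near_eq_cvg; apply: nearW => n /=.
by rewrite mulrC mulKf// gt_eqF// pi_gt0.
Qed.

(** Bessel's integral over a half-turn: pi J_0(x |rho|) is the integral of cos (x rho . e_theta). It
    yields |J_0| <= 1 and later the angular part of the integrals over R^2. *)
Lemma besselJ0_angular (a b x : R) :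
  Rintegral mu setT (fun t : R => cos (x * circ a b t) / (1 + t ^+ 2)) =
  pi * besselJ0 (x * Num.sqrt (a ^+ 2 + b ^+ 2)).
Proof.
have /cvg_lim E := @besselJ0_angular_cvg a b x.
have -> : besselJ0 (x * Num.sqrt (a ^+ 2 + b ^+ 2)) =
  limn (series (bessel_term (x * Num.sqrt (a ^+ 2 + b ^+ 2)))) by [].
by rewrite E// mulrC divfK// gt_eqF// pi_gt0.
Qed.

Lemma besselJ0_le1 (x : R) : `|besselJ0 x| <= 1.
Proof.
have E := @besselJ0_angular 1 0 x.
rewrite expr1n expr0n addr0 sqrtr1 mulr1 in E.
have ic : mu.-integrable setT
    (EFin \o (fun t : R => cos (x * circ 1 0 t) / (1 + t ^+ 2))).
  apply: (integrable_bounded_oneDsqrV (k := fun t => cos (x * circ 1 0 t)) (M := 1)).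
    apply: continuous_measurable_fun => t.
    apply: (@continuous_comp _ _ _ (fun t => x * circ 1 0 t) cos).
      by apply: cvgM; [exact: cvg_cst|exact: continuous_circ].
    exact: continuous_cos.
  by move=> t; rewrite ler_norml cos_geN1 cos_le1.
have -> : besselJ0 x =
    Rintegral mu setT (fun t : R => cos (x * circ 1 0 t) / (1 + t ^+ 2)) / pi.
  by rewrite E mulrC mulKf// gt_eqF// pi_gt0.
rewrite normrM normfV (gtr0_norm (@pi_gt0 R)) ler_pdivrMr ?pi_gt0// mul1r.
apply: (le_trans (le_normr_Rintegral measurableT ic)).
rewrite -[leRHS]Rintegral_oneDsqrV.
apply: le_Rintegral => //.
- exact: (integrable_norm ic).
- exact: integrable_oneDsqrV.
- move=> t _.
  have t0 : 0 <= (1 + t ^+ 2)^-1 by rewrite invr_ge0 ltW// oneDsqr_gt0'.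
  rewrite normrM [X in _ * X]ger0_norm// ler_piMl//.
  by rewrite ler_norml cos_geN1 cos_le1.
Qed.

End bessel_angular.

(** * Power series of J_0 in the variable x^2 and Bessel's equation *)

Section bessel_series.
Context {R : realType}.

(** [besg] and [besh] are the first and second derivatives of j, so J_0'(x) = 2 x [besg] (x^2). With
    the argument squared, the functions of h and m that occur below have polynomial arguments and no
    square root. *)
Definition bcoef (k : nat) : R := (- 4^-1) ^+ k / k`!%:R ^+ 2.
Definition besj (x : R) : R := limn (pseries bcoef x).
Definition besg (x : R) : R := limn (pseries (pseries_diffs bcoef) x).
Definition besh (x : R) : R :=
  limn (pseries (pseries_diffs (pseries_diffs bcoef)) x).

Lemma besselJ0E (x : R) : besselJ0 x = besj (x ^+ 2).
Proof.
rewrite /besselJ0 /besj /pseries; congr (limn _); apply/funext => n.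
rewrite /series/=; apply: eq_bigr => k _; rewrite /bcoef exprM.
have -> : (x / 2) ^+ 2 = 4^-1 * x ^+ 2 by field.
by rewrite exprMn [in RHS]exprNn; ring.
Qed.

Lemma cvg_pseries_fact (d : nat -> R) (x : R) :
  (forall k, `|d k| <= k`!%:R^-1) -> cvgn (pseries d x).
Proof.
move=> dk; apply: normed_cvg.
apply: (@series_le_cvg _ _ (exp_coeff `|x|)).
- by move=> k /=.
- by move=> k; exact: exp_coeff_ge0.
- by move=> k /=; rewrite /exp_coeff normrM normrX mulrC ler_wpM2l// exprn_ge0.
- exact: is_cvg_series_exp_coeff.
Qed.

Lemma factV_le1 (k : nat) : k`!%:R^-1 <= 1 :> R.
Proof. by rewrite invf_le1 ?ltr0n ?fact_gt0// ler1n fact_gt0. Qed.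

Lemma norm_bcoef_le (k : nat) : `|bcoef k| <= k`!%:R^-1 * k`!%:R^-1.
Proof.
rewrite /bcoef normrM normrX normrN !ger0_norm// ?invr_ge0 ?exprn_ge0//.
rewrite expr2 invfM ler_piMl ?mulr_ge0 ?invr_ge0// exprn_ile1// invf_le1// ler1n//.
Qed.

Lemma bcoef_bound k : `|bcoef k| <= k`!%:R^-1.
Proof.
apply: (le_trans (norm_bcoef_le k)).
by rewrite ler_piMl ?invr_ge0// factV_le1.
Qed.

Lemma natr_factV k : k.+1%:R * k.+1`!%:R^-1 = k`!%:R^-1 :> R.
Proof. by rewrite factS natrM invfM mulrA divff ?pnatr_eq0// mul1r. Qed.

(** The bound is kept as a product of two inverse factorials: the factor k + 1 of a differentiation
    only restores 1/k! from 1/(k+1)!, so the argument can be repeated for the next derivatives. *)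
Lemma bcoef1_le k : `|pseries_diffs bcoef k| <= k`!%:R^-1 * k.+1`!%:R^-1.
Proof.
rewrite /pseries_diffs normrM normr_nat.
apply: (@le_trans _ _ (k.+1%:R * (k.+1`!%:R^-1 * k.+1`!%:R^-1))).
  by rewrite ler_wpM2l// norm_bcoef_le.
by rewrite mulrA natr_factV.
Qed.

Lemma bcoef1_bound k : `|pseries_diffs bcoef k| <= k`!%:R^-1.
Proof.
apply: (le_trans (bcoef1_le k)).
by rewrite ler_piMr ?invr_ge0// factV_le1.
Qed.

Lemma bcoef2_le k :
  `|pseries_diffs (pseries_diffs bcoef) k| <= k`!%:R^-1 * k.+2`!%:R^-1.
Proof.
rewrite {1}/pseries_diffs normrM normr_nat.
apply: (@le_trans _ _ (k.+1%:R * (k.+1`!%:R^-1 * k.+2`!%:R^-1))).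
  by rewrite ler_wpM2l// bcoef1_le.
by rewrite mulrA natr_factV.
Qed.

Lemma bcoef2_bound k : `|pseries_diffs (pseries_diffs bcoef) k| <= k`!%:R^-1.
Proof.
apply: (le_trans (bcoef2_le k)).
by rewrite ler_piMr ?invr_ge0// factV_le1.
Qed.

Lemma bcoef3_bound k :
  `|pseries_diffs (pseries_diffs (pseries_diffs bcoef)) k| <= k`!%:R^-1.
Proof.
rewrite {1}/pseries_diffs normrM normr_nat.
apply: (@le_trans _ _ (k.+1%:R * (k.+1`!%:R^-1 * k.+3`!%:R^-1))).
  by rewrite ler_wpM2l// bcoef2_le.
rewrite mulrA natr_factV.
by rewrite ler_piMr ?invr_ge0// factV_le1.
Qed.

Lemma is_derive_pseries_fact (d : nat -> R) (x : R) :
  (forall k, `|d k| <= k`!%:R^-1) ->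
  (forall k, `|pseries_diffs d k| <= k`!%:R^-1) ->
  (forall k, `|pseries_diffs (pseries_diffs d) k| <= k`!%:R^-1) ->
  is_derive x 1 (fun y => limn (pseries d y)) (limn (pseries (pseries_diffs d) x)).
Proof.
move=> h0 h1 h2; apply: (@pseries_snd_diffs _ _ (`|x| + 1)).
- exact: cvg_pseries_fact.
- exact: cvg_pseries_fact.
- exact: cvg_pseries_fact.
- by rewrite [ltRHS]ger0_norm ?addr_ge0// ltrDl.
Qed.

Lemma is_derive_besj (x : R) : is_derive x 1 besj (besg x).
Proof.
exact: (is_derive_pseries_fact _ bcoef_bound bcoef1_bound bcoef2_bound).
Qed.

Lemma is_derive_besg (x : R) : is_derive x 1 besg (besh x).
Proof.
exact: (is_derive_pseries_fact _ bcoef1_bound bcoef2_bound bcoef3_bound).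
Qed.

(** The left side is the derivative of y j'(y), a power series with coefficients k b_k. Its
    differentiated coefficients are (k+1)^2 b_(k+1) = - b_k / 4. *)
Lemma besODE (x : R) : x * besh x + besg x = - (besj x / 4).
Proof.
pose pp (k : nat) := k%:R * bcoef k.
have dpp : pseries_diffs pp = (fun k => - 4^-1 * bcoef k).
  apply/funext => k; rewrite /pseries_diffs /pp /bcoef factS natrM exprS.
  have h1 : k.+1%:R != 0 :> R by rewrite pnatr_eq0.
  have h4 : k`!%:R != 0 :> R by rewrite pnatr_eq0 -lt0n fact_gt0.
  move: h1 h4; move: (k.+1%:R : R) (k`!%:R : R) ((- 4^-1) ^+ k : R) => u v w h1 h4.
  by field; rewrite h1 h4.
have q1 : `|- 4^-1| <= 1 :> R.
  by rewrite normrN ger0_norm// invf_le1// ler1n.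
have b0 k : `|pp k| <= k`!%:R^-1.
  rewrite /pp; case: k => [|k]; first by rewrite mul0r normr0 invr_ge0.
  apply: (le_trans (bcoef1_le k)).
  by rewrite ler_piMl ?invr_ge0// factV_le1.
have b1 k : `|pseries_diffs pp k| <= k`!%:R^-1.
  rewrite dpp normrM; apply: le_trans (bcoef_bound k); exact: ler_piMl.
have b2 k : `|pseries_diffs (pseries_diffs pp) k| <= k`!%:R^-1.
  rewrite dpp; apply: le_trans (bcoef1_bound k).
  rewrite /pseries_diffs mulrCA normrM; exact: ler_piMl.
have d1 := is_derive_pseries_fact x b0 b1 b2.
have E : (fun y => limn (pseries pp y)) = (fun y => y * besg y).
  apply/funext => y; apply/cvg_lim => //.
  rewrite -cvg_shiftS.
  have H : (fun n => y * pseries (pseries_diffs bcoef) y n) @ \oo --> y * besg y.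
    by apply: cvgM; [exact: cvg_cst|exact: cvg_pseries_fact bcoef1_bound].
  move: H; apply: cvg_trans; apply: near_eq_cvg; apply: nearW => n /=.
  rewrite /pseries /series/= big_nat_recl//= {1}/pp !mul0r add0r mulr_sumr.
  by apply: eq_bigr => k _; rewrite /pseries_diffs exprS /pp; ring.
have d2 := dM (dId x) (is_derive_besg x).
have [_ e1] := d1; have [_ e2] := d2.
move: e1; rewrite E e2 dpp mul1r addrC => ->.
apply/cvg_lim => //.
have H : (fun n => - 4^-1 * pseries bcoef x n) @ \oo --> - 4^-1 * besj x.
  by apply: cvgM; [exact: cvg_cst|exact: cvg_pseries_fact bcoef_bound].
rewrite (_ : - (besj x / 4) = - 4^-1 * besj x); last by field.
move: H; apply: cvg_trans; apply: near_eq_cvg; apply: nearW => n /=.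
by rewrite /pseries /series/= mulr_sumr; apply: eq_bigr => k _; rewrite mulrA.
Qed.

Lemma besj_le1 (x : R) : 0 <= x -> `|besj x| <= 1.
Proof. by move=> x0; rewrite -(sqr_sqrtr x0) -besselJ0E besselJ0_le1. Qed.

(** By Bessel's equation (y j'(y))' = - j / 4 with |j| <= 1, so the mean value theorem gives |x
    j'(x)| <= x / 4. At x = 0 the equation itself gives the value. *)
Lemma besg_le (x : R) : 0 <= x -> `|besg x| <= 4^-1.
Proof.
rewrite le_eqVlt => /predU1P[<-|x0].
  have := besODE 0; rewrite mul0r add0r => ->.
  by rewrite normrN normrM [X in _ * X]ger0_norm// ler_piMl// besj_le1.
have dP (y : R) : is_derive y 1 (fun y => y * besg y) (- (besj y / 4)).
  by apply: (dEq (dM (dId y) (is_derive_besg y))); rewrite mul1r addrC besODE.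
have [c cx] := @MVT _ (fun y => y * besg y) _ 0 x x0 (fun y _ => dP y)
  (continuous_subspaceT (is_derive_continuous dP)).
rewrite mul0r !subr0 => E.
have c0 : 0 <= c by move: cx; rewrite in_itv/= => /andP[/ltW].
have -> : besg x = - (besj c / 4).
  by apply: (mulfI (lt0r_neq0 x0)); rewrite E mulrC.
by rewrite normrN normrM [X in _ * X]ger0_norm// ler_piMl// besj_le1.
Qed.

End bessel_series.

(** * Hankel transform and radial substitution *)

Section hankel.
Context {R : realType}.
Notation mR := (measurableTypeR R).
Notation mu := (@lebesgue_measure R).

Lemma integrable_opp (f : R -> R) : mu.-integrable setT (EFin \o f) ->
  mu.-integrable setT (EFin \o (fun x => f (- x))).
Proof.
move=> fi; have mf : measurable_fun [set: R] (EFin \o f) by exact: (measurable_int mu).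
have mo : measurable_fun [set: mR] (-%R : mR -> mR) by apply: continuous_measurable_fun; exact: opp_continuous.
apply/integrableP; split; first exact: (measurableT_comp mf mo).
have /integrableP[_] := fi.
have /(integral_scale (c := -1)) -> : measurable_fun [set: R] (abse \o (EFin \o f)).
  exact: measurableT_comp.
  under eq_integral do rewrite normrN1 mule1 mulN1r.
  by [].
by rewrite oppr_eq0 oner_eq0.
Qed.

Lemma Rintegral_opp (f : R -> R) : measurable_fun setT f ->
  Rintegral mu setT (fun x => f (- x)) = Rintegral mu setT f.
Proof.
move=> mf; rewrite /Rintegral; congr fine.
rewrite [RHS](integral_scale (c := -1)); last 2 first.
- by rewrite oppr_eq0 oner_eq0.
- exact/measurable_EFinP.
by apply: eq_integral => x _; rewrite normrN1 mule1 mulN1r.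
Qed.

Lemma Rintegral_odd (f : R -> R) : mu.-integrable setT (EFin \o f) ->
  (forall x, f (- x) = - f x) -> Rintegral mu setT f = 0.
Proof.
move=> fi fodd.
have mf : measurable_fun [set: R] f by apply/measurable_EFinP; exact: (measurable_int mu).
have : Rintegral mu setT f = - Rintegral mu setT f.
  rewrite -[LHS]Rintegral_opp//.
  under eq_Rintegral do rewrite fodd -mulN1r.
  by rewrite (RintegralZl _ _ fi)// mulN1r.
by move/eqP; rewrite -subr_eq0 opprK -mulr2n mulrn_eq0 /= => /eqP.
Qed.

Lemma even_decomp (f : R -> R) : f 0 = 0 -> (forall x, f (- x) = f x) ->
  f = (fun x => (f \_ `]0, +oo[) x + (f \_ `]0, +oo[) (- x)).
Proof.
move=> f0 fe; apply/funext => x; rewrite !patchE.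
have E (y : R) : (y \in (`]0, +oo[%classic : set R)) = (0 < y).
  by apply/idP/idP; rewrite inE/= in_itv/= andbT.
rewrite !E oppr_gt0; have [x0|x0|<-] := ltgtP 0 x.
- by rewrite addr0.
- by rewrite add0r fe.
- by rewrite f0 addr0.
Qed.

Lemma integrable_even (f : R -> R) : f 0 = 0 -> (forall x, f (- x) = f x) ->
  mu.-integrable `]0, +oo[ (EFin \o f) ->
  mu.-integrable setT (EFin \o f) /\
  Rintegral mu setT f = 2 * Rintegral mu `]0, +oo[ f.
Proof.
move=> f0 fe fi.
have fi' : mu.-integrable setT (EFin \o (f \_ `]0, +oo[)).
  rewrite -restrict_EFin.
  by apply/integrable_restrict => //; rewrite setTI.
have fi2 := integrable_opp fi'.
have mf' : measurable_fun [set: R] (f \_ `]0, +oo[).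
  by apply/measurable_EFinP; exact: (measurable_int mu).
rewrite [X in Rintegral mu setT X](even_decomp f0 fe) (RintegralD _ fi' fi2)//.
rewrite (Rintegral_opp mf') -Rintegral_mkcond mulr2n mulrDl mul1r; split => //.
rewrite (even_decomp f0 fe); exact: (integrableD measurableT fi' fi2).
Qed.

(** The angular integral of a kernel bounded by 1 is at most pi, so Tonelli reduces the claim to the
    integrability of A. *)
Lemma integrable_prod_circ (A : R -> R) (K : mR * mR -> R) :
  mu.-integrable setT (EFin \o A) -> measurable_fun setT K ->
  (forall p, `|K p| <= 1) ->
  (mu \x mu)%E.-integrable setT
    (fun p : mR * mR => (A p.1 * (K p / (1 + p.2 ^+ 2)))%:E).
Proof.
move=> iA mK K1.
have mA : measurable_fun [set: mR] A.
  by apply/measurable_EFinP; exact: (measurable_int mu iA).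
have mg : measurable_fun [set: mR * mR]
    (fun p : mR * mR => (A p.1 * (K p / (1 + p.2 ^+ 2)))%:E).
  apply/measurable_EFinP; apply: measurable_funM.
    exact: (measurableT_comp mA measurable_fst).
  apply: measurable_funM => //.
  have m1 : measurable_fun [set: mR] (fun t : mR => (1 + t ^+ 2)^-1 : R)%R.
    by apply: continuous_measurable_fun; exact: continuous_oneDsqrV.
  exact: (measurableT_comp m1 measurable_snd).
apply/(@integrable12ltyP _ _ _ _ R mu mu _ mg).
apply: (@le_lt_trans _ _ (\int[mu]_r (`|A r|%:E * pi%:E)))%E; last first.
  rewrite ge0_integralZr//; last 2 first.
  - by apply/measurable_EFinP; apply: measurableT_comp.
  - by rewrite lee_fin pi_ge0.
  have /integrableP[_ H] := iA.
  by rewrite muleC; apply: lte_mul_pinfty; rewrite ?lee_fin ?pi_ge0.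
apply: ge0_le_integral => //.
- by move=> r _; exact: integral_ge0.
- have mag : measurable_fun [set: mR * mR]
    (fun p : mR * mR => `|(A p.1 * (K p / (1 + p.2 ^+ 2)))%:E|)%E.
    exact: measurableT_comp.
  exact: (@measurable_fun_fubini_tonelli_F _ _ _ _ R mu _ mag).
- by apply: emeasurable_funM => //; apply/measurable_EFinP; apply: measurableT_comp.
move=> r _.
have piE : (\int[mu]_t ((1 + t ^+ 2)^-1 : R)%:E = pi%:E)%E.
  rewrite -Rintegral_oneDsqrV /Rintegral fineK//.
  exact: integrable_fin_num integrable_oneDsqrV.
rewrite -piE -ge0_integralZl//; last 2 first.
- have /integrableP[] := @integrable_oneDsqrV R; by [].
- by move=> t _; rewrite lee_fin invr_ge0 ltW// oneDsqr_gt0'.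
apply: ge0_le_integral => //.
- apply: measurableT_comp => //.
  exact: (measurable_fun_pair2 r mg).
- apply: emeasurable_funM => //.
  by have /integrableP[] := @integrable_oneDsqrV R.
- move=> t _; rewrite -EFinM lee_fin !normrM ler_wpM2l//.
  have t0 : 0 <= (1 + t ^+ 2)^-1 by rewrite invr_ge0 ltW// oneDsqr_gt0'.
  by rewrite [X in _ * X]ger0_norm// ler_piMl.
Qed.

Lemma Rintegral_prod_circ (A : R -> R) (K : mR * mR -> R) :
  mu.-integrable setT (EFin \o A) -> measurable_fun setT K ->
  (forall p, `|K p| <= 1) ->
  Rintegral (mu \x mu)%E setT
    (fun p : mR * mR => A p.1 * (K p / (1 + p.2 ^+ 2))) =
  Rintegral mu setT
    (fun r => A r * Rintegral mu setT (fun t => K (r, t) / (1 + t ^+ 2))) /\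
  mu.-integrable setT
    (EFin \o (fun r => A r * Rintegral mu setT (fun t => K (r, t) / (1 + t ^+ 2)))).
Proof.
move=> iA mK K1.
have ig := integrable_prod_circ iA mK K1.
have iK r : mu.-integrable setT (EFin \o (fun t => K (r, t) / (1 + t ^+ 2))).
  apply: (integrable_bounded_oneDsqrV (k := fun t => K (r, t)) (M := 1)) => //.
  exact: (measurable_fun_pair2 r mK).
have FE : fubini_F mu (fun p : mR * mR => (A p.1 * (K p / (1 + p.2 ^+ 2)))%:E) =
    EFin \o (fun r => A r * Rintegral mu setT (fun t => K (r, t) / (1 + t ^+ 2))).
  apply/funext => r; rewrite /fubini_F /= -(RintegralZl _ _ (iK r))// /Rintegral.
  rewrite fineK//.
  have := integrableZl measurableT (A r) (iK r).
  by move=> /(integrable_fin_num measurableT).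
split.
  rewrite /Rintegral; congr fine.
  rewrite -(@integral12_prod_meas1 _ _ _ _ R mu mu _ ig).
  by rewrite FE.
have := @integrable_fubini_F _ _ _ _ R mu mu _ ig.
by rewrite FE.
Qed.

Lemma norm2_polar (p : mR * mR) : norm2 (polar_map p) = `|p.1|.
Proof.
case: p => r t; rewrite /norm2 /polar_map/=.
have st : (0 < 1 + t ^+ 2) by exact: oneDsqr_gt0'.
rewrite !exprMn exprVn sqr_sqrtr; last exact: ltW.
rewrite -mulrDl -[X in (X + _) / _]mulr1 -mulrDr mulfK ?gt_eqF//.
by rewrite sqrtr_sqr.
Qed.

Lemma dot2_polar (p : mR * mR) (rho : R * R) :
  dot2 (polar_map p) rho = p.1 * circ rho.1 rho.2 p.2.
Proof. by rewrite /dot2 /polar_map /circ/=; ring. Qed.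

Lemma measurable_norm2 : measurable_fun [set: mR * mR] (@norm2 R).
Proof.
have ms : measurable_fun [set: mR] (Num.sqrt : mR -> mR).
  by apply: continuous_measurable_fun; exact: sqrt_continuous.
apply: (measurableT_comp ms).
by apply: measurable_funD; apply: measurable_funX.
Qed.

Lemma measurable_dot2 (rho : R * R) : measurable_fun [set: mR * mR] ((@dot2 R) ^~ rho).
Proof. by apply: measurable_funD; apply: measurable_funM. Qed.

Section hankel_transform.
Variables (F : R -> R) (rho : R * R).
Hypothesis mF : measurable_fun [set: R] F.
Hypothesis iF : mu.-integrable `]0, +oo[ (fun r => (r * F r)%:E).

(** The radius of [polar_map] is signed, so the radial density is extended evenly; folding it back
    produces the factor 2 in [hankel_cos]. *)
Let A (r : R) : R := `|r| * F `|r|.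

Let iA : mu.-integrable setT (EFin \o A).
Proof.
apply: (integrable_even _ _ _).1; first by rewrite /A normr0 mul0r.
  by move=> x; rewrite /A normrN.
move: iF; apply: eq_integrable => // r; rewrite inE/= in_itv/= andbT => r0.
by rewrite /A gtr0_norm.
Qed.

Let kernel (k : R -> R) (p : mR * mR) : R := k (p.1 * circ rho.1 rho.2 p.2).

Let measurable_kernel (k : R -> R) : measurable_fun [set: R] k ->
  measurable_fun setT (kernel k).
Proof.
move=> mk.
have mk' : measurable_fun [set: mR] k := mk.
apply: (measurableT_comp mk'); apply: measurable_funM => //.
have mc : measurable_fun [set: mR] (circ rho.1 rho.2) by exact: measurable_circ.
exact: (measurableT_comp mc measurable_snd).
Qed.

Let radial (k : R -> R) (h : mR * mR) : R := F (norm2 h) * k (dot2 h rho).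

Let measurable_radial (k : R -> R) : measurable_fun [set: R] k ->
  measurable_fun setT (radial k).
Proof.
move=> mk.
have mk' : measurable_fun [set: mR] k := mk.
have mF' : measurable_fun [set: mR] F := mF.
apply: measurable_funM.
  exact: (measurableT_comp mF' measurable_norm2).
exact: (measurableT_comp mk' (measurable_dot2 rho)).
Qed.

Let radial_polar k p : radial k (polar_map p) * polar_jac p =
  A p.1 * (kernel k p / (1 + p.2 ^+ 2)).
Proof. by rewrite /radial norm2_polar dot2_polar /polar_jac /A /kernel; ring. Qed.

Let integrable_radial (k : R -> R) : measurable_fun [set: R] k -> (forall x, `|k x| <= 1) ->
  (mu \x mu)%E.-integrable setT (EFin \o radial k).
Proof.
move=> mk k1.
have mr : measurable_fun setT (EFin \o radial k).
  by apply/measurable_EFinP; exact: measurable_radial.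
apply/integrableP; split; first exact: mr.
rewrite ge0_polar//; last exact: measurableT_comp.
have /integrableP[_] := integrable_prod_circ iA (measurable_kernel mk)
  (fun p => k1 _).
apply: le_lt_trans; apply: ge0_le_integral => //.
- by move=> p _; rewrite mule_ge0 ?lee_fin ?polar_jac_ge0.
- by apply: (measurable_polar (f := fun p => `|(EFin \o radial k) p|%E)); exact: measurableT_comp.
- apply: measurableT_comp => //; apply: (measurable_int (mu \x mu)%E).
  exact: (integrable_prod_circ iA (measurable_kernel mk) (fun p => k1 _)).
- move=> p _; rewrite -EFinM lee_fin -radial_polar.
  by rewrite [leRHS]normrM [X in _ <= _ * X]ger0_norm ?polar_jac_ge0.
Qed.

Let Rintegral_radial (k : R -> R) : measurable_fun [set: R] k -> (forall x, `|k x| <= 1) ->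
  Rintegral (mu \x mu)%E setT (radial k) =
  Rintegral mu setT (fun r => A r *
    Rintegral mu setT (fun t => k (r * circ rho.1 rho.2 t) / (1 + t ^+ 2))) /\
  mu.-integrable setT (EFin \o (fun r => A r *
    Rintegral mu setT (fun t => k (r * circ rho.1 rho.2 t) / (1 + t ^+ 2)))).
Proof.
move=> mk k1.
have [E1 E2] := Rintegral_prod_circ iA (measurable_kernel mk) (fun p => k1 _).
split; last exact: E2.
etransitivity; last exact: E1.
rewrite /Rintegral; congr fine.
rewrite polar; last by apply/measurable_EFinP; exact: measurable_radial.
by apply: eq_integral => p _; rewrite -EFinM radial_polar.
Qed.

Lemma hankel_cos :
  (@leb2 R).-integrable setT (fun h => (F (norm2 h) * cos (dot2 h rho))%:E) /\
  Rintegral (@leb2 R) setT (fun h => F (norm2 h) * cos (dot2 h rho)) =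
  2 * pi * Rintegral mu `]0, +oo[ (fun r => r * F r * besselJ0 (r * norm2 rho)).
Proof.
have mk : measurable_fun [set: R] (cos : R -> R).
  by apply: continuous_measurable_fun; exact: continuous_cos.
have k1 (x : R) : `|cos x| <= 1 by rewrite ler_norml cos_geN1 cos_le1.
split; first exact: (integrable_radial mk k1).
have [E i] := Rintegral_radial mk k1.
etransitivity; first exact: E.
have JE (r : R) : Rintegral mu setT
   (fun t => cos (r * circ rho.1 rho.2 t) / (1 + t ^+ 2)) =
   pi * besselJ0 (r * norm2 rho) by rewrite besselJ0_angular.
have m0y : measurable (`]0, +oo[%classic : set mR) by exact: measurable_itv.
have i' := integrableS measurableT m0y (@subsetT _ _) i.
have [||_ ->] := integrable_even _ _ i'.
- by rewrite /A normr0 !mul0r.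
- move=> x; rewrite /A normrN !JE !besselJ0E; congr (_ * (_ * besj _)).
  by rewrite !exprMn sqrrN.
rewrite -mulrA -RintegralZl//.
  congr (_ * _); apply: eq_Rintegral => r; rewrite inE/= in_itv/= andbT => r0.
  by rewrite JE /A gtr0_norm//; ring.
have := integrableZl m0y (pi^-1) i'.
apply: eq_integrable => // r; rewrite inE/= in_itv/= andbT => r0.
rewrite /= -EFinM; congr EFin.
rewrite JE /A gtr0_norm// mulrCA mulrA mulrA mulrAC.
rewrite -[RHS]mulr1 -(@divff _ (pi : R)) ?gt_eqF ?pi_gt0//; ring.
Qed.

(** The density [A] is even in the signed radius while the sine is odd in it. *)
Lemma hankel_sin :
  (@leb2 R).-integrable setT (fun h => (F (norm2 h) * sin (dot2 h rho))%:E) /\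
  Rintegral (@leb2 R) setT (fun h => F (norm2 h) * sin (dot2 h rho)) = 0.
Proof.
have mk : measurable_fun [set: R] (sin : R -> R).
  by apply: continuous_measurable_fun; exact: continuous_sin.
have k1 (x : R) : `|sin x| <= 1 by rewrite ler_norml sin_geN1 sin_le1.
split; first exact: (integrable_radial mk k1).
have [E i] := Rintegral_radial mk k1.
etransitivity; first exact: E.
apply: (Rintegral_odd i) => r; rewrite /A normrN -mulrN; congr (_ * _).
have iS : mu.-integrable setT
    (EFin \o (fun t => sin (r * circ rho.1 rho.2 t) / (1 + t ^+ 2))).
  apply: (integrable_bounded_oneDsqrV (k := fun t => sin (r * circ rho.1 rho.2 t))
    (M := 1)) => //.
  exact: (measurable_fun_pair2 r (measurable_kernel mk)).
under eq_Rintegral do rewrite mulNr sinN mulNr -mulN1r.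
by rewrite (RintegralZl _ _ iS)// mulN1r.
Qed.

End hankel_transform.

End hankel.

(** * The substitutions m = sqrt (h^2 - w^2) and m = sqrt (w^2 - h^2) *)

Section radial_substitution.
Context {R : realType}.
Notation mR := (measurableTypeR R).
Notation mu := (@lebesgue_measure R).

Lemma measurable_invr : measurable_fun [set: mR] (fun x : mR => x^-1 : R).
Proof.
(* These continuous approximations vanish at 0, which matches the default value 0 of the inverse
   there. *)
pose f_ (n : nat) (x : mR) : R := x / (x ^+ 2 + n.+1%:R^-1).
apply: (measurable_fun_cvg (h := f_)) => //.
- move=> n; apply: continuous_measurable_fun => x.
  have x0 : 0 < x ^+ 2 + n.+1%:R^-1 by rewrite ltr_wpDl ?sqr_ge0// invr_gt0.
  apply: cvgM; first exact: cvg_id.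
  apply: cvgV; first by rewrite gt_eqF.
  by apply: cvgD; [exact: sqr_continuous|exact: cvg_cst].
- move=> x _; rewrite /f_; have [->|x0] := eqVneq x 0.
    rewrite invr0; under eq_fun do rewrite mul0r; exact: cvg_cst.
  rewrite (_ : x^-1 = x / (x ^+ 2 + 0)); last by rewrite addr0; field.
  apply: cvgM; first exact: cvg_cst.
  apply: cvgV; first by rewrite addr0 sqrf_eq0.
  by apply: cvgD; [exact: cvg_cst|exact: cvg_harmonic].
Qed.

Lemma measurable_sqrtr : measurable_fun [set: mR] (Num.sqrt : mR -> mR).
Proof. by apply: continuous_measurable_fun; exact: sqrt_continuous. Qed.

(** Density of G(m) dm on the positive half-line in the variable y = m^2, extended by 0. In this
    variable both substitutions become affine in x = h|h|. *)
Definition radf (G : R -> R) (y : R) : R :=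
  \1_(`]0, +oo[%classic : set R) y * (G (Num.sqrt y) * (2 * Num.sqrt y)^-1).

Lemma measurable_radf (G : R -> R) : measurable_fun [set: R] G ->
  measurable_fun [set: R] (EFin \o radf G).
Proof.
move=> mG; have mG' : measurable_fun [set: mR] G := mG.
apply/measurable_EFinP; apply: measurable_funM.
  exact: measurable_indic.
apply: measurable_funM.
  exact: (measurableT_comp mG' measurable_sqrtr).
apply: (measurableT_comp measurable_invr).
by apply: measurable_funM => //; exact: measurable_sqrtr.
Qed.

Lemma indic0y (y : R) : \1_(`]0, +oo[%classic : set R) y = (0 < y)%R%:R :> R.
Proof. by rewrite indicE mem_setE in_itv/= andbT. Qed.

Lemma radf_pos (G : R -> R) (y : R) : 0 < y ->
  radf G y = G (Num.sqrt y) / (2 * Num.sqrt y).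
Proof. by move=> y0; rewrite /radf indic0y y0 mul1r. Qed.

Lemma radf_npos (G : R -> R) (y : R) : y <= 0 -> radf G y = 0.
Proof. by move=> y0; rewrite /radf indic0y ltNge y0 mul0r. Qed.

Lemma integral_radf (G : R -> R) : measurable_fun [set: R] G ->
  (\int[mu]_y (radf G y)%:E = \int[mu]_(m in `]0%R, +oo[) (G m)%:E)%E.
Proof.
move=> mG; rewrite (integral_sgsqr (f := EFin \o radf G)); last exact: measurable_radf.
rewrite [RHS]integral_mkcond; apply: eq_integral => m _; rewrite patchE.
case: ifPn => [|]; rewrite mem_setE in_itv/= andbT.
- move=> m0; rewrite -EFinM /sgsqr gtr0_norm// radf_pos ?mulr_gt0//.
  rewrite -expr2 sqrtr_sqr gtr0_norm//; congr EFin; field; by rewrite gt_eqF.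
- rewrite -leNgt => m0; rewrite radf_npos ?mul0e// /sgsqr.
  by rewrite mulr_le0_ge0.
Qed.

(** Composition of y = m^2, y = x - w^2 and x = h|h|. For h <= w the argument h|h| - w^2 is
    nonpositive, where [radf] vanishes, so the range of h takes care of itself. *)
Lemma integral_evan (w : R) (G : R -> R) : 0 < w -> measurable_fun [set: R] G ->
  (\int[mu]_(h in `]w, +oo[)
     ((h / Num.sqrt (h ^+ 2 - w ^+ 2)) * G (Num.sqrt (h ^+ 2 - w ^+ 2)))%:E =
   \int[mu]_(m in `]0%R, +oo[) (G m)%:E)%E.
Proof.
move=> w0 mG; rewrite -integral_radf//.
rewrite [RHS](integral_shift (- w ^+ 2) (measurable_radf mG)).
rewrite [RHS](integral_sgsqr (f := fun x => (EFin \o radf G) (x + - w ^+ 2))); last first.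
  have m1 : measurable_fun [set: mR] (fun x : mR => x + - w ^+ 2 : mR).
    exact: measurable_funD.
  exact: (measurableT_comp (measurable_radf mG : measurable_fun [set: mR] _) m1).
rewrite [LHS]integral_mkcond; apply: eq_integral => h _; rewrite patchE.
case: ifPn => [|]; rewrite mem_setE in_itv/= andbT.
- move=> wh; have h0 : 0 < h by apply: lt_trans wh.
  have y0 : 0 < h ^+ 2 - w ^+ 2 by rewrite subr_gt0 ltr_pXn2r ?nnegrE ?ltW.
  rewrite -EFinM /sgsqr gtr0_norm// -expr2 radf_pos//; congr EFin.
  by field; rewrite gt_eqF// sqrtr_gt0.
- rewrite -leNgt => hw; rewrite radf_npos ?mul0e// /sgsqr subr_le0.
  by case: (ger0P h) => h0; nra.
Qed.

Lemma integral_prop (w : R) (G : R -> R) : 0 < w -> measurable_fun [set: R] G ->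
  (\int[mu]_(h in `]0%R, w[)
     ((h / Num.sqrt (w ^+ 2 - h ^+ 2)) * G (Num.sqrt (w ^+ 2 - h ^+ 2)))%:E =
   \int[mu]_(m in `]0%R, w[) (G m)%:E)%E.
Proof.
move=> w0 mG.
(* The cutoff removes h < 0: there w^2 - h|h| = w^2 + h^2, whose root exceeds w. For h > w the
   argument is negative, and at h = 0 the Jacobian vanishes. *)
pose K (m : R) : R := \1_(`]0, w[%classic : set R) m * G m.
have KE (m : R) : K m = if 0 < m < w then G m else 0.
  by rewrite /K indicE mem_setE in_itv/=; case: ifP; rewrite ?mul1r ?mul0r.
have mK : measurable_fun [set: R] K.
  by apply: measurable_funM => //; exact: measurable_indic.
have -> : (\int[mu]_(m in `]0%R, w[) (G m)%:E =
    \int[mu]_(m in `]0%R, +oo[) (K m)%:E)%E.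
  rewrite integral_mkcond [RHS]integral_mkcond; apply: eq_integral => m _.
  rewrite !patchE !mem_setE !in_itv/= andbT KE.
  by case: (0 < m) => //=; case: (m < w).
rewrite -integral_radf//.
rewrite [RHS](integral_shift (w ^+ 2) (measurable_radf mK)).
rewrite [RHS](@integral_scale _ (-1) (fun x => (EFin \o radf K) (x + w ^+ 2)));
  last 2 first.
- by rewrite oppr_eq0 oner_eq0.
- have m1 : measurable_fun [set: mR] (fun x : mR => x + w ^+ 2 : mR).
    exact: measurable_funD.
  exact: (measurableT_comp (measurable_radf mK : measurable_fun [set: mR] _) m1).
under [RHS]eq_integral do rewrite normrN1 mule1 mulN1r.
rewrite [RHS](integral_sgsqr (f := fun x => (EFin \o radf K) (- x + w ^+ 2))); last first.
  have m1 : measurable_fun [set: mR] (fun x : mR => - x + w ^+ 2 : mR).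
    by apply: measurable_funD => //; exact: measurable_funN.
  exact: (measurableT_comp (measurable_radf mK : measurable_fun [set: mR] _) m1).
rewrite [LHS]integral_mkcond; apply: eq_integral => h _; rewrite patchE.
case: ifPn => [|]; rewrite mem_setE in_itv/=.
- move=> /andP[h0 hw].
  have y0 : 0 < w ^+ 2 - h ^+ 2 by rewrite subr_gt0 ltr_pXn2r ?nnegrE ?ltW.
  rewrite -EFinM /sgsqr gtr0_norm// -expr2 (addrC (- _)) radf_pos// KE sqrtr_gt0 y0/=.
  rewrite ifT; last first.
    rewrite -[ltRHS]gtr0_norm// -sqrtr_sqr ltr_sqrt ?exprn_gt0//.
    by rewrite ltrBlDr ltrDl exprn_gt0.
  by congr EFin; field; rewrite gt_eqF// sqrtr_gt0.
- rewrite negb_and -!leNgt => /orP[h0|wh].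
    move: h0; rewrite le_eqVlt => /orP[/eqP ->|h0].
      by rewrite normr0 mulr0 mule0.
    rewrite -EFinM radf_pos ?KE; last first.
      by rewrite /sgsqr ltr0_norm// mulrN opprK ltr_wpDl ?exprn_gt0// -expr2 sqr_ge0.
    rewrite ifF ?mul0r//; apply/negbTE; rewrite negb_and -!leNgt.
    apply/orP; right; rewrite -[leLHS]gtr0_norm// -sqrtr_sqr ler_wsqrtr//.
    by rewrite /sgsqr ltr0_norm// mulrN opprK lerDr -expr2 sqr_ge0.
  rewrite radf_npos ?mul0e// /sgsqr ger0_norm; last by rewrite (le_trans _ wh)// ltW.
  by rewrite addrC subr_le0 -expr2 lerXn2r ?nnegrE// (le_trans (ltW w0)).
Qed.

End radial_substitution.

Section complex_radial_substitution.
Context {R : realType}.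
Notation mu := (@lebesgue_measure R).

(** The identity of integrals holds in the extended reals for every measurable G, so applying it to
    |G| transports finiteness. *)
Lemma transfer_integrable (D E : set R) (K : (R -> R) -> R -> R) :
  measurable D -> measurable E ->
  (forall G, measurable_fun [set: R] G -> measurable_fun D (K G)) ->
  (forall G x, D x -> `|K G x| = K (fun y => `|G y|) x) ->
  (forall G, measurable_fun [set: R] G ->
     \int[mu]_(x in D) (K G x)%:E = \int[mu]_(x in E) (G x)%:E)%E ->
  forall G, measurable_fun [set: R] G -> mu.-integrable E (EFin \o G) ->
  mu.-integrable D (EFin \o K G).
Proof.
move=> mD mE mK absK EK G mG /integrableP[_ iG].
apply/integrableP; split; first by apply/measurable_EFinP; exact: mK.
move: iG; rewrite /= -(EK (fun y => `|G y|)); last exact: measurableT_comp.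
rewrite [X in (X < _)%E -> _](_ : _ = \int[mu]_(x in D) `|K G x|%:E)%E//.
by apply: eq_integral => x /set_mem Dx; rewrite absK.
Qed.

Lemma evan_integrable (w : R) (G : R -> R) : 0 < w -> measurable_fun [set: R] G ->
  mu.-integrable `]0, +oo[ (EFin \o G) ->
  mu.-integrable `]w, +oo[ (EFin \o (fun h =>
     (h / Num.sqrt (h ^+ 2 - w ^+ 2)) * G (Num.sqrt (h ^+ 2 - w ^+ 2)))).
Proof.
move=> w0; apply: (@transfer_integrable `]w, +oo[%classic `]0, +oo[%classic
  (fun G h => h / Num.sqrt (h ^+ 2 - w ^+ 2) * G (Num.sqrt (h ^+ 2 - w ^+ 2)))) => //.
- move=> F mF; apply: measurable_funTS.
  have ms : measurable_fun [set: measurableTypeR R] (fun h : measurableTypeR R =>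
      Num.sqrt (h ^+ 2 - w ^+ 2) : measurableTypeR R).
    by apply: (measurableT_comp measurable_sqrtr); exact: measurable_funB.
  apply: measurable_funM.
    by apply: measurable_funM => //; exact: (measurableT_comp measurable_invr ms).
  exact: (measurableT_comp (mF : measurable_fun [set: measurableTypeR R] F) ms).
- move=> F h; rewrite /= in_itv/= andbT => wh; rewrite normrM ger0_norm//.
  by rewrite divr_ge0 ?sqrtr_ge0// (le_trans _ (ltW wh))// ltW.
- by move=> F mF; exact: integral_evan.
Qed.

Lemma prop_integrable (w : R) (G : R -> R) : 0 < w -> measurable_fun [set: R] G ->
  mu.-integrable `]0, w[ (EFin \o G) ->
  mu.-integrable `]0, w[ (EFin \o (fun h =>
     (h / Num.sqrt (w ^+ 2 - h ^+ 2)) * G (Num.sqrt (w ^+ 2 - h ^+ 2)))).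
Proof.
move=> w0; apply: (@transfer_integrable `]0, w[%classic `]0, w[%classic
  (fun G h => h / Num.sqrt (w ^+ 2 - h ^+ 2) * G (Num.sqrt (w ^+ 2 - h ^+ 2)))) => //.
- move=> F mF; apply: measurable_funTS.
  have ms : measurable_fun [set: measurableTypeR R] (fun h : measurableTypeR R =>
      Num.sqrt (w ^+ 2 - h ^+ 2) : measurableTypeR R).
    by apply: (measurableT_comp measurable_sqrtr); exact: measurable_funB.
  apply: measurable_funM.
    by apply: measurable_funM => //; exact: (measurableT_comp measurable_invr ms).
  exact: (measurableT_comp (mF : measurable_fun [set: measurableTypeR R] F) ms).
- move=> F h; rewrite /= in_itv/= => /andP[h0 _]; rewrite normrM ger0_norm//.
  by rewrite divr_ge0 ?sqrtr_ge0// ltW.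
- by move=> F mF; exact: integral_prop.
Qed.

Lemma Rintegral_evan (w : R) (G : R -> R) : 0 < w -> measurable_fun [set: R] G ->
  Rintegral mu `]w, +oo[ (fun h =>
     (h / Num.sqrt (h ^+ 2 - w ^+ 2)) * G (Num.sqrt (h ^+ 2 - w ^+ 2))) =
  Rintegral mu `]0, +oo[ G.
Proof. by move=> w0 mG; rewrite /Rintegral integral_evan. Qed.

Lemma Rintegral_prop (w : R) (G : R -> R) : 0 < w -> measurable_fun [set: R] G ->
  Rintegral mu `]0, w[ (fun h =>
     (h / Num.sqrt (w ^+ 2 - h ^+ 2)) * G (Num.sqrt (w ^+ 2 - h ^+ 2))) =
  Rintegral mu `]0, w[ G.
Proof. by move=> w0 mG; rewrite /Rintegral integral_prop. Qed.

End complex_radial_substitution.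

(** * Complex exponential, square root and calculus *)

Section complex_basics.
Context {R : realType}.
Implicit Types (z u v : CC R) (x y : R).

Lemma cP z u : cre z = cre u -> cim z = cim u -> z = u.
Proof. by case: z => a b; case: u => c d /= -> ->. Qed.

Lemma creD z u : cre (z + u) = cre z + cre u.
Proof. by case: z => a b; case: u. Qed.
Lemma cimD z u : cim (z + u) = cim z + cim u.
Proof. by case: z => a b; case: u. Qed.
Lemma creN z : cre (- z) = - cre z. Proof. by case: z. Qed.
Lemma cimN z : cim (- z) = - cim z. Proof. by case: z. Qed.
Lemma creM z u : cre (z * u) = cre z * cre u - cim z * cim u.
Proof. by case: z => a b; case: u. Qed.
Lemma cimM z u : cim (z * u) = cre z * cim u + cim z * cre u.
Proof. by case: z => a b; case: u. Qed.
Lemma creR x : cre (x%:C : CC R) = x. Proof. by []. Qed.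
Lemma cimR x : cim (x%:C : CC R) = 0. Proof. by []. Qed.
Lemma creI : cre (Ci : CC R) = 0. Proof. by []. Qed.
Lemma cimI : cim (Ci : CC R) = 1. Proof. by []. Qed.
Lemma creE x y : cre (x +i* y : CC R) = x. Proof. by []. Qed.
Lemma cimE x y : cim (x +i* y : CC R) = y. Proof. by []. Qed.
Lemma cre0 : cre (0 : CC R) = 0. Proof. by []. Qed.
Lemma cim0 : cim (0 : CC R) = 0. Proof. by []. Qed.
Lemma cre1 : cre (1 : CC R) = 1. Proof. by []. Qed.
Lemma cim1 : cim (1 : CC R) = 0. Proof. by []. Qed.
Lemma creV z : cre z^-1 = cre z / (cre z ^+ 2 + cim z ^+ 2).
Proof. by case: z. Qed.
Lemma cimV z : cim z^-1 = - (cim z / (cre z ^+ 2 + cim z ^+ 2)).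
Proof. by case: z. Qed.

Lemma cre_cexp z : cre (cexp z) = expR (cre z) * cos (cim z).
Proof. by rewrite /cexp creM creR cimR mul0r subr0. Qed.

Lemma cim_cexp z : cim (cexp z) = expR (cre z) * sin (cim z).
Proof. by rewrite /cexp cimM creR cimR mul0r addr0. Qed.

(* [cexp] comes first: otherwise the product rules would unfold it. *)
Definition ccE := (cre_cexp, cim_cexp, creD, cimD, creN, cimN, creM, cimM, creR,
  cimR, creI, cimI, cre0, cim0, cre1, cim1).

Lemma CiCi : Ci * Ci = -1 :> CC R.
Proof. by apply: cP; rewrite !ccE; ring. Qed.

Lemma Ci_neq0 : (Ci : CC R) != 0.
Proof. by rewrite eq_complex/= oner_eq0 andbF. Qed.

Lemma realc_eq0 x : ((x%:C : CC R) == 0) = (x == 0).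
Proof. by rewrite eq_complex/= eqxx andbT. Qed.

Lemma realcD x y : (x + y)%:C = x%:C + y%:C :> CC R.
Proof. exact: rmorphD. Qed.
Lemma realcM x y : (x * y)%:C = x%:C * y%:C :> CC R.
Proof. exact: rmorphM. Qed.
Lemma realcN x : (- x)%:C = - x%:C :> CC R.
Proof. exact: rmorphN. Qed.
Lemma realcB x y : (x - y)%:C = x%:C - y%:C :> CC R.
Proof. exact: rmorphB. Qed.
Lemma realcV x : (x^-1)%:C = (x%:C)^-1 :> CC R.
Proof. exact: fmorphV. Qed.
Lemma realcX x n : (x ^+ n)%:C = (x%:C) ^+ n :> CC R.
Proof. exact: rmorphXn. Qed.
Lemma realcn n : (n%:R)%:C = n%:R :> CC R.
Proof. exact: rmorph_nat. Qed.

(** The norm of [CC R] takes its values in [R[i]]; estimates and integrability need a real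
    modulus. *)
Definition cabs z : R := Num.sqrt (cre z ^+ 2 + cim z ^+ 2).

Lemma cabsE z : (cabs z)%:C = `|z : R[i]|.
Proof. by rewrite normc_def. Qed.

Lemma cabs_ge0 z : 0 <= cabs z. Proof. exact: sqrtr_ge0. Qed.

Lemma cabsM z u : cabs (z * u) = cabs z * cabs u.
Proof. by apply: complexI; rewrite realcM !cabsE normrM. Qed.

Lemma cabsD z u : cabs (z + u) <= cabs z + cabs u.
Proof. by rewrite -lecR realcD !cabsE ler_normD. Qed.

Lemma cabsN z : cabs (- z) = cabs z.
Proof. by rewrite /cabs creN cimN !sqrrN. Qed.

Lemma cabsR x : cabs x%:C = `|x|.
Proof. by rewrite /cabs creR cimR expr0n addr0 sqrtr_sqr. Qed.

Lemma cabsI : cabs Ci = 1.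
Proof. by rewrite /cabs creI cimI expr0n add0r expr1n sqrtr1. Qed.

Lemma cabs_sqr z : cabs z ^+ 2 = cre z ^+ 2 + cim z ^+ 2.
Proof. by rewrite sqr_sqrtr// addr_ge0// sqr_ge0. Qed.

Lemma cre_le_cabs z : `|cre z| <= cabs z.
Proof. by rewrite -sqrtr_sqr ler_wsqrtr// lerDl sqr_ge0. Qed.

Lemma cim_le_cabs z : `|cim z| <= cabs z.
Proof. by rewrite -sqrtr_sqr ler_wsqrtr// lerDr sqr_ge0. Qed.

Lemma cabs_le z : cabs z <= `|cre z| + `|cim z|.
Proof.
rewrite -[leRHS]ger0_norm ?addr_ge0// -sqrtr_sqr ler_wsqrtr// sqrrD.
by rewrite !real_normK ?num_real// -addrA lerD2l lerDr mulrn_wge0// mulr_ge0.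
Qed.

Lemma cabsV z : cabs z^-1 = (cabs z)^-1.
Proof. by apply: complexI; rewrite realcV !cabsE normfV. Qed.

Lemma cre_neq0 z : cre z != 0 -> z != 0.
Proof. by apply: contra_neq => ->. Qed.

Lemma creJ z : cre (cconj z) = cre z. Proof. by case: z. Qed.
Lemma cimJ z : cim (cconj z) = - cim z. Proof. by case: z. Qed.

Lemma cexpD z u : cexp (z + u) = cexp z * cexp u.
Proof.
by apply: cP; rewrite !ccE expRD ?cosD ?sinD; ring.
Qed.

Lemma cexp0 : cexp 0 = 1 :> CC R.
Proof. by apply: cP; rewrite !ccE expR0 ?cos0 ?sin0 mul1r. Qed.

Lemma cabs_cexp z : cabs (cexp z) = expR (cre z).
Proof.
rewrite /cabs cre_cexp cim_cexp !exprMn -mulrDr cos2Dsin2 mulr1 sqrtr_sqr.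
by rewrite ger0_norm// expR_ge0.
Qed.

Lemma cexp_conj z : cexp (cconj z) = cconj (cexp z).
Proof.
by apply: cP; rewrite ?creJ ?cimJ ?cre_cexp ?cim_cexp ?creJ ?cimJ ?cosN ?sinN ?mulrN.
Qed.

End complex_basics.

(** * The principal square root *)

Section csqrt_theory.
Context {R : realType}.
Implicit Types (z u v : CC R) (x y : R).

Lemma csqrt_argD z : 0 <= (cabs z + cre z) / 2.
Proof.
rewrite divr_ge0// -(opprK (cre z)) subr_ge0 (le_trans _ (cre_le_cabs z))//.
by rewrite -normrN ler_norm.
Qed.

Lemma csqrt_argB z : 0 <= (cabs z - cre z) / 2.
Proof. by rewrite divr_ge0// subr_ge0 (le_trans _ (cre_le_cabs z))// ler_norm. Qed.

Lemma cre_csqrt z : cre (csqrt z) = Num.sqrt ((cabs z + cre z) / 2).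
Proof. by []. Qed.

Lemma cim_csqrt z : cim (csqrt z) =
  (if cim z < 0 then -1 else 1) * Num.sqrt ((cabs z - cre z) / 2).
Proof. by []. Qed.

Lemma cre_csqrt_ge0 z : 0 <= cre (csqrt z).
Proof. by rewrite cre_csqrt sqrtr_ge0. Qed.

Lemma csqrtK z : csqrt z ^+ 2 = z.
Proof.
have E := cabs_sqr z.
rewrite expr2; apply: cP; rewrite !ccE cre_csqrt cim_csqrt.
  rewrite -!expr2 exprMn !sqr_sqrtr ?csqrt_argD ?csqrt_argB//.
  have -> : (if cim z < 0 then -1 else 1 : R) ^+ 2 = 1 by case: ifP => _; ring.
  by field.
set e := (if _ then _ else _).
have -> : Num.sqrt ((cabs z + cre z) / 2) * (e * Num.sqrt ((cabs z - cre z) / 2)) +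
   e * Num.sqrt ((cabs z - cre z) / 2) * Num.sqrt ((cabs z + cre z) / 2) =
   e * 2 * (Num.sqrt ((cabs z + cre z) / 2) * Num.sqrt ((cabs z - cre z) / 2)).
  by ring.
rewrite -sqrtrM ?csqrt_argD//.
have -> : (cabs z + cre z) / 2 * ((cabs z - cre z) / 2) = (cim z / 2) ^+ 2.
  transitivity ((cabs z ^+ 2 - cre z ^+ 2) / 4); first by field.
  by rewrite E; field.
rewrite sqrtr_sqr normrM normfV normr_nat /e.
case: ifPn => [y0|]; first by rewrite ltr0_norm//; field.
by rewrite -leNgt => y0; rewrite ger0_norm//; field.
Qed.

Lemma cre_csqrt_gt0 z : cim z != 0 -> 0 < cre (csqrt z).
Proof.
move=> y0; rewrite lt_neqAle cre_csqrt_ge0 andbT; apply/eqP => /esym p0.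
have : cim (csqrt z ^+ 2) = 0 by rewrite expr2 !ccE p0; ring.
by rewrite csqrtK; apply/eqP.
Qed.

(** Of the factors of (sqrt z - u)(sqrt z + u) = 0 the second has positive real part. This
    identifies the branch at the end of the path and under conjugation. *)
Lemma csqrt_unique z u : 0 < cre u -> u ^+ 2 = z -> csqrt z = u.
Proof.
move=> u0 uz; apply/eqP; rewrite -subr_eq0.
have : (csqrt z - u) * (csqrt z + u) = 0 by rewrite -subr_sqr csqrtK uz subrr.
move/eqP; rewrite mulf_eq0 => /orP[//|/eqP E].
have : cre (csqrt z + u) = 0 by rewrite E.
by rewrite creD => /eqP; rewrite gt_eqF// ltr_wpDl// cre_csqrt_ge0.
Qed.

Lemma csqrt_cabs z : cabs (csqrt z) ^+ 2 = cabs z.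
Proof. by rewrite expr2 -cabsM -expr2 csqrtK. Qed.

End csqrt_theory.

(** * Calculus of complex-valued functions of a real variable *)

Section complex_calculus.
Context {R : realType}.
Notation mu := (@lebesgue_measure R).
Implicit Types (f g : R -> CC R) (t : R) (l k : CC R).

Definition cder f t l :=
  is_derive t 1 (fun s => cre (f s)) (cre l) /\
  is_derive t 1 (fun s => cim (f s)) (cim l).

Lemma cderEq f t l l' : cder f t l -> l = l' -> cder f t l'.
Proof. by move=> H <-. Qed.

Lemma cderExt f g t l : f =1 g -> cder f t l -> cder g t l.
Proof. by move=> /funext <-. Qed.

Lemma cderCst l t : cder (fun=> l) t 0.
Proof. by split; exact: dCst. Qed.

Lemma cderR (f : R -> R) t (l : R) : is_derive t 1 f l ->
  cder (fun s => (f s)%:C) t l%:C.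
Proof. by move=> H; split => //=; exact: dCst. Qed.

Lemma cderD f g t l k : cder f t l -> cder g t k -> cder (fun s => f s + g s) t (l + k).
Proof.
move=> [f1 f2] [g1 g2]; split.
  by apply: (dExt _ (dEq (dD f1 g1) _)) => [s|]; rewrite creD.
by apply: (dExt _ (dEq (dD f2 g2) _)) => [s|]; rewrite cimD.
Qed.

Lemma cderM f g t l k : cder f t l -> cder g t k ->
  cder (fun s => f s * g s) t (l * g t + f t * k).
Proof.
move=> [f1 f2] [g1 g2]; split.
  apply: (dExt _ (dEq (dB (dM f1 g1) (dM f2 g2)) _)) => [s|]; first by rewrite creM.
  by rewrite !ccE; ring.
apply: (dExt _ (dEq (dD (dM f1 g2) (dM f2 g1)) _)) => [s|]; first by rewrite cimM.
by rewrite !ccE; ring.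
Qed.

Lemma cderZ f t l k : cder f t l -> cder (fun s => k * f s) t (k * l).
Proof. by move=> H; apply: (cderEq (cderM (cderCst k t) H)); rewrite mul0r add0r. Qed.

Lemma cderExp f t l : cder f t l -> cder (fun s => cexp (f s)) t (l * cexp (f t)).
Proof.
move=> [f1 f2]; split.
  apply: (dExt _ (dEq (dM (dExp f1) (dCos f2)) _)) => [s|]; first by rewrite cre_cexp.
  by rewrite !ccE; ring.
apply: (dExt _ (dEq (dM (dExp f1) (dSin f2)) _)) => [s|]; first by rewrite cim_cexp.
by rewrite !ccE; ring.
Qed.

(** The argument moves horizontally at a fixed nonzero height, so it never meets the cut: the sign
    in the definition is constant and both radicands stay positive. *)
Lemma cder_csqrt (X : R -> R) (y t l : R) : y != 0 -> is_derive t 1 X l ->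
  cder (fun s => csqrt (X s +i* y)) t (l%:C / (2 * csqrt (X t +i* y))).
Proof.
move=> y0 dX'.
have absX (x : R) : `|x| < Num.sqrt (x ^+ 2 + y ^+ 2).
  rewrite -sqrtr_sqr ltr_sqrt; first by rewrite ltrDl exprn_even_gt0.
  by rewrite ltr_wpDl ?sqr_ge0// exprn_even_gt0.
have M0 (x : R) : 0 < x ^+ 2 + y ^+ 2.
  by rewrite ltr_wpDl ?sqr_ge0// exprn_even_gt0.
pose M x := Num.sqrt (x ^+ 2 + y ^+ 2).
have argD x : 0 < (M x + x) / 2.
  rewrite divr_gt0// -(opprK x) subr_gt0 opprK (le_lt_trans _ (absX x))//.
  by rewrite -normrN ler_norm.
have argB x : 0 < (M x - x) / 2.
  by rewrite divr_gt0// subr_gt0 (le_lt_trans _ (absX x))// ler_norm.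
have dS : is_derive t 1 (fun s => X s ^+ 2 + y ^+ 2) (2 * X t * l).
  by apply: (dEq (dD (dX 2 dX') (dCst _ _))); rewrite /= expr1 addr0.
have dM' : is_derive t 1 (fun s => M (X s)) (X t * l / M (X t)).
  apply: (dEq (dSqrt dS (M0 (X t)))); rewrite -/(M (X t)).
  by field; rewrite gt_eqF// sqrtr_gt0.
have Mt0 : 0 < M (X t) by rewrite sqrtr_gt0.
pose z : CC R := X t +i* y.
have zM : cabs z = M (X t) by [].
have z0 : csqrt z != 0 by apply: cre_neq0; rewrite gt_eqF// cre_csqrt_gt0.
(* The inverse of sqrt z is its conjugate divided by |z|, which separates the claimed derivative
   into components. *)
have L : (l%:C / (2 * csqrt z)) =
    (l / (2 * M (X t)))%:C * (cre (csqrt z) +i* (- cim (csqrt z))).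
  apply: (mulIf z0); rewrite -[RHS]mulrA.
  have -> : (cre (csqrt z) +i* (- cim (csqrt z))) * csqrt z = (M (X t))%:C.
    apply: cP; rewrite !ccE creE cimE; last by ring.
    by rewrite -zM -csqrt_cabs cabs_sqr; ring.
  rewrite -realcM (_ : l / (2 * M (X t)) * M (X t) = l / 2); last first.
    by field; rewrite gt_eqF.
  by rewrite invfM mulrA mulfVK// realcM realcV realcn.
split.
  have H := dSqrt (dM (dD dM' dX') (dCst 2^-1 t)) (argD (X t)).
  apply: (dExt _ (dEq H _)) => [s|]; first by rewrite cre_csqrt.
  rewrite -/z L !ccE creE cimE cre_csqrt zM -/(M _).
  have P : 0 < Num.sqrt ((M (X t) + X t) / 2) by rewrite sqrtr_gt0 argD.
  have PE : Num.sqrt ((M (X t) + X t) / 2) ^+ 2 = (M (X t) + X t) / 2.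
    by rewrite sqr_sqrtr// ltW.
  move: P PE; set P := Num.sqrt _ => P0 PE.
  apply: (mulIf (lt0r_neq0 P0)).
  rewrite mul0r subr0 -[RHS]mulrA -expr2 PE.
  by field; rewrite !gt_eqF.
have H := dZ (if y < 0 then -1 else 1)
  (dSqrt (dM (dB dM' dX') (dCst 2^-1 t)) (argB (X t))).
apply: (dExt _ (dEq H _)) => [s|]; first by rewrite cim_csqrt.
rewrite -/z L !ccE creE cimE cim_csqrt zM -/(M _) -[cim z]/y.
have P : 0 < Num.sqrt ((M (X t) - X t) / 2) by rewrite sqrtr_gt0 argB.
have PE : Num.sqrt ((M (X t) - X t) / 2) ^+ 2 = (M (X t) - X t) / 2.
  by rewrite sqr_sqrtr// ltW.
move: P PE; set P := Num.sqrt _ => P0 PE.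
set e := (if _ then _ else _).
apply: (mulIf (lt0r_neq0 P0)).
have -> : (l / (2 * M (X t)) * - (e * P) + 0 * cre (csqrt z)) * P =
    - (l / (2 * M (X t))) * e * P ^+ 2 by ring.
rewrite PE.
by field; rewrite !gt_eqF.
Qed.

Lemma cder_continuous f f' : (forall t, cder f t (f' t)) ->
  continuous (fun s => cre (f s)) /\ continuous (fun s => cim (f s)).
Proof.
move=> H; split.
  exact: (is_derive_continuous (f := fun t => cre (f' t)) (fun t => (H t).1)).
exact: (is_derive_continuous (f := fun t => cim (f' t)) (fun t => (H t).2)).
Qed.

Lemma cder_cst f : (forall t, cder f t 0) -> forall s t, f s = f t.
Proof.
move=> H s t; apply: cP.
  by apply: (is_derive_0_is_cst (f := fun x => cre (f x))) => x; exact: (H x).1.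
by apply: (is_derive_0_is_cst (f := fun x => cim (f x))) => x; exact: (H x).2.
Qed.

Lemma cintegral_FTC f F (a b : R) : a <= b ->
  continuous (fun s => cre (f s)) -> continuous (fun s => cim (f s)) ->
  (forall t, cder F t (f t)) -> cintegral mu `[a, b] f = F b - F a.
Proof.
move=> ab c1 c2 dF; rewrite /cintegral.
rewrite (Rintegral_FTC (F := fun s => cre (F s)) ab c1 (fun t => (dF t).1)).
rewrite (Rintegral_FTC (F := fun s => cim (F s)) ab c2 (fun t => (dF t).2)).
by apply: cP; rewrite !ccE.
Qed.

Lemma cintegral_FTC_y f F :
  cintegrable mu `[0, +oo[ f ->
  continuous (fun s => cre (f s)) -> continuous (fun s => cim (f s)) ->
  (forall t, cder F t (f t)) ->
  cabs (F n%:R) @[n --> \oo] --> 0 ->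
  cintegral mu `[0, +oo[ f = - F 0.
Proof.
move=> [i1 i2] c1 c2 dF F0; rewrite /cintegral.
rewrite (Rintegral_FTC_y (F := fun s => cre (F s)) (B := 0) i1 c1 (fun t => (dF t).1)).
  rewrite (Rintegral_FTC_y (F := fun s => cim (F s)) (B := 0) i2 c2 (fun t => (dF t).2)).
    by apply: cP; rewrite !ccE ?creE ?cimE add0r.
  apply: norm_cvg0; apply: (squeeze_cvgr _ (cvg_cst 0) F0).
  by apply: nearW => n; rewrite normr_ge0 cim_le_cabs.
apply: norm_cvg0; apply: (squeeze_cvgr _ (cvg_cst 0) F0).
by apply: nearW => n; rewrite normr_ge0 cre_le_cabs.
Qed.

Lemma Rder_under_integral (D : set R) (f f' : R -> R -> R) (t L : R) (G : R -> R) :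
  measurable D -> `|t| < L ->
  (forall s, `|s| < L -> mu.-integrable D (EFin \o f s)) ->
  (forall s m : R, `|s| < L -> D m -> is_derive s 1 (f ^~ m) (f' s m)) ->
  (forall m, 0 <= G m) -> mu.-integrable D (EFin \o G) ->
  (forall s m, `|s| < L -> D m -> `|f' s m| <= G m) ->
  is_derive t 1 (fun s => Rintegral mu D (f s)) (Rintegral mu D (f' t)).
Proof.
move=> mD tL fi df G0 Gi fG.
have I (s : R) : (`](- L), L[%classic : set R) s -> `|s| < L.
  by rewrite /= in_itv/= ltr_norml.
have tI : (`](- L), L[%classic : set R) t by rewrite /= in_itv/= -ltr_norml.
have d1E s m : `|s| < L -> D m -> partial1of2 f s m = f' s m.
  by move=> sL Dm; rewrite partial1of2E; have [_ ->] := df s m sL Dm.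
have H := @cvg_differentiation_under_integral R _ (measurableTypeR R) mu f D mD t
  (- L) L tI (fun s sI => fi s (I s sI))
  (fun s m sI Dm => let: DeriveDef d _ := df s m (I s sI) Dm in d) G G0 Gi.
apply: cvg_is_derive.
have {}H := H _.
rewrite (_ : Rintegral mu D (f' t) = Rintegral mu D (fun y => partial1of2 f t y)); last first.
  by apply: eq_Rintegral => m /set_mem Dm; rewrite d1E.
under eq_fun do rewrite (addrC t).
apply: H => s m sI Dm; rewrite d1E//; [exact: fG (I s sI) Dm|exact: I].
Qed.

Lemma cder_under_integral (D : set R) (f f' : R -> R -> CC R) (t L : R) (G : R -> R) :
  measurable D -> `|t| < L ->
  (forall s, `|s| < L -> cintegrable mu D (f s)) ->
  (forall s m, `|s| < L -> D m -> cder (f ^~ m) s (f' s m)) ->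
  (forall m, 0 <= G m) -> mu.-integrable D (EFin \o G) ->
  (forall s m, `|s| < L -> D m -> cabs (f' s m) <= G m) ->
  cder (fun s => cintegral mu D (f s)) t (cintegral mu D (f' t)).
Proof.
move=> mD tL fi df G0 Gi fG; split.
  apply: (@Rder_under_integral D (fun s m => cre (f s m)) (fun s m => cre (f' s m))
    t L G mD tL _ _ G0 Gi).
  - by move=> s sL; exact: (fi s sL).1.
  - by move=> s m sL Dm; exact: (df s m sL Dm).1.
  - by move=> s m sL Dm; rewrite (le_trans (cre_le_cabs _))// fG.
apply: (@Rder_under_integral D (fun s m => cim (f s m)) (fun s m => cim (f' s m))
  t L G mD tL _ _ G0 Gi).
- by move=> s sL; exact: (fi s sL).2.
- by move=> s m sL Dm; exact: (df s m sL Dm).2.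
- by move=> s m sL Dm; rewrite (le_trans (cim_le_cabs _))// fG.
Qed.

Lemma cintegrable_le d (T : measurableType d) (nu : {measure set T -> \bar R})
    (D : set T) (f : T -> CC R) (G : T -> R) :
  measurable D -> measurable_fun D (fun x => cre (f x)) ->
  measurable_fun D (fun x => cim (f x)) ->
  nu.-integrable D (EFin \o G) -> (forall x, D x -> cabs (f x) <= G x) ->
  cintegrable nu D f.
Proof.
move=> mD m1 m2 Gi fG; split; (apply: (le_integrable mD _ _ Gi);
  [exact/measurable_EFinP|]) => x Dx; rewrite /= lee_fin;
  apply: (le_trans _ (ler_norm _)); apply: le_trans (fG x Dx).
  exact: cre_le_cabs.
exact: cim_le_cabs.
Qed.

Lemma cintegralZl d (T : measurableType d) (nu : {measure set T -> \bar R})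
    (D : set T) (f : T -> CC R) k : measurable D -> cintegrable nu D f ->
  cintegral nu D (fun x => k * f x) = k * cintegral nu D f.
Proof.
move=> mD [i1 i2].
have iZ (c : R) (h : T -> R) : nu.-integrable D (EFin \o h) ->
    nu.-integrable D (EFin \o (fun x => c * h x)).
  by move=> ih; exact: (integrableZl mD c ih).
apply: cP; rewrite /cintegral !ccE ?creE ?cimE -!RintegralZl//.
  by rewrite -RintegralB//; [apply: eq_Rintegral => x _; rewrite creM|exact: iZ..].
by rewrite -RintegralD//; [apply: eq_Rintegral => x _; rewrite cimM|exact: iZ..].
Qed.

End complex_calculus.

(** * Weyl's identity *)

Section exponential_bounds.
Context {R : realType}.
Notation mu := (@lebesgue_measure R).

Lemma expR_ge_sqr (x : R) : 0 <= x -> x ^+ 2 / 4 <= expR x.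
Proof.
move=> x0; have H := expR_ge1Dx (x / 2).
have -> : expR x = expR (x / 2) ^+ 2 by rewrite expr2 -expRD -splitr.
rewrite (_ : x ^+ 2 / 4 = (x / 2) ^+ 2); last by field.
by apply: lerXn2r; rewrite ?nnegrE ?divr_ge0 ?expR_ge0// (le_trans _ H)// lerDr.
Qed.

(** Half of the exponential absorbs the square: x^2 / 4 <= e^x at x = c m / 2 reads m^2 <= (16 /
    c^2) e^{c m / 2}. *)
Lemma polyexp_le (A B c m : R) : 0 <= A -> 0 <= B -> 0 < c -> 0 <= m ->
  (A + B * m ^+ 2) * expR (- (c * m)) <=
  (A + B * (16 / c ^+ 2)) * expR (- (c / 2 * m)).
Proof.
move=> A0 B0 c0 m0.
have E : expR (- (c * m)) = expR (- (c / 2 * m)) * expR (- (c / 2 * m)).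
  by rewrite -expRD; congr expR; field.
have e0 : 0 <= expR (- (c / 2 * m)) := expR_ge0 _.
rewrite E mulrA ler_wpM2r// mulrDl lerD//.
  by rewrite ler_piMr// -expR0 ler_expR oppr_le0 !mulr_ge0// ltW.
rewrite -mulrA ler_wpM2l// expRN -ler_pdivlMr ?invr_gt0 ?expR_gt0// invrK.
have H := @expR_ge_sqr (c / 2 * m) _.
have {}H : (c / 2 * m) ^+ 2 / 4 <= expR (c / 2 * m).
  by apply: H; rewrite !mulr_ge0// ltW.
have c2 : 0 < 16 / c ^+ 2 by rewrite divr_gt0// exprn_gt0.
apply: le_trans (_ : 16 / c ^+ 2 * ((c / 2 * m) ^+ 2 / 4) <= _).
  by rewrite le_eqVlt; apply/orP; left; apply/eqP; field; rewrite gt_eqF.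
by rewrite ler_wpM2l// ltW.
Qed.

Lemma expR_nat_cvg0 (c : R) : 0 < c -> expR (- (c * n%:R)) @[n --> \oo] --> 0.
Proof.
move=> c0; have -> : (fun n : nat => expR (- (c * n%:R))) = (fun n => expR (- c) ^+ n).
  by apply/funext => n; rewrite -mulNr mulrC expRM_natl.
apply: cvg_expr; rewrite ger0_norm ?expR_ge0// -expR0 ltr_expR oppr_lt0//.
Qed.

Lemma integrable_expR (c : R) : 0 < c ->
  mu.-integrable `[0, +oo[ (EFin \o (fun m : R => expR (- (c * m)))).
Proof.
move=> c0.
have dE (x : R) : is_derive x 1 (fun m => - c^-1 * expR (- (c * m))) (expR (- (c * x))).
  apply: (dEq (dZ _ (dExp (dN (dZ c (dId x)))))).
  by field; rewrite gt_eqF.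
have cE : continuous (fun m : R => expR (- (c * m))).
  move=> x; apply: (@continuous_comp _ _ _ (fun m => - (c * m)) expR); last exact: continuous_expR.
  by apply: cvgN; apply: cvgM; [exact: cvg_cst|exact: cvg_id].
have mE : measurable_fun [set: measurableTypeR R] (fun m : R => expR (- (c * m))).
  exact: continuous_measurable_fun.
apply/integrableP; split; first by apply: measurable_funTS; exact/measurable_EFinP.
under eq_integral do rewrite /= ger0_norm ?expR_ge0//.
have l : - c^-1 * expR (- (c * x)) @[x --> +oo] --> - c^-1 * 0.
  apply: cvgM; first exact: cvg_cst.
  apply: (cvg_comp (fun x => c * x) (fun x => expR (- x))); last exact: cvgr_expR.
  by apply: gt0_cvgMry => //.
rewrite (ge0_continuous_FTC2y _ _ l)//.
- by rewrite ltry.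
- exact: (continuous_subspaceT cE).
- by apply: cvg_at_right_filter; exact: (is_derive_continuous dE).
- by move=> x _; rewrite derive1E; have [_ ->] := dE x.
Qed.

Lemma integrable_polyexp (A B c : R) : 0 <= A -> 0 <= B -> 0 < c ->
  mu.-integrable `[0, +oo[ (EFin \o (fun m : R => (A + B * m ^+ 2) * expR (- (c * m)))).
Proof.
move=> A0 B0 c0.
have m0y : measurable (`[0, +oo[%classic : set (measurableTypeR R)) by exact: measurable_itv.
have iK := integrableZl m0y (A + B * (16 / c ^+ 2))
  (integrable_expR (divr_gt0 c0 (ltr0n R 2))).
apply: (le_integrable _ _ _ iK) => //.
- apply: measurable_funTS; apply/measurable_EFinP.
  apply: continuous_measurable_fun => x; apply: cvgM.
    apply: cvgD; first exact: cvg_cst.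
    by apply: cvgM; [exact: cvg_cst|exact: sqr_continuous].
  apply: (@continuous_comp _ _ _ (fun m => - (c * m)) expR); last exact: continuous_expR.
  by apply: cvgN; apply: cvgM; [exact: cvg_cst|exact: cvg_id].
- move=> m; rewrite /= in_itv/= andbT => m0; rewrite lee_fin.
  rewrite !ger0_norm; first exact: polyexp_le.
    by rewrite mulr_ge0 ?expR_ge0// addr_ge0// mulr_ge0// divr_ge0// sqr_ge0.
  by rewrite mulr_ge0 ?expR_ge0// addr_ge0// mulr_ge0// sqr_ge0.
Qed.

End exponential_bounds.

Section cdifferentiable.
Context {R : realType}.
Notation mu := (@lebesgue_measure R).
Implicit Types f g : R -> CC R.

Definition cdiff f := forall t, exists l, cder f t l.

Lemma cdiff_continuous f : cdiff f ->
  continuous (fun s => cre (f s)) /\ continuous (fun s => cim (f s)).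
Proof.
move=> /choice[f' df]; exact: (cder_continuous df).
Qed.

Lemma cdiff_measurable f (D : set (measurableTypeR R)) : cdiff f ->
  measurable_fun D (fun s => cre (f s)) /\ measurable_fun D (fun s => cim (f s)).
Proof.
move=> /cdiff_continuous[c1 c2]; split; apply: measurable_funTS;
  exact: continuous_measurable_fun.
Qed.

Lemma cdiffM f g : cdiff f -> cdiff g -> cdiff (fun s => f s * g s).
Proof.
move=> df dg t; have [l L] := df t; have [k K] := dg t.
by exists (l * g t + f t * k); exact: cderM.
Qed.

Lemma cdiffD f g : cdiff f -> cdiff g -> cdiff (fun s => f s + g s).
Proof.
move=> df dg t; have [l L] := df t; have [k K] := dg t.
by exists (l + k); exact: cderD.
Qed.

Lemma cdiffExp f : cdiff f -> cdiff (fun s => cexp (f s)).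
Proof. by move=> df t; have [l L] := df t; exists (l * cexp (f t)); exact: cderExp. Qed.

Definition rdiff (f : R -> R) := forall t : R, exists l : R, is_derive t 1 f l.

Lemma rdiffC (c : R) : rdiff (fun=> c).
Proof. by move=> t; exists 0; exact: dCst. Qed.

Lemma rdiffId : rdiff (fun t => t).
Proof. by move=> t; exists 1; exact: dId. Qed.

Lemma rdiffM (f g : R -> R) : rdiff f -> rdiff g -> rdiff (fun s => f s * g s).
Proof.
move=> df dg t; have [l L] := df t; have [k K] := dg t.
by exists (l * g t + f t * k); exact: dM.
Qed.

Lemma rdiffD (f g : R -> R) : rdiff f -> rdiff g -> rdiff (fun s => f s + g s).
Proof.
by move=> df dg t; have [l L] := df t; have [k K] := dg t; exists (l + k); exact: dD.
Qed.

Lemma rdiffX (f : R -> R) n : rdiff f -> rdiff (fun s => f s ^+ n).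
Proof.
by move=> df t; have [l L] := df t; exists (n%:R * f t ^+ n.-1 * l); exact: dX.
Qed.

Lemma rdiff_comp (f g : R -> R) : rdiff f -> rdiff g -> rdiff (fun s => f (g s)).
Proof.
move=> df dg t; have [k K] := dg t; have [l L] := df (g t).
by exists (l * k); exact: (dComp L K).
Qed.

Lemma rdiff_continuous (f : R -> R) : rdiff f -> continuous f.
Proof. by move=> /choice[f' df]; exact: (is_derive_continuous df). Qed.

Lemma cdiffR (f : R -> R) : rdiff f -> cdiff (fun s => (f s)%:C).
Proof. by move=> df t; have [l L] := df t; exists l%:C; exact: cderR. Qed.

Lemma rdiff_besj : rdiff (@besj R).
Proof. by move=> t; exists (besg t); exact: is_derive_besj. Qed.

Lemma rdiff_besg : rdiff (@besg R).
Proof. by move=> t; exists (besh t); exact: is_derive_besg. Qed.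

Lemma cdiffZ f (k : CC R) : cdiff f -> cdiff (fun s => k * f s).
Proof. by move=> df t; have [l L] := df t; exists (k * l); exact: cderZ. Qed.

Lemma cdiff_lin (k : CC R) : cdiff (fun s => k * s%:C).
Proof. by apply: cdiffZ; apply: cdiffR; exact: rdiffId. Qed.

End cdifferentiable.

Section weyl.
Context {R : realType}.
Notation mu := (@lebesgue_measure R).

Lemma besj0 : besj 0 = 1 :> R.
Proof.
rewrite /besj; apply/cvg_lim => //; rewrite -cvg_shiftS.
rewrite (_ : (fun n => _) = (fun=> 1)); first exact: cvg_cst.
apply/funext => n; rewrite /pseries /series/= big_nat_recl//= big1 => [|i _].
  by rewrite /bcoef fact0 expr0 expr1n divr1 mulr1 addr0.
by rewrite exprS mul0r mulr0.
Qed.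

End weyl.

(** * The plane-wave kernels along the path *)

Section weyl_kernel.
Context {R : realType}.
Notation mu := (@lebesgue_measure R).
Variables (w x0 y : R).
Hypothesis (y0 : y != 0).

(** As y is nonzero, the radicand is never real and the real part of the root stays positive, so the
    whole path lies on one branch. *)
Definition zpath (t : R) : CC R := csqrt ((x0 - t ^+ 2) +i* y).
Local Notation z := zpath.

Lemma cder_zpath (t : R) : cder z t (- t%:C / z t).
Proof.
have dX' : is_derive t 1 (fun t : R => x0 - t ^+ 2) (- (2 * t)).
  by apply: (dEq (dB (dCst x0 t) (dX 2 (dId t)))); rewrite /= expr1 mulr1 sub0r.
apply: (cderEq (cder_csqrt y0 dX')); rewrite -/(z t).
by rewrite realcN realcM realcn invfM mulrA mulNr [2 * _]mulrC mulfK ?pnatr_eq0// mulNr.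
Qed.

Lemma cre_zpath_gt0 (t : R) : 0 < cre (z t).
Proof. exact: cre_csqrt_gt0. Qed.

Lemma zpath_neq0 t : z t != 0.
Proof. by apply: cre_neq0; rewrite gt_eqF// cre_zpath_gt0. Qed.

(** Twice the square of Re z is |z^2| + Re z^2. From s to L the second term drops by L^2 - s^2 and
    the first grows by at most as much. This supplies a common decay rate for all |s| <= L. *)
Lemma cre_zpath_mono (s L : R) : `|s| <= L -> cre (z L) <= cre (z s).
Proof.
move=> sL; rewrite !cre_csqrt !creE ler_wsqrtr// ler_wpM2r//.
have sq : s ^+ 2 <= L ^+ 2.
  by rewrite -(real_normK (num_real s)); apply: lerXn2r; rewrite ?nnegrE ?(le_trans _ sL).
have := cabsD ((x0 - s ^+ 2) +i* y) (- (L ^+ 2 - s ^+ 2)%:C).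
rewrite cabsN cabsR ger0_norm ?subr_ge0//.
have -> : ((x0 - s ^+ 2) +i* y : CC R) + - (L ^+ 2 - s ^+ 2)%:C = (x0 - L ^+ 2) +i* y.
  by apply: cP; rewrite !ccE ?creE ?cimE; ring.
move: (cabs _) (cabs _) => A B; lra.
Qed.

Lemma cabs_zpath_le (s L : R) : `|s| <= L -> cabs (z s) <= 1 + (`|x0| + L ^+ 2 + `|y|).
Proof.
move=> sL.
have H : cabs (z s) ^+ 2 <= `|x0| + L ^+ 2 + `|y|.
  rewrite csqrt_cabs (le_trans (cabs_le _))// creE cimE lerD2r.
  rewrite (le_trans (ler_normB _ _))// lerD2l ger0_norm ?sqr_ge0//.
  by rewrite -(real_normK (num_real s)); apply: lerXn2r; rewrite ?nnegrE ?(le_trans _ sL).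
apply: le_trans (_ : 1 + cabs (z s) ^+ 2 <= _); last by rewrite lerD2l.
have := cabs_ge0 (z s); move: (cabs (z s)) => c c0; nra.
Qed.

Variables (eps : R) (kap : CC R).
Hypotheses (kap2 : kap * kap = eps%:C) (kap1 : cabs kap = 1).

(** One kernel treats both integrals: (eps, kap) = (-1, i) is the propagating part and (1, -1) the
    evanescent one, with kap^2 = eps in each case. *)
Definition wk_a (m : R) : R := w ^+ 2 + eps * m ^+ 2.
Definition wk_E (t m : R) : CC R := cexp (kap * z t * m%:C).
Definition wk_f (t m : R) : CC R := (besj (wk_a m * t ^+ 2))%:C * wk_E t m.
Definition wk_f' (t m : R) : CC R :=
  (2 * t * (wk_a m * besg (wk_a m * t ^+ 2)))%:C * wk_E t m +
  (besj (wk_a m * t ^+ 2))%:C * (kap * (- t%:C / z t) * m%:C * wk_E t m).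
(** By Bessel's equation the m-derivative of [wk_a m * besg (wk_a m * t ^+ 2)] is - eps m j / 2.
    With eps = kap^2 and z' = - t / z it reproduces the term that the t-derivative of the
    exponential leaves. *)
Definition wk_F (t m : R) : CC R :=
  (2 * t)%:C / (kap * z t) * ((wk_a m * besg (wk_a m * t ^+ 2))%:C * wk_E t m).

Lemma kap_neq0 : kap != 0.
Proof.
by apply/eqP => E; move: kap1; rewrite E cabsR normr0 => /eqP; rewrite eq_sym oner_eq0.
Qed.

Lemma cder_wk_f (t m : R) : cder (wk_f ^~ m) t (wk_f' t m).
Proof.
have d0 : is_derive t 1 (fun t : R => wk_a m * t ^+ 2) (2 * t * wk_a m).
  by apply: (dEq (dZ (wk_a m) (dX 2 (dId t)))); rewrite /= expr1 mulr1 mulrC.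
have d1 := cderR (dComp (g := fun t => wk_a m * t ^+ 2)
  (is_derive_besj (wk_a m * t ^+ 2)) d0).
have d2 := cderExp (cderM (cderZ kap (cder_zpath t)) (cderCst m%:C t)).
apply: (cderEq (cderM d1 d2)); rewrite /wk_f' -/(wk_E t m) mulr0 addr0.
rewrite (_ : besg _ * _ = 2 * t * (wk_a m * besg (wk_a m * t ^+ 2)))//.
by ring.
Qed.

Lemma rdiff_wk_a : rdiff wk_a.
Proof.
apply: rdiffD; first exact: rdiffC.
by apply: rdiffM; [exact: rdiffC|apply: rdiffX; exact: rdiffId].
Qed.

Lemma cdiff_wk_E t : cdiff (wk_E t).
Proof. by apply: cdiffExp; exact: cdiff_lin. Qed.

Lemma rdiff_wk_j t : rdiff (fun m => besj (wk_a m * t ^+ 2)).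
Proof.
apply: (rdiff_comp rdiff_besj); apply: rdiffM; [exact: rdiff_wk_a|exact: rdiffC].
Qed.

Lemma rdiff_wk_g t : rdiff (fun m => besg (wk_a m * t ^+ 2)).
Proof.
apply: (rdiff_comp rdiff_besg); apply: rdiffM; [exact: rdiff_wk_a|exact: rdiffC].
Qed.

Lemma cdiff_wk_f t : cdiff (wk_f t).
Proof. by apply: cdiffM; [apply: cdiffR; exact: rdiff_wk_j|exact: cdiff_wk_E]. Qed.

Lemma cdiff_wk_f' t : cdiff (wk_f' t).
Proof.
apply: cdiffD.
  apply: cdiffM; last exact: cdiff_wk_E.
  apply: cdiffR; apply: rdiffM; first exact: rdiffC.
  by apply: rdiffM; [exact: rdiff_wk_a|exact: rdiff_wk_g].
apply: cdiffM; first by apply: cdiffR; exact: rdiff_wk_j.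
by apply: cdiffM; [exact: cdiff_lin|exact: cdiff_wk_E].
Qed.

(* The [t]-derivative of the kernel is an exact [m]-derivative; this is the
   invariance of the plane-wave integral under complex rotations. *)
Lemma cder_wk_F (t m : R) : cder (wk_F t) m (wk_f' t m).
Proof.
have da : is_derive m 1 wk_a (2 * eps * m).
  apply: (dEq (dD (dCst (w ^+ 2) m) (dZ eps (dX 2 (dId m))))).
  by rewrite /= expr1; ring.
have d0 : is_derive m 1 (fun m => wk_a m * t ^+ 2) (2 * eps * m * t ^+ 2).
  by apply: (dEq (dM da (dCst (t ^+ 2) m))); rewrite mulr0 addr0.
have dag : is_derive m 1 (fun m => wk_a m * besg (wk_a m * t ^+ 2))
    (- (eps * m * besj (wk_a m * t ^+ 2) / 2)).
  apply: (dEq (dM da (dComp (g := fun m => wk_a m * t ^+ 2)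
    (is_derive_besg (wk_a m * t ^+ 2)) d0))).
  have O := besODE (wk_a m * t ^+ 2).
  transitivity (2 * eps * m * (wk_a m * t ^+ 2 * besh (wk_a m * t ^+ 2) +
     besg (wk_a m * t ^+ 2))); first by ring.
  by rewrite O; field.
have dE : cder (wk_E t) m (kap * z t * wk_E t m).
  apply: (cderEq (cderExp (cderZ (kap * z t) (cderR (dId m))))).
  by rewrite mulr1.
apply: (cderEq (cderZ _ (cderM (cderR dag) dE))).
have zn := zpath_neq0 t; have kn := kap_neq0.
rewrite /wk_f'.
have -> : (- (eps * m * besj (wk_a m * t ^+ 2) / 2))%:C =
   - (kap * kap * m%:C * (besj (wk_a m * t ^+ 2))%:C / 2) :> CC R.
  by rewrite kap2 realcN !realcM realcV realcn.
have -> : (2 * t)%:C = 2 * t%:C :> CC R by rewrite realcM realcn.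
rewrite [(2 * t * _)%:C]realcM [(2 * t)%:C]realcM realcn.
move: (besj _)%:C (wk_a m * _)%:C (wk_E t m) (t%:C : CC R) (m%:C : CC R) (z t) zn kn.
move=> J A E T M Z zn kn; field.
by rewrite zn kn.
Qed.

Lemma wk_f'_bound (s L m : R) : `|s| < L -> 0 <= m -> 0 <= wk_a m ->
  cabs (wk_f' s m) <= (L * wk_a m / 2 + m * L / cre (z L)) * cabs (wk_E s m).
Proof.
move=> sL m0 a0; have L0 : 0 <= L by rewrite (le_trans _ (ltW sL)).
have zL : (cabs (z s))^-1 <= (cre (z L))^-1.
  rewrite lef_pV2 ?posrE ?cre_zpath_gt0//; last first.
    by rewrite (lt_le_trans (cre_zpath_gt0 s))// (le_trans (ler_norm _))// cre_le_cabs.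
  by rewrite (le_trans (cre_zpath_mono (ltW sL)))// (le_trans (ler_norm _))// cre_le_cabs.
have X0 : 0 <= wk_a m * s ^+ 2 by rewrite mulr_ge0 ?sqr_ge0.
apply: (le_trans (cabsD _ _)); move: (wk_E s m) => E.
rewrite [leRHS]mulrDl lerD//.
  rewrite cabsM cabsR ler_wpM2r ?cabs_ge0// !normrM normr_nat (ger0_norm a0).
  have := besg_le X0; have := ltW sL; have := normr_ge0 s.
  have := normr_ge0 (besg (wk_a m * s ^+ 2)).
  move: `|s| `|besg (wk_a m * s ^+ 2)| (wk_a m) a0 => u v A A0 v0 u0 uL v4.
  apply: le_trans (_ : 2 * L * (A * 4^-1) <= _); last by rewrite le_eqVlt; apply/orP; left; apply/eqP; field.
  by apply: ler_pM; rewrite ?mulr_ge0// ?ler_wpM2l.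
rewrite !cabsM !cabsR kap1 mul1r cabsN cabsR cabsV (ger0_norm m0) mulrA.
rewrite ler_wpM2r ?cabs_ge0//.
apply: le_trans (_ : 1 * (L / cre (z L) * m) <= _); last by rewrite mul1r mulrC mulrA.
apply: ler_pM; rewrite ?mulr_ge0 ?invr_ge0 ?cabs_ge0// ?besj_le1//.
by rewrite ler_wpM2r// ler_pM// ?invr_ge0 ?cabs_ge0// ltW.
Qed.

End weyl_kernel.

Section weyl_identity.
Context {R : realType}.
Notation mu := (@lebesgue_measure R).

Lemma cintegrable_itv (f : R -> CC R) (a b : R) : cdiff f -> cintegrable mu `[a, b] f.
Proof.
by move=> /cdiff_continuous[c1 c2]; split; exact: continuous_integrable_itv.
Qed.

Lemma in_set0y (m : R) : (`[0, +oo[%classic : set R) m -> 0 <= m.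
Proof. by rewrite /= in_itv/= andbT. Qed.

Lemma in_set0b (b m : R) : (`[0, b]%classic : set R) m -> 0 <= m <= b.
Proof. by rewrite /= in_itv/=. Qed.

Section path.
Variables (w x0 y : R).
Hypotheses (w0 : 0 < w) (y0 : y != 0).
Local Notation z := (zpath x0 y).
Local Notation ft := (wk_f w x0 y).
Local Notation ft' := (wk_f' w x0 y).
Local Notation Ft := (wk_F w x0 y).

Lemma kapP : Ci * Ci = (-1)%:C :> CC R.
Proof. by rewrite CiCi realcN. Qed.

Lemma kapE : (-1) * (-1) = 1%:C :> CC R.
Proof. by rewrite mulrNN mulr1. Qed.

Lemma cabsN1 : cabs (-1 : CC R) = 1.
Proof. by rewrite cabsN cabsR normr1. Qed.

Lemma cabs_wk_E_evan t m : cabs (wk_E x0 y (-1) t m) = expR (- (cre (z t) * m)).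
Proof. by rewrite cabs_cexp !ccE; congr expR; ring. Qed.

Lemma cabs_wk_E_prop t m : cabs (wk_E x0 y Ci t m) = expR (- cim (z t) * m).
Proof. by rewrite cabs_cexp !ccE; congr expR; ring. Qed.

Lemma evan_kernel_integrable t : cintegrable mu `[0, +oo[ (ft 1 (-1) t).
Proof.
have [m1 m2] := cdiff_measurable `[0, +oo[%classic (cdiff_wk_f w x0 y 1 (-1) t).
apply: (cintegrable_le _ m1 m2 (integrable_expR (cre_zpath_gt0 x0 y0 t))) => // m _.
rewrite /wk_f [leLHS]cabsM cabsR cabs_wk_E_evan ler_piMl ?expR_ge0//.
by rewrite besj_le1// mulr_ge0 ?sqr_ge0// addr_ge0 ?sqr_ge0// mul1r sqr_ge0.
Qed.

Lemma evan_poly_le (l q m : R) : 0 <= q -> 0 <= m ->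
  l * (w ^+ 2 + m ^+ 2) / 2 + m * q <= l * w ^+ 2 / 2 + q + (l / 2 + q) * m ^+ 2.
Proof.
move=> q0 m0; rewrite -subr_ge0.
have -> : l * w ^+ 2 / 2 + q + (l / 2 + q) * m ^+ 2 -
  (l * (w ^+ 2 + m ^+ 2) / 2 + m * q) = q * ((m - 2^-1) ^+ 2 + 3 / 4) by field.
by rewrite mulr_ge0// addr_ge0 ?sqr_ge0// divr_ge0.
Qed.

(** On the window |s| < L with L = |t| + 1 all exponentials decay at least at the rate Re z(L), and
    the remaining factor of the t-derivative grows at most quadratically in m. *)
Lemma cder_evan (t : R) : cder (fun s => cintegral mu `[0, +oo[ (ft 1 (-1) s)) t
  (cintegral mu `[0, +oo[ (ft' 1 (-1) t)).
Proof.
pose L : R := `|t| + 1; have tL : `|t| < L by rewrite ltrDl.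
have L0 : 0 <= L by rewrite (le_trans _ (ltW tL)).
have p0 := cre_zpath_gt0 x0 y0 L.
pose p := cre (z L).
have q0 : 0 <= L / p by rewrite mulr_ge0// invr_ge0 ltW.
pose A : R := L * w ^+ 2 / 2 + L / p; pose B : R := L / 2 + L / p.
have A0 : 0 <= A by apply: addr_ge0 => //; apply: mulr_ge0 => //; rewrite mulr_ge0// sqr_ge0.
have B0 : 0 <= B by apply: addr_ge0 => //; rewrite mulr_ge0.
apply: (@cder_under_integral _ _ _ _ _ L
   (fun m => (A + B * m ^+ 2) * expR (- (p * m)))) => //.
- by move=> s _; exact: evan_kernel_integrable.
- by move=> s m _ _; exact: cder_wk_f.
- by move=> m; rewrite mulr_ge0 ?expR_ge0// addr_ge0// mulr_ge0// sqr_ge0.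
- exact: integrable_polyexp.
- move=> s m sL /in_set0y m0.
  have a0 : 0 <= wk_a w 1 m by rewrite addr_ge0 ?sqr_ge0// mul1r sqr_ge0.
  apply: (le_trans (@wk_f'_bound R w x0 y y0 1 (-1) cabsN1 s L m sL m0 a0)).
  apply: ler_pM; rewrite ?cabs_ge0//.
  + apply: addr_ge0; first by rewrite !mulr_ge0.
    by rewrite -mulrA mulr_ge0.
  + rewrite /A /B /wk_a mul1r -/p.
    by rewrite -[m * L / p]mulrA; exact: evan_poly_le.
  + by rewrite cabs_wk_E_evan ler_expR lerN2 ler_wpM2r// cre_zpath_mono// ltW.
Qed.

(** Here the exponential has modulus e^{-m Im z} with Im z of either sign; a constant majorant
    suffices because m <= w and |z| is bounded on the window. *)
Lemma cder_prop (t : R) : cder (fun s => cintegral mu `[0, w] (ft (-1) Ci s)) t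
  (cintegral mu `[0, w] (ft' (-1) Ci t)).
Proof.
pose L : R := `|t| + 1; have tL : `|t| < L by rewrite ltrDl.
have L0 : 0 <= L by rewrite (le_trans _ (ltW tL)).
have p0 := cre_zpath_gt0 x0 y0 L.
pose p := cre (z L).
have q0 : 0 <= L / p by rewrite mulr_ge0// invr_ge0 ltW.
have w1 : 0 <= w := ltW w0.
pose B : R := 1 + (`|x0| + L ^+ 2 + `|y|).
pose C : R := (L * w ^+ 2 / 2 + w * L / p) * expR (w * B).
have C0 : 0 <= C.
  rewrite mulr_ge0 ?expR_ge0//; apply: addr_ge0.
    by rewrite !mulr_ge0// ?sqr_ge0.
  by rewrite -mulrA mulr_ge0.
apply: (@cder_under_integral _ _ _ _ _ L (fun=> C)) => //.
- by move=> s _; apply: cintegrable_itv; exact: cdiff_wk_f.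
- by move=> s m _ _; exact: cder_wk_f.
- by apply: continuous_integrable_itv => x; exact: cvg_cst.
- move=> s m sL /in_set0b /andP[m0 mw].
  have mw2 : m ^+ 2 <= w ^+ 2 by apply: lerXn2r; rewrite ?nnegrE.
  have a0 : 0 <= wk_a w (-1) m by rewrite /wk_a mulN1r subr_ge0.
  apply: (le_trans (@wk_f'_bound R w x0 y y0 (-1) Ci (@cabsI R) s L m sL m0 a0)).
  apply: ler_pM; rewrite ?cabs_ge0//.
  + apply: addr_ge0; first by rewrite !mulr_ge0.
    by rewrite -mulrA mulr_ge0.
  + apply: lerD.
      by rewrite ler_wpM2r// ler_wpM2l// /wk_a mulN1r gerBl sqr_ge0.
    by rewrite -!mulrA ler_wpM2r.
  + rewrite cabs_wk_E_prop ler_expR (le_trans (ler_norm _))//.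
    rewrite normrM normrN mulrC (ger0_norm m0); apply: ler_pM => //.
    by rewrite (le_trans (cim_le_cabs _))// cabs_zpath_le// ltW.
Qed.

Lemma wk_F0 (eps : R) (kap : CC R) t : Ft eps kap t 0 =
  (2 * t)%:C / (kap * z t) * (w ^+ 2 * besg (w ^+ 2 * t ^+ 2))%:C.
Proof.
rewrite /wk_F /wk_a expr0n mulr0 addr0 /wk_E mulr0 cexp0 mulr1//.
Qed.

(** The end m = w contributes nothing because w^2 - m^2, a factor of the antiderivative, vanishes
    there. *)
Lemma prop_derivative (t : R) : cintegral mu `[0, w] (ft' (-1) Ci t) =
  - ((2 * t)%:C / (Ci * z t) * (w ^+ 2 * besg (w ^+ 2 * t ^+ 2))%:C).
Proof.
have [c1 c2] := cdiff_continuous (cdiff_wk_f' w x0 y (-1) Ci t).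
rewrite (cintegral_FTC (F := Ft (-1) Ci t) (ltW w0) c1 c2); last first.
  by move=> m; apply: cder_wk_F => //; [exact: kapP|exact: cabsI].
by rewrite wk_F0 /wk_F /wk_a mulN1r subrr !mul0r mulr0 sub0r.
Qed.

Lemma evan_derivative (t : R) : cintegral mu `[0, +oo[ (ft' 1 (-1) t) =
  - ((2 * t)%:C / ((-1) * z t) * (w ^+ 2 * besg (w ^+ 2 * t ^+ 2))%:C).
Proof.
have [c1 c2] := cdiff_continuous (cdiff_wk_f' w x0 y 1 (-1) t).
have p0 := cre_zpath_gt0 x0 y0 t.
pose p := cre (z t).
have L0 : 0 <= `|t| by [].
have q0 : 0 <= `|t| / p by rewrite mulr_ge0// invr_ge0 ltW.
have aE m : wk_a w 1 m = w ^+ 2 + m ^+ 2 by rewrite /wk_a mul1r.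
have a0 m : 0 <= wk_a w 1 m by rewrite aE addr_ge0 ?sqr_ge0.
have EE m : cabs (wk_E x0 y (-1) t m) = expR (- (p * m)).
  exact: cabs_wk_E_evan.
rewrite (cintegral_FTC_y (F := Ft 1 (-1) t) _ c1 c2).
- by rewrite wk_F0.
- have [m1 m2] := cdiff_measurable `[0, +oo[%classic (cdiff_wk_f' w x0 y 1 (-1) t).
  (* [wk_f'_bound] asks for |t| < L strictly; only its polynomial factor depends on L, and the
     exponential keeps the rate p at t itself. *)
  pose L : R := `|t| + 1; have tL : `|t| < L by rewrite ltrDl.
  have l0 : 0 <= L by rewrite (le_trans _ (ltW tL)).
  have r0 := cre_zpath_gt0 x0 y0 L.
  have s0 : 0 <= L / cre (z L) by rewrite mulr_ge0// invr_ge0 ltW.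
  have A0 : 0 <= L * w ^+ 2 / 2 + L / cre (z L).
    by apply: addr_ge0 => //; apply: mulr_ge0 => //; rewrite mulr_ge0// sqr_ge0.
  have B0 : 0 <= L / 2 + L / cre (z L) by apply: addr_ge0 => //; rewrite mulr_ge0.
  apply: (cintegrable_le _ m1 m2 (integrable_polyexp A0 B0 p0)) => // m /in_set0y m0.
  apply: (le_trans (@wk_f'_bound R w x0 y y0 1 (-1) cabsN1 t L m tL m0 (a0 m))).
  rewrite EE ler_wpM2r ?expR_ge0// aE.
  by rewrite -[m * L / _]mulrA; exact: evan_poly_le.
- by move=> m; apply: cder_wk_F => //; [exact: kapE|exact: cabsN1].
have A0 : 0 <= `|t| / p * w ^+ 2 by rewrite mulr_ge0// sqr_ge0.
have K0 : ((`|t| / p * w ^+ 2 + `|t| / p * (16 / p ^+ 2)) * expR (- (p / 2 * n%:R)))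
    @[n --> \oo] --> 0.
  rewrite -[X in _ --> X](mulr0 (`|t| / p * w ^+ 2 + `|t| / p * (16 / p ^+ 2))).
  apply: cvgM; first exact: cvg_cst.
  by apply: expR_nat_cvg0; rewrite divr_gt0.
apply: (squeeze_cvgr _ (cvg_cst 0) K0); apply: nearW => n.
rewrite cabs_ge0/=; apply: le_trans (polyexp_le A0 q0 p0 (ler0n _ n)).
rewrite /wk_F [leLHS]cabsM [X in _ * X <= _]cabsM EE cabsR mulrA ler_wpM2r ?expR_ge0//.
rewrite [X in X * _]cabsM cabsV [cabs (-1 * z t)]cabsM cabsN1 mul1r cabsR.
rewrite normrM normr_nat normrM (ger0_norm (a0 _)).
have X0 : 0 <= wk_a w 1 n%:R * t ^+ 2 by rewrite mulr_ge0 ?sqr_ge0.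
have zp : (cabs (z t))^-1 <= p^-1.
  rewrite lef_pV2 ?posrE//; last first.
    by rewrite (lt_le_trans p0)// (le_trans (ler_norm _))// cre_le_cabs.
  by rewrite (le_trans (ler_norm _))// cre_le_cabs.
rewrite -[leRHS]mulrDr -aE.
apply: le_trans (_ : (2 * `|t| / p) * (wk_a w 1 n%:R * 4^-1) <= _).
  apply: ler_pM; rewrite ?mulr_ge0 ?invr_ge0 ?cabs_ge0//.
    by rewrite ler_wpM2l// mulr_ge0.
  by rewrite ler_wpM2l// besg_le.
have -> : 2 * `|t| / p * (wk_a w 1 n%:R / 4) = `|t| / p * wk_a w 1 n%:R / 2.
  by field; rewrite gt_eqF.
by rewrite ler_pdivrMr// ler_peMr ?ler1n// mulr_ge0.
Qed.

Lemma weyl_path_const (t : R) :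
  Ci * cintegral mu `[0, w] (ft (-1) Ci t) + cintegral mu `[0, +oo[ (ft 1 (-1) t) =
  Ci * cintegral mu `[0, w] (ft (-1) Ci 0) + cintegral mu `[0, +oo[ (ft 1 (-1) 0).
Proof.
apply: (cder_cst (f := fun t => Ci * cintegral mu `[0, w] (ft (-1) Ci t) +
  cintegral mu `[0, +oo[ (ft 1 (-1) t))) => s.
apply: (cderEq (cderD (cderZ Ci (cder_prop s)) (cder_evan s))).
rewrite prop_derivative evan_derivative.
have zn := zpath_neq0 x0 y0 s; have In := @Ci_neq0 R.
by field; rewrite zn In.
Qed.

Lemma weyl_path0 :
  Ci * cintegral mu `[0, w] (ft (-1) Ci 0) + cintegral mu `[0, +oo[ (ft 1 (-1) 0) =
  cexp (Ci * w%:C * z 0) / z 0.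
Proof.
have zn := zpath_neq0 x0 y0 0; have In := @Ci_neq0 R.
have p0 := cre_zpath_gt0 x0 y0 0.
have fE eps kap m : ft eps kap 0 m = cexp (kap * z 0 * m%:C).
  by rewrite /wk_f expr0n mulr0 besj0 mul1r.
have dF (kap : CC R) m : kap != 0 ->
    cder (fun m : R => (kap * z 0)^-1 * cexp (kap * z 0 * m%:C)) m
    (cexp (kap * z 0 * m%:C)).
  move=> kn; apply: (cderEq (cderZ _ (cderExp (cderZ (kap * z 0) (cderR (dId m)))))).
  by rewrite mulr1 mulKf// mulf_neq0.
have [c1 c2] := cdiff_continuous (cdiff_wk_f w x0 y (-1) Ci 0).
rewrite (cintegral_FTC (F := fun m : R => (Ci * z 0)^-1 * cexp (Ci * z 0 * m%:C))
  (ltW w0) c1 c2); last by move=> m; rewrite fE; exact: dF.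
have [e1 e2] := cdiff_continuous (cdiff_wk_f w x0 y 1 (-1) 0).
rewrite (cintegral_FTC_y (F := fun m : R => ((-1) * z 0)^-1 * cexp ((-1) * z 0 * m%:C))
  (evan_kernel_integrable 0) e1 e2); last 2 first.
- by move=> m; rewrite fE; apply: dF; rewrite oppr_eq0 oner_eq0.
- rewrite -[X in _ --> X](mulr0 (cabs ((-1) * z 0)^-1)).
  under eq_fun do rewrite cabsM.
  apply: cvgM; first exact: cvg_cst.
  under eq_fun do rewrite cabs_cexp creM creM cimM creR cimR mulr0 subr0 creN cimN cre1 cim1 oppr0 mul0r subr0 mulN1r mulNr.
  exact: expR_nat_cvg0.
rewrite !mulr0 !cexp0 !mulr1 (_ : Ci * z 0 * w%:C = Ci * w%:C * z 0); last by ring.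
by field; rewrite zn In.
Qed.

End path.

(** The path ends at t = rho, where z = zeta by uniqueness of the root with positive real part, and
    starts at t = 0, where z is the complex distance. The conditions on zeta make Im zeta^2
    nonzero. *)
Lemma weyl_identity (w rho : R) (zeta : CC R) : 0 < w -> 0 < cre zeta -> cim zeta != 0 ->
  Ci * cintegral mu `[0, w] (fun m => (besj ((w ^+ 2 - m ^+ 2) * rho ^+ 2))%:C *
     cexp (Ci * zeta * m%:C)) +
  cintegral mu `[0, +oo[ (fun m => (besj ((w ^+ 2 + m ^+ 2) * rho ^+ 2))%:C *
     cexp (- zeta * m%:C)) =
  cexp (Ci * w%:C * csqrt ((rho ^+ 2)%:C + zeta ^+ 2)) /
    csqrt ((rho ^+ 2)%:C + zeta ^+ 2).
Proof.
move=> w0 p0 q0.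
pose x0 := rho ^+ 2 + cre (zeta ^+ 2); pose y := cim (zeta ^+ 2).
have y0 : y != 0.
  rewrite /y expr2 cimM mulrC -mulr2n mulrn_eq0/= mulf_eq0 negb_or q0/=.
  by rewrite gt_eqF.
have zrho : zpath x0 y rho = zeta.
  apply: csqrt_unique => //; apply: cP; rewrite ?creE ?cimE//.
  by rewrite /x0; ring.
have z0 : zpath x0 y 0 = csqrt ((rho ^+ 2)%:C + zeta ^+ 2).
  rewrite /zpath; congr csqrt; apply: cP; rewrite !ccE ?creE ?cimE.
    by rewrite /x0 expr0n subr0 expr2 creM.
  by rewrite add0r /y expr2 cimM.
rewrite -z0 -(@weyl_path0 w x0 y w0 y0) -(@weyl_path_const w x0 y w0 y0 rho).
have -> : wk_f w x0 y (-1) Ci rho =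
    (fun m => (besj ((w ^+ 2 - m ^+ 2) * rho ^+ 2))%:C * cexp (Ci * zeta * m%:C)).
  by apply/funext => m; rewrite /wk_f /wk_E /wk_a zrho mulN1r.
have -> // : wk_f w x0 y 1 (-1) rho =
    (fun m => (besj ((w ^+ 2 + m ^+ 2) * rho ^+ 2))%:C * cexp (- zeta * m%:C)).
by apply/funext => m; rewrite /wk_f /wk_E /wk_a zrho mulN1r mul1r.
Qed.

End weyl_identity.

(** * The plane-wave representation *)

Section complex_integration.
Context {R : realType}.
Notation mu := (@lebesgue_measure R).
Notation mR := (measurableTypeR R).

Section cmeasurable.
Context d (T : measurableType d).
Implicit Types f g : T -> CC R.

Definition cmeas (D : set T) f :=
  measurable_fun D (fun x => cre (f x)) /\ measurable_fun D (fun x => cim (f x)).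

Lemma cmeasC D (c : CC R) : cmeas D (fun=> c).
Proof. by split; exact: measurable_cst. Qed.

Lemma cmeasR D (f : T -> mR) : measurable_fun D f -> cmeas D (fun x => (f x)%:C).
Proof. by move=> mf; split => //; exact: measurable_cst. Qed.

Lemma cmeasD D f g : cmeas D f -> cmeas D g -> cmeas D (fun x => f x + g x).
Proof.
move=> [f1 f2] [g1 g2]; split.
  rewrite (_ : (fun x => _) = (fun x => cre (f x) + cre (g x))).
    exact: measurable_funD.
  by apply/funext => x; rewrite creD.
rewrite (_ : (fun x => _) = (fun x => cim (f x) + cim (g x))).
  exact: measurable_funD.
by apply/funext => x; rewrite cimD.
Qed.

Lemma cmeasM D f g : cmeas D f -> cmeas D g -> cmeas D (fun x => f x * g x).
Proof.
move=> [f1 f2] [g1 g2]; split.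
  rewrite (_ : (fun x => _) = (fun x => cre (f x) * cre (g x) - cim (f x) * cim (g x))).
    by apply: measurable_funB; exact: measurable_funM.
  by apply/funext => x; rewrite creM.
rewrite (_ : (fun x => _) = (fun x => cre (f x) * cim (g x) + cim (f x) * cre (g x))).
  by apply: measurable_funD; exact: measurable_funM.
by apply/funext => x; rewrite cimM.
Qed.

Lemma cmeasN D f : cmeas D f -> cmeas D (fun x => - f x).
Proof.
move=> mf; rewrite (_ : (fun x => _) = (fun x => (-1) * f x)).
  by apply: cmeasM => //; exact: cmeasC.
by apply/funext => x; rewrite mulN1r.
Qed.

Lemma cmeasV f : cmeas setT f -> cmeas setT (fun x => (f x)^-1).
Proof.
move=> [f1 f2].
have mq : measurable_fun [set: T] (fun x => (cre (f x) ^+ 2 + cim (f x) ^+ 2)^-1 : mR).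
  apply: (measurableT_comp (@measurable_invr R)).
  by apply: measurable_funD; exact: measurable_funX.
split.
  rewrite (_ : (fun x => _) = (fun x => cre (f x) / (cre (f x) ^+ 2 + cim (f x) ^+ 2))).
    exact: measurable_funM.
  by apply/funext => x; rewrite creV.
rewrite (_ : (fun x => _) = (fun x => - (cim (f x) / (cre (f x) ^+ 2 + cim (f x) ^+ 2)))).
  by apply: measurableT_comp => //; exact: measurable_funM.
by apply/funext => x; rewrite cimV.
Qed.

Lemma cmeasExp D f : cmeas D f -> cmeas D (fun x => cexp (f x)).
Proof.
move=> [f1 f2].
have me : measurable_fun [set: mR] (expR : mR -> mR).
  by apply: continuous_measurable_fun; exact: continuous_expR.
have mc : measurable_fun [set: mR] (cos : mR -> mR).
  by apply: continuous_measurable_fun; exact: continuous_cos.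
have ms : measurable_fun [set: mR] (sin : mR -> mR).
  by apply: continuous_measurable_fun; exact: continuous_sin.
split.
  rewrite (_ : (fun x => _) = (fun x => expR (cre (f x)) * cos (cim (f x)))).
    by apply: measurable_funM; [exact: (measurableT_comp me f1)|exact: (measurableT_comp mc f2)].
  by apply/funext => x; rewrite cre_cexp.
rewrite (_ : (fun x => _) = (fun x => expR (cre (f x)) * sin (cim (f x)))).
  by apply: measurable_funM; [exact: (measurableT_comp me f1)|exact: (measurableT_comp ms f2)].
by apply/funext => x; rewrite cim_cexp.
Qed.

Variable nu : {measure set T -> \bar R}.

Lemma ceq_integral (D : set T) f g : (forall x, D x -> f x = g x) ->
  cintegral nu D f = cintegral nu D g.
Proof.
move=> fg; rewrite /cintegral; congr (_ +i* _);
  by apply: eq_Rintegral => x /set_mem Dx; rewrite fg.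
Qed.

Lemma ceq_integrable (D : set T) f g : measurable D -> (forall x, D x -> f x = g x) ->
  cintegrable nu D f -> cintegrable nu D g.
Proof.
move=> mD fg [i1 i2].
by split; [apply: (eq_integrable mD _ _ _ i1)|apply: (eq_integrable mD _ _ _ i2)];
  move=> x /set_mem Dx; rewrite fg.
Qed.

Lemma cintegrableZl (D : set T) f k : measurable D -> cintegrable nu D f ->
  cintegrable nu D (fun x => k * f x).
Proof.
move=> mD [i1 i2].
have iZ (c : R) (h : T -> R) : nu.-integrable D (EFin \o h) ->
    nu.-integrable D (EFin \o (fun x => c * h x)).
  by move=> ih; exact: (integrableZl mD c ih).
split.
  apply: (eq_integrable mD _ _ _ (integrableB mD (iZ (cre k) _ i1) (iZ (cim k) _ i2))).
  by move=> x _; rewrite /= creM EFinB.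
apply: (eq_integrable mD _ _ _ (integrableD mD (iZ (cre k) _ i2) (iZ (cim k) _ i1))).
by move=> x _; rewrite /= cimM EFinD.
Qed.

Lemma cintegrableS (D E : set T) f : measurable D -> measurable E -> E `<=` D ->
  cintegrable nu D f -> cintegrable nu E f.
Proof. by move=> mD mE ED [i1 i2]; split; [exact: (integrableS mD)|exact: (integrableS mD)]. Qed.

End cmeasurable.

Lemma cdiff_cmeas (f : R -> CC R) (D : set mR) : cdiff f -> cmeas D f.
Proof. exact: cdiff_measurable. Qed.

(** The upper end is an interval bound, so that the same statement serves for [+oo] and for a finite
    cutoff. The point w, where the plane-wave kernel is singular, is a null set. *)
Lemma integrable_split (f : R -> R) (w : R) (b : itv_bound R) : 0 < w ->
  (BRight w <= b)%O -> measurable_fun [set: R] f ->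
  mu.-integrable `]0, w[ (EFin \o f) ->
  mu.-integrable [set` Interval (BRight w) b] (EFin \o f) ->
  mu.-integrable [set` Interval (BRight 0) b] (EFin \o f) /\
  Rintegral mu [set` Interval (BRight 0) b] f =
  Rintegral mu `]0, w[ f + Rintegral mu [set` Interval (BRight w) b] f.
Proof.
move=> w0 wb mf i1 i2.
have U : [set` Interval (BRight 0) b] =
    `]0, w[%classic `|` [set` Interval (BLeft w) b] :> set R.
  rewrite -itv_bndbnd_setU// ?bnd_simp//.
  by rewrite (le_trans _ wb)// bnd_simp.
have i3 : mu.-integrable [set` Interval (BLeft w) b] (EFin \o f).
  apply/integrableP; split; first by apply: measurable_funTS; exact/measurable_EFinP.
  have /integrableP[_] := i2; rewrite integral_itv_obnd_cbnd//.
  by apply: measurable_funTS; apply: measurableT_comp => //; exact/measurable_EFinP.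
have dj : [disjoint (`]0, w[%classic : set R) & [set` Interval (BLeft w) b]].
  apply/disj_setPS => x [/=]; rewrite !itv_boundlr/= !bnd_simp => /andP[_ xw] /andP[wx _].
  by move: (lt_le_trans xw wx); rewrite ltxx.
have i4 : mu.-integrable [set` Interval (BRight 0) b] (EFin \o f).
  apply/integrableP; split; first by apply: measurable_funTS; exact/measurable_EFinP.
  rewrite U ge0_integral_setU//.
  - move/integrableP: i1 => [_ i1]; move/integrableP: i3 => [_ i3].
    by rewrite lte_add_pinfty.
  - by apply: measurable_funTS; apply: measurableT_comp => //; exact/measurable_EFinP.
split => //; rewrite U Rintegral_setU//; last by rewrite -U.
by rewrite [X in _ = _ + X]Rintegral_itv_obnd_cbnd.
Qed.

Lemma cintegrable_split (f : R -> CC R) (w : R) (b : itv_bound R) : 0 < w ->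
  (BRight w <= b)%O -> cmeas [set: mR] f ->
  cintegrable mu `]0, w[ f ->
  cintegrable mu [set` Interval (BRight w) b] f ->
  cintegrable mu [set` Interval (BRight 0) b] f /\
  cintegral mu [set` Interval (BRight 0) b] f =
  cintegral mu `]0, w[ f + cintegral mu [set` Interval (BRight w) b] f.
Proof.
move=> w0 wb [m1 m2] [i1 i2] [j1 j2].
have [a1 b1] := integrable_split w0 wb m1 i1 j1.
have [a2 b2] := integrable_split w0 wb m2 i2 j2.
by split => //; rewrite /cintegral b1 b2; apply: cP; rewrite !ccE.
Qed.

Lemma cintegral_oo_cc (f : R -> CC R) (w : R) : cintegrable mu `[0, w] f ->
  cintegral mu `]0, w[ f = cintegral mu `[0, w] f.
Proof.
move=> [i1 i2].
have E (h : R -> R) : mu.-integrable `[0, w] (EFin \o h) ->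
    Rintegral mu `]0, w[ h = Rintegral mu `[0, w] h.
  move=> ih.
  have ioo : mu.-integrable `]0, w[ (EFin \o h).
    by apply: (integrableS _ _ _ ih) => //; exact: subset_itv_oo_cc.
  rewrite Rintegral_itv_bndo_bndc// Rintegral_itv_obnd_cbnd//.
  by apply: (integrableS _ _ _ ih) => //; exact: subset_itv_oc_cc.
by rewrite /cintegral !E.
Qed.

Lemma cintegral_oy_cy (f : R -> CC R) : cintegrable mu `[0, +oo[ f ->
  cintegral mu `]0, +oo[ f = cintegral mu `[0, +oo[ f.
Proof.
move=> [i1 i2].
have E (h : R -> R) : mu.-integrable `[0, +oo[ (EFin \o h) ->
    Rintegral mu `]0, +oo[ h = Rintegral mu `[0, +oo[ h.
  move=> ih; rewrite Rintegral_itv_obnd_cbnd//.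
  by apply: (integrableS _ _ _ ih) => //; apply: subset_itvr; rewrite bnd_simp.
by rewrite /cintegral !E.
Qed.

Lemma creRM (x : R) (z : CC R) : cre (x%:C * z) = x * cre z.
Proof. by rewrite creM creR cimR mul0r subr0. Qed.

Lemma cimRM (x : R) (z : CC R) : cim (x%:C * z) = x * cim z.
Proof. by rewrite cimM creR cimR mul0r addr0. Qed.

Lemma creMR (z : CC R) (x : R) : cre (z * x%:C) = cre z * x.
Proof. by rewrite creM creR cimR mulr0 subr0. Qed.

Lemma cimMR (z : CC R) (x : R) : cim (z * x%:C) = cim z * x.
Proof. by rewrite cimM creR cimR mulr0 add0r. Qed.

Lemma cintegral_evan (w : R) (G : R -> CC R) : 0 < w -> cmeas [set: mR] G ->
  cintegrable mu `]0, +oo[ G ->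
  cintegrable mu `]w, +oo[ (fun h => (h / Num.sqrt (h ^+ 2 - w ^+ 2))%:C *
    G (Num.sqrt (h ^+ 2 - w ^+ 2))) /\
  cintegral mu `]w, +oo[ (fun h => (h / Num.sqrt (h ^+ 2 - w ^+ 2))%:C *
    G (Num.sqrt (h ^+ 2 - w ^+ 2))) = cintegral mu `]0, +oo[ G.
Proof.
move=> w0 [m1 m2] [i1 i2].
have e1 := Rintegral_evan w0 m1; have e2 := Rintegral_evan w0 m2.
have j1 := evan_integrable w0 m1 i1; have j2 := evan_integrable w0 m2 i2.
split; first split.
- by apply: (eq_integrable _ _ _ _ j1) => // x _; rewrite /= creRM.
- by apply: (eq_integrable _ _ _ _ j2) => // x _; rewrite /= cimRM.
- rewrite /cintegral -e1 -e2; congr (_ +i* _); apply: eq_Rintegral => x _.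
    by rewrite creRM.
  by rewrite cimRM.
Qed.

Lemma cintegral_prop (w : R) (G : R -> CC R) : 0 < w -> cmeas [set: mR] G ->
  cintegrable mu `]0, w[ G ->
  cintegrable mu `]0, w[ (fun h => (h / Num.sqrt (w ^+ 2 - h ^+ 2))%:C *
    G (Num.sqrt (w ^+ 2 - h ^+ 2))) /\
  cintegral mu `]0, w[ (fun h => (h / Num.sqrt (w ^+ 2 - h ^+ 2))%:C *
    G (Num.sqrt (w ^+ 2 - h ^+ 2))) = cintegral mu `]0, w[ G.
Proof.
move=> w0 [m1 m2] [i1 i2].
have e1 := Rintegral_prop w0 m1; have e2 := Rintegral_prop w0 m2.
have j1 := prop_integrable w0 m1 i1; have j2 := prop_integrable w0 m2 i2.
split; first split.
- by apply: (eq_integrable _ _ _ _ j1) => // x _; rewrite /= creRM.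
- by apply: (eq_integrable _ _ _ _ j2) => // x _; rewrite /= cimRM.
- rewrite /cintegral -e1 -e2; congr (_ +i* _); apply: eq_Rintegral => x _.
    by rewrite creRM.
  by rewrite cimRM.
Qed.

Lemma chankel (F : R -> CC R) (rho : R * R) : cmeas [set: mR] F ->
  cintegrable mu `]0, +oo[ (fun r => r%:C * F r) ->
  cintegrable (@leb2 R) setT (fun h => F (norm2 h) * cexp (Ci * (dot2 h rho)%:C)) /\
  cintegral (@leb2 R) setT (fun h => F (norm2 h) * cexp (Ci * (dot2 h rho)%:C)) =
  (2 * pi)%:C * cintegral mu `]0, +oo[
    (fun r => r%:C * F r * (besselJ0 (r * norm2 rho))%:C).
Proof.
move=> [m1 m2] [i1 i2].
have j1 : mu.-integrable `]0, +oo[ (fun r => (r * cre (F r))%:E).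
  by apply: (eq_integrable _ _ _ _ i1) => // x _; rewrite creRM.
have j2 : mu.-integrable `]0, +oo[ (fun r => (r * cim (F r))%:E).
  by apply: (eq_integrable _ _ _ _ i2) => // x _; rewrite cimRM.
have [c1 C1] := hankel_cos rho m1 j1; have [c2 C2] := hankel_cos rho m2 j2.
have [s1 S1] := hankel_sin rho m1 j1; have [s2 S2] := hankel_sin rho m2 j2.
have E (x : R) : cre (cexp (Ci * x%:C) : CC R) = cos x /\ cim (cexp (Ci * x%:C) : CC R) = sin x.
  by rewrite cre_cexp cim_cexp creM cimM creR cimR creI cimI !(mul0r, mulr0, subr0, add0r, mul1r, expR0, oppr0, addr0).
have e1 h : cre (F (norm2 h) * cexp (Ci * (dot2 h rho)%:C)) =
    cre (F (norm2 h)) * cos (dot2 h rho) - cim (F (norm2 h)) * sin (dot2 h rho).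
  by rewrite creM !(E _).1 !(E _).2.
have e2 h : cim (F (norm2 h) * cexp (Ci * (dot2 h rho)%:C)) =
    cre (F (norm2 h)) * sin (dot2 h rho) + cim (F (norm2 h)) * cos (dot2 h rho).
  by rewrite cimM !(E _).1 !(E _).2.
split; first split.
- apply: (eq_integrable _ _ _ _ (integrableB measurableT c1 s2)) => // h _.
  by rewrite e1 EFinB.
- apply: (eq_integrable _ _ _ _ (integrableD measurableT s1 c2)) => // h _.
  by rewrite e2 EFinD.
apply: cP; rewrite ?creRM ?cimRM /cintegral ?creE ?cimE.
- rewrite (_ : Rintegral _ _ _ = Rintegral (@leb2 R) setT (fun h =>
     cre (F (norm2 h)) * cos (dot2 h rho) - cim (F (norm2 h)) * sin (dot2 h rho))); last first.
    by apply: eq_Rintegral => h _; rewrite e1.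
  rewrite RintegralB// C1 S2 subr0; congr (_ * _); apply: eq_Rintegral => r _.
  by rewrite creMR creRM.
- rewrite (_ : Rintegral _ _ _ = Rintegral (@leb2 R) setT (fun h =>
     cre (F (norm2 h)) * sin (dot2 h rho) + cim (F (norm2 h)) * cos (dot2 h rho))); last first.
    by apply: eq_Rintegral => h _; rewrite e2.
  rewrite RintegralD// C2 S1 add0r; congr (_ * _); apply: eq_Rintegral => r _.
  by rewrite cimMR cimRM.
Qed.

End complex_integration.

(** * From the integral over R^2 to the beam *)

Section plane_wave.
Context {R : realType}.
Notation mu := (@lebesgue_measure R).
Notation mR := (measurableTypeR R).

(** Square roots of negative reals are 0, so for r >= 0 this sum equals [muf] with no case
    distinction, which makes measurability immediate. It involves w only through w^2. *)
Definition nuf (w r : R) : CC R :=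
  (Num.sqrt (r ^+ 2 - w ^+ 2))%:C - Ci * (Num.sqrt (w ^+ 2 - r ^+ 2))%:C.

Lemma mufE (w r : R) : 0 <= r -> muf r w = nuf w r.
Proof.
move=> r0; rewrite /muf /nuf.
have [rw|rw] := leP r `|w|.
  have q : r ^+ 2 <= w ^+ 2 by rewrite -(real_normK (num_real w)) lerXn2r ?nnegrE.
  by rewrite [Num.sqrt (r ^+ 2 - _)]ler0_sqrtr ?subr_le0// sub0r mulNr.
have q : w ^+ 2 <= r ^+ 2 by rewrite -(real_normK (num_real w)) lerXn2r ?nnegrE// ltW.
by rewrite [Num.sqrt (w ^+ 2 - _)]ler0_sqrtr ?subr_le0// mulr0 subr0.
Qed.

Lemma norm2_ge0 (h : R * R) : 0 <= norm2 h.
Proof. exact: sqrtr_ge0. Qed.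

Lemma cmeas_nuf (w : R) : cmeas [set: mR] (nuf w).
Proof.
have ms (f : mR -> mR) : measurable_fun [set: mR] f ->
    measurable_fun [set: mR] (fun r => Num.sqrt (f r) : mR).
  by move=> mf; exact: (measurableT_comp (@measurable_sqrtr R) mf).
have mx : measurable_fun [set: mR] (fun r => r ^+ 2 : mR) by exact: measurable_funX.
apply: cmeasD.
  by apply: cmeasR; apply: ms; apply: measurable_funB => //; exact: measurable_cst.
apply: cmeasN; apply: cmeasM; first exact: cmeasC.
by apply: cmeasR; apply: ms; apply: measurable_funB => //; exact: measurable_cst.
Qed.

Lemma CiV : (Ci : CC R)^-1 = - Ci.
Proof. by apply: (mulfI Ci_neq0); rewrite mulfV ?Ci_neq0// mulrN CiCi opprK. Qed.

Lemma nuf_prop (w r : R) : 0 < w -> 0 < r -> r < w ->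
  nuf w r = - (Ci * (Num.sqrt (w ^+ 2 - r ^+ 2))%:C) /\ 0 < Num.sqrt (w ^+ 2 - r ^+ 2).
Proof.
move=> w0 r0 rw; have q : r ^+ 2 < w ^+ 2 by rewrite ltrXn2r// ?nnegrE ltW.
by rewrite /nuf ler0_sqrtr ?subr_le0 ?ltW// sub0r sqrtr_gt0 subr_gt0.
Qed.

Lemma nuf_evan (w r : R) : 0 < w -> w < r ->
  nuf w r = (Num.sqrt (r ^+ 2 - w ^+ 2))%:C /\ 0 < Num.sqrt (r ^+ 2 - w ^+ 2).
Proof.
move=> w0 rw; have q : w ^+ 2 < r ^+ 2 by rewrite ltrXn2r// ?nnegrE ltW// (lt_trans w0).
by rewrite /nuf [Num.sqrt (w ^+ 2 - _)]ler0_sqrtr ?subr_le0 ?ltW// mulr0 subr0 sqrtr_gt0 subr_gt0.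
Qed.

Definition uprofile (w : R) (zeta : CC R) (r : R) : CC R :=
  ((2 * pi) ^+ 2)%:C^-1 * (2 * nuf w r)^-1 * cexp (- nuf w r * zeta).

Lemma cmeas_uprofile w zeta : cmeas [set: mR] (uprofile w zeta).
Proof.
have mn := cmeas_nuf w.
apply: cmeasM.
  apply: cmeasM; first exact: cmeasC.
  by apply: cmeasV; apply: cmeasM => //; exact: cmeasC.
by apply: cmeasExp; apply: cmeasM; [exact: cmeasN|exact: cmeasC].
Qed.

Lemma Uplus_integrandE w rho zeta h : Uplus_integrand w rho zeta h =
  uprofile w zeta (norm2 h) * cexp (Ci * (dot2 h rho)%:C).
Proof.
by rewrite /Uplus_integrand /uprofile mufE ?norm2_ge0// cexpD -mulNr [X in _ * X = _]mulrC mulrA.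
Qed.

Definition uradial w zeta (s r : R) : CC R :=
  r%:C * uprofile w zeta r * (besselJ0 (r * s))%:C.

Lemma cmeas_uradial w zeta s : cmeas [set: mR] (uradial w zeta s).
Proof.
apply: cmeasM.
  by apply: cmeasM; [apply: cmeasR|exact: cmeas_uprofile].
apply: cmeasR; rewrite (_ : (fun r : mR => _) = (fun r => besj ((r * s) ^+ 2))); last first.
  by apply/funext => r; rewrite besselJ0E.
apply: continuous_measurable_fun; apply: rdiff_continuous.
apply: (rdiff_comp (f := @besj R)); first exact: rdiff_besj.
by apply: rdiffX; apply: rdiffM; [exact: rdiffId|exact: rdiffC].
Qed.

Section with_parameters.
Variables (w : R) (zeta : CC R).
Hypotheses (w0 : 0 < w) (z0 : 0 < cre zeta).
Local Notation c := (((2 * pi) ^+ 2)%:C^-1 : CC R).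
Local Notation two := (2 : CC R).

Let two_neq0 : two != 0.
Proof. by rewrite -realcn realc_eq0 pnatr_eq0. Qed.

(** The integrands in the variable m = sqrt |h^2 - w^2|. Its Jacobian cancels the factor 1/mu,
    singular at h = w, and leaves smooth kernels. *)
Definition prK (s m : R) : CC R :=
  (besj ((w ^+ 2 - m ^+ 2) * s ^+ 2))%:C * cexp (Ci * zeta * m%:C).
Definition evK (s m : R) : CC R :=
  (besj ((w ^+ 2 + m ^+ 2) * s ^+ 2))%:C * cexp (- zeta * m%:C).

Lemma cdiff_cexp_lin (k : CC R) : cdiff (fun m : R => cexp (k * m%:C)).
Proof. by apply: cdiffExp; exact: cdiff_lin. Qed.

Lemma cdiff_prK s : cdiff (prK s).
Proof.
apply: cdiffM; last exact: cdiff_cexp_lin.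
apply: cdiffR; apply: (rdiff_comp (f := @besj R)); first exact: rdiff_besj.
apply: rdiffM; last exact: rdiffC.
by move=> t; exists (0 - 2%:R * t ^+ 1 * 1); exact: (dB (dCst _ _) (dX 2 (dId t))).
Qed.

Lemma cdiff_evK s : cdiff (evK s).
Proof.
apply: cdiffM; last exact: cdiff_cexp_lin.
apply: cdiffR; apply: (rdiff_comp (f := @besj R)); first exact: rdiff_besj.
apply: rdiffM; last exact: rdiffC.
by apply: rdiffD; [exact: rdiffC|apply: rdiffX; exact: rdiffId].
Qed.

Lemma evK_integrable s : cintegrable mu `[0, +oo[ (evK s).
Proof.
have [m1 m2] := cdiff_measurable `[0, +oo[%classic (cdiff_evK s).
apply: (cintegrable_le _ m1 m2 (integrable_expR z0)) => // m /in_set0y m0.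
rewrite /evK [leLHS]cabsM cabsR cabs_cexp creM creN creR cimR mulr0 subr0 mulNr.
rewrite ler_piMl ?expR_ge0//.
by rewrite besj_le1// mulr_ge0 ?sqr_ge0// addr_ge0 ?sqr_ge0.
Qed.

Lemma evK_integrable_o s : cintegrable mu `]0, +oo[ (evK s).
Proof.
by apply: cintegrableS (evK_integrable s) => //; apply: subset_itvr; rewrite bnd_simp.
Qed.

Lemma prK_integrable s : cintegrable mu `[0, w] (prK s).
Proof. exact: cintegrable_itv (cdiff_prK s). Qed.

Lemma prK_integrable_o s : cintegrable mu `]0, w[ (prK s).
Proof. by apply: cintegrableS (prK_integrable s) => //; exact: subset_itv_oo_cc. Qed.

Lemma uradial_propE s r : (`]0, w[%classic : set R) r ->
  (r / Num.sqrt (w ^+ 2 - r ^+ 2))%:C *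
    (c * (Ci / 2) * prK s (Num.sqrt (w ^+ 2 - r ^+ 2))) = uradial w zeta s r.
Proof.
rewrite /= in_itv/= => /andP[r0 rw].
have [nE s0] := nuf_prop w0 r0 rw.
rewrite /uradial /uprofile nE /prK besselJ0E.
rewrite sqr_sqrtr; last by rewrite subr_ge0 lerXn2r ?nnegrE ?ltW.
rewrite (_ : w ^+ 2 - (w ^+ 2 - r ^+ 2) = r ^+ 2); last by ring.
rewrite -exprMn; move: (Num.sqrt _) s0 => q q0.
have qn : (q%:C : CC R) != 0 by rewrite realc_eq0 gt_eqF.
rewrite opprK (_ : Ci * q%:C * zeta = Ci * zeta * q%:C); last by ring.
move: (cexp _) (besj _)%:C (c) => E B k.
rewrite realcM realcV mulrN invrN !invfM CiV.
by field; rewrite qn.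
Qed.

Lemma uradial_evanE s r : (`]w, +oo[%classic : set R) r ->
  (r / Num.sqrt (r ^+ 2 - w ^+ 2))%:C *
    (c * (1 / 2) * evK s (Num.sqrt (r ^+ 2 - w ^+ 2))) = uradial w zeta s r.
Proof.
rewrite /= in_itv/= andbT => rw.
have [nE s0] := nuf_evan w0 rw.
rewrite /uradial /uprofile nE /evK besselJ0E.
rewrite sqr_sqrtr; last by rewrite subr_ge0 lerXn2r ?nnegrE ?ltW// (lt_trans w0).
rewrite (_ : w ^+ 2 + (r ^+ 2 - w ^+ 2) = r ^+ 2); last by ring.
rewrite -exprMn; move: (Num.sqrt _) s0 => q q0.
have qn : (q%:C : CC R) != 0 by rewrite realc_eq0 gt_eqF.
rewrite (_ : - q%:C * zeta = - zeta * q%:C); last by ring.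
move: (cexp _) (besj _)%:C (c) => E B k.
rewrite realcM realcV.
by field; rewrite qn.
Qed.

Lemma uradial_prop s : cintegrable mu `]0, w[ (uradial w zeta s) /\
  cintegral mu `]0, w[ (uradial w zeta s) = c * (Ci / 2) * cintegral mu `[0, w] (prK s).
Proof.
have mK : cmeas [set: mR] (fun m => c * (Ci / 2) * prK s m).
  by apply: cmeasM; [exact: cmeasC|exact: (@cdiff_cmeas R _ setT (cdiff_prK s))].
have iK : cintegrable mu `]0, w[ (fun m => c * (Ci / 2) * prK s m).
  by apply: cintegrableZl => //; exact: prK_integrable_o.
have [j e] := cintegral_prop w0 mK iK.
split; first by apply: ceq_integrable j => //; exact: uradial_propE.
apply: etrans (etrans _ e) _; first by apply: ceq_integral => r rI; rewrite uradial_propE.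
rewrite cintegralZl//; last exact: prK_integrable_o.
by rewrite cintegral_oo_cc//; exact: prK_integrable.
Qed.

Lemma uradial_evan s : cintegrable mu `]w, +oo[ (uradial w zeta s) /\
  cintegral mu `]w, +oo[ (uradial w zeta s) = c * (1 / 2) * cintegral mu `[0, +oo[ (evK s).
Proof.
have mK : cmeas [set: mR] (fun m => c * (1 / 2) * evK s m).
  by apply: cmeasM; [exact: cmeasC|exact: (@cdiff_cmeas R _ setT (cdiff_evK s))].
have iK : cintegrable mu `]0, +oo[ (fun m => c * (1 / 2) * evK s m).
  by apply: cintegrableZl => //; exact: evK_integrable_o.
have [j e] := cintegral_evan w0 mK iK.
split; first by apply: ceq_integrable j => //; exact: uradial_evanE.
apply: etrans (etrans _ e) _; first by apply: ceq_integral => r rI; rewrite uradial_evanE.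
rewrite cintegralZl//; last exact: evK_integrable_o.
by rewrite cintegral_oy_cy//; exact: evK_integrable.
Qed.

Lemma uradial_split s : cintegrable mu `]0, +oo[ (uradial w zeta s) /\
  cintegral mu `]0, +oo[ (uradial w zeta s) =
  cintegral mu `]0, w[ (uradial w zeta s) + cintegral mu `]w, +oo[ (uradial w zeta s).
Proof.
apply: cintegrable_split => //; first exact: cmeas_uradial.
  by have [] := uradial_prop s.
by have [] := uradial_evan s.
Qed.

Lemma Uplus_radial rho : cintegrable (@leb2 R) setT (Uplus_integrand w rho zeta) /\
  Uplus w rho zeta = (2 * pi)%:C * cintegral mu `]0, +oo[ (uradial w zeta (norm2 rho)).
Proof.
(* At s = 0 the Bessel factor is 1, so the radial case already contains the integrability that
   [chankel] requires. *)
have iF : cintegrable mu `]0, +oo[ (fun r => r%:C * uprofile w zeta r).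
  apply: ceq_integrable (uradial_split 0).1 => // r _.
  by rewrite /uradial mulr0 besselJ0E expr0n besj0 mulr1.
have [j e] := chankel rho (cmeas_uprofile w zeta) iF.
split; first by apply: ceq_integrable j => // h _; rewrite Uplus_integrandE.
rewrite -[RHS]e; apply: ceq_integral => h _; exact: Uplus_integrandE.
Qed.

Let pi_neq0 : (pi%:C : CC R) != 0.
Proof. by rewrite realc_eq0 gt_eqF// pi_gt0. Qed.

Lemma Uprop_integrandE rho r : (`]0, w[%classic : set R) r ->
  (2 * pi)%:C * uradial w zeta (norm2 rho) r = Uprop_integrand w rho zeta r.
Proof.
move=> rI; rewrite -uradial_propE//; move: rI; rewrite /= in_itv/= => /andP[r0 rw].
have [_ s0] := nuf_prop w0 r0 rw.
rewrite /Uprop_integrand /prK besselJ0E.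
rewrite sqr_sqrtr; last by rewrite subr_ge0 lerXn2r ?nnegrE ?ltW.
rewrite (_ : w ^+ 2 - (w ^+ 2 - r ^+ 2) = r ^+ 2); last by ring.
rewrite -exprMn; move: (Num.sqrt _) s0 => q q0.
have qn : (q%:C : CC R) != 0 by rewrite realc_eq0 gt_eqF.
move: (cexp _) (besj _) => E B.
rewrite !(realcM, realcV, realcX, realcn).
move: (@pi R) pi_neq0 => P P0.
by field; rewrite qn P0.
Qed.

Lemma Uevan_integrandE rho r : (`]w, +oo[%classic : set R) r ->
  (2 * pi)%:C * uradial w zeta (norm2 rho) r = Uevan_integrand w rho zeta r.
Proof.
move=> rI; rewrite -uradial_evanE//; move: rI; rewrite /= in_itv/= andbT => rw.
have [_ s0] := nuf_evan w0 rw.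
rewrite /Uevan_integrand /evK besselJ0E.
rewrite sqr_sqrtr; last by rewrite subr_ge0 lerXn2r ?nnegrE ?ltW// (lt_trans w0).
rewrite (_ : w ^+ 2 + (r ^+ 2 - w ^+ 2) = r ^+ 2); last by ring.
rewrite -exprMn; move: (Num.sqrt _) s0 => q q0.
have qn : (q%:C : CC R) != 0 by rewrite realc_eq0 gt_eqF.
move: (cexp _) (besj _) => E B.
rewrite !(realcM, realcV, realcX, realcn).
move: (@pi R) pi_neq0 => P P0.
by field; rewrite qn P0.
Qed.

Lemma Uplus_split rho :
  cintegrable (@leb2 R) setT (Uplus_integrand w rho zeta) /\
  cintegrable mu `]0, w[ (Uprop_integrand w rho zeta) /\
  cintegrable mu `]w, +oo[ (Uevan_integrand w rho zeta) /\
  Uplus w rho zeta = Uprop w rho zeta + Uevan w rho zeta.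
Proof.
have [i e] := Uplus_radial rho; have [p1 p2] := uradial_prop (norm2 rho).
have [e1 e2] := uradial_evan (norm2 rho).
split => //; split.
  have j : cintegrable mu `]0, w[ (fun r => (2 * pi)%:C * uradial w zeta (norm2 rho) r).
    exact: cintegrableZl.
  by apply: ceq_integrable j => //; exact: Uprop_integrandE.
split.
  have j : cintegrable mu `]w, +oo[ (fun r => (2 * pi)%:C * uradial w zeta (norm2 rho) r).
    exact: cintegrableZl.
  by apply: ceq_integrable j => //; exact: Uevan_integrandE.
rewrite e (uradial_split _).2 mulrDr -!cintegralZl//; congr (_ + _); apply: ceq_integral.
  exact: Uprop_integrandE.
exact: Uevan_integrandE.
Qed.

(** Stated for either sign of Im zeta, because -z and z* have imaginary part +a. The constants
    combine as 2 pi / (2 (2 pi)^2) = 1 / (4 pi). *)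
Lemma Uplus_beam rho : cim zeta != 0 -> Uplus w rho zeta = beamB w rho zeta.
Proof.
move=> y0; rewrite (Uplus_radial rho).2 (uradial_split _).2 (uradial_prop _).2 (uradial_evan _).2.
have W := weyl_identity (norm2 rho) w0 z0 y0.
rewrite /beamB /rtilde invfM [RHS]mulrCA -W -/(prK _) -/(evK _).
move: (cintegral _ _ _) (cintegral _ _ _) => I J.
rewrite !(realcM, realcV, realcX, realcn).
move: (@pi R) pi_neq0 => P P0.
by field.
Qed.

End with_parameters.

Lemma norm2_opp2 (rho : R * R) : norm2 (opp2 rho) = norm2 rho.
Proof. by rewrite /norm2 /opp2/= !sqrrN. Qed.

Lemma rtilde_opp (rho : R * R) zeta : rtilde (opp2 rho) (- zeta) = rtilde rho zeta.
Proof. by rewrite /rtilde norm2_opp2 sqrrN. Qed.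

Lemma beamB_opp w (rho : R * R) zeta : beamB w (opp2 rho) (- zeta) = beamB w rho zeta.
Proof. by rewrite /beamB rtilde_opp. Qed.

Lemma cconjD (z u : CC R) : cconj (z + u) = cconj z + cconj u.
Proof. by apply: cP; rewrite ?(creJ, cimJ, creD, cimD)// opprD. Qed.

Lemma cconjM (z u : CC R) : cconj (z * u) = cconj z * cconj u.
Proof. by apply: cP; rewrite ?(creJ, cimJ, creM, cimM, creJ, cimJ); ring. Qed.

Lemma cconjV (z : CC R) : cconj (z^-1) = (cconj z)^-1.
Proof. by apply: cP; rewrite ?(creJ, cimJ, creV, cimV, creJ, cimJ) sqrrN ?mulNr. Qed.

Lemma cconjR (x : R) : cconj (x%:C : CC R) = x%:C.
Proof. by apply: cP; rewrite ?(creJ, cimJ, creR, cimR) ?oppr0. Qed.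

Lemma cconjI : cconj (Ci : CC R) = - Ci.
Proof. by apply: cP; rewrite ?(creJ, cimJ, creN, cimN, creI, cimI) ?oppr0. Qed.

Lemma csqrt_conj (z : CC R) : cim z != 0 -> csqrt (cconj z) = cconj (csqrt z).
Proof.
move=> y0; apply: csqrt_unique; first by rewrite creJ cre_csqrt_gt0.
by rewrite expr2 -cconjM -expr2 csqrtK.
Qed.

(** Under these conditions the radicand is not real, and there the principal root commutes with
    conjugation; conjugating i w then reverses the sign of w. *)
Lemma beamB_conj w (rho : R * R) (zeta : CC R) : cre zeta != 0 -> cim zeta != 0 ->
  beamB w rho zeta = cconj (beamB (- w) rho (cconj zeta)).
Proof.
move=> p0 q0; rewrite /beamB /rtilde.
have -> : (norm2 rho ^+ 2)%:C + cconj zeta ^+ 2 = cconj ((norm2 rho ^+ 2)%:C + zeta ^+ 2).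
  by rewrite cconjD cconjR [zeta ^+ 2]expr2 cconjM expr2.
rewrite csqrt_conj; last first.
  rewrite cimD cimR add0r expr2 cimM [cim _ * _]mulrC -mulr2n mulrn_eq0/=.
  by rewrite mulf_neq0.
set s := csqrt _.
have cK (u : CC R) : cconj (cconj u) = u by apply: cP; rewrite ?(creJ, cimJ) ?opprK.
rewrite [RHS]cconjM cconjV (cconjM (4 * pi)%:C) (cK s) cconjR -cexp_conj (cconjM (Ci * _)) (cK s).
rewrite cconjM cconjI cconjR realcN.
by rewrite mulrNN.
Qed.

End plane_wave.

(** * Analytic continuation and the jump *)

Section complex_topology.
Context {R : realType}.

(** Feeding each estimate into the next one gives the remainders of sin, cos and exp to increasing
    order. *)
Lemma mvt_bound (f df : R -> R) (t K : R) : (forall x : R, is_derive x 1 f (df x)) ->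
  (forall c, `|c| <= `|t| -> `|df c| <= K) -> `|f t - f 0| <= K * `|t|.
Proof.
move=> dfx dK.
have cf := is_derive_continuous dfx.
have [t0|t0] := leP 0 t.
  have [//|c cI ->] := @MVT_segment R f df 0 t t0 (fun x _ => dfx x).
    exact: continuous_subspaceT.
  rewrite subr0 normrM ler_wpM2r// dK//.
  by move: cI; rewrite in_itv/= => /andP[c0 ct]; rewrite !ger0_norm.
have [//|c cI E] := @MVT_segment R f df t 0 (ltW t0) (fun x _ => dfx x).
  exact: continuous_subspaceT.
rewrite distrC E sub0r normrM normrN ler_wpM2r// dK//.
move: cI; rewrite in_itv/= => /andP[tc c0].
by rewrite (ler0_norm c0) (ler0_norm (ltW t0)) lerN2.
Qed.

Lemma sin_lip (y : R) : `|sin y| <= `|y|.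
Proof.
rewrite -[X in X <= _]/(`|sin y|) -[sin y]subr0 -sin0 -[leRHS]mul1r.
apply: (mvt_bound (df := cos)) => c _.
by rewrite ler_norml cos_geN1 cos_le1.
Qed.

Lemma cos_quad (y : R) : `|cos y - 1| <= y ^+ 2.
Proof.
rewrite -[X in cos y - X]cos0 -(real_normK (num_real y)) expr2.
apply: (mvt_bound (df := fun x => - sin x)) => c cy.
by rewrite normrN (le_trans (sin_lip c)).
Qed.

Lemma sin_cubic (y : R) : `|sin y - y| <= y ^+ 2 * `|y|.
Proof.
have -> : sin y - y = (sin y - y) - (sin 0 - 0) by rewrite sin0 subrr subr0.
apply: (mvt_bound (f := fun y => sin y - y) (df := fun x => cos x - 1)) => c cy.
rewrite (le_trans (cos_quad c))// -(real_normK (num_real c)) -(real_normK (num_real y)).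
by rewrite lerXn2r ?nnegrE.
Qed.

Lemma expR_lip1 (x : R) : `|x| <= 1 -> `|expR x - 1| <= expR 1 * `|x|.
Proof.
move=> x1; rewrite -[X in expR x - X]expR0.
apply: (mvt_bound (df := expR)) => c cx.
by rewrite ger0_norm ?expR_ge0// ler_expR (le_trans (ler_norm c))// (le_trans cx).
Qed.

Lemma expR_quad1 (x : R) : `|x| <= 1 -> `|expR x - 1 - x| <= expR 1 * x ^+ 2.
Proof.
move=> x1.
have -> : expR x - 1 - x = (expR x - 1 - x) - (expR 0 - 1 - 0).
  by rewrite expR0 subrr subrr subr0.
rewrite -(real_normK (num_real x)) expr2 mulrA.
apply: (mvt_bound (f := fun x => expR x - 1 - x) (df := fun x => expR x - 1)).
  by move=> y; apply: (dEq (dB (dB (is_derive_expR y) (dCst 1 y)) (dId y))); rewrite subr0.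
move=> c cx; rewrite (le_trans (expR_lip1 (le_trans cx x1)))//.
by rewrite ler_wpM2l// expR_ge0.
Qed.

Lemma cexp_quad (h : CC R) : cabs h <= 1 ->
  cabs (cexp h - 1 - h) <= (4 * expR 1) * cabs h ^+ 2.
Proof.
move=> h1; rewrite (le_trans (cabs_le _))// cabs_sqr.
have x1 := le_trans (cre_le_cabs h) h1; have y1 := le_trans (cim_le_cabs h) h1.
rewrite !creD !creN !cimD !cimN cre_cexp cim_cexp cre1 cim1 subr0.
move: (cre h) (cim h) x1 y1 => x y x1 y1.
have k1 : 1 <= expR 1 :> R by rewrite -[leLHS]expR0 ler_expR.
set k := expR 1 in k1 *.
have ex : expR x <= k by rewrite ler_expR (le_trans (ler_norm x)).
have H1 : `|expR x * cos y - 1 - x| <= k * y ^+ 2 + k * x ^+ 2.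
  have -> : expR x * cos y - 1 - x = expR x * (cos y - 1) + (expR x - 1 - x) by ring.
  rewrite (le_trans (ler_normD _ _))// lerD ?expR_quad1//.
  by rewrite normrM ger0_norm ?expR_ge0// ler_pM ?expR_ge0// cos_quad.
have H2 : `|expR x * sin y - y| <= k * (`|x| * `|y|) + y ^+ 2.
  have -> : expR x * sin y - y = (expR x - 1) * sin y + (sin y - y) by ring.
  rewrite (le_trans (ler_normD _ _))// lerD//.
    by rewrite normrM mulrA ler_pM// ?expR_lip1// sin_lip.
  by rewrite (le_trans (sin_cubic y))// ler_piMr ?sqr_ge0.
apply: (le_trans (lerD H1 H2)).
have xy : `|x| * `|y| <= x ^+ 2 + y ^+ 2.
  rewrite -(real_normK (num_real x)) -(real_normK (num_real y)).
  by move: (`|x|) (`|y|) => u v; nra.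
have kxy : k * (`|x| * `|y|) <= k * (x ^+ 2 + y ^+ 2) by rewrite ler_wpM2l// (le_trans _ k1).
have y2 : y ^+ 2 <= k * y ^+ 2 by rewrite ler_peMl ?sqr_ge0.
have x2 : 0 <= k * x ^+ 2 by rewrite mulr_ge0 ?sqr_ge0// (le_trans _ k1).
have x3 : 0 <= k * y ^+ 2 by rewrite mulr_ge0 ?sqr_ge0// (le_trans _ k1).
by lra.
Qed.

(** For the order on [R[i]] a positive number is real, so the radii of complex neighbourhoods reduce
    to real ones. *)
Lemma cgt0 (e : R[i]) : 0 < e -> e = (cre e)%:C /\ 0 < cre e.
Proof.
rewrite ltcE/= => /andP[/eqP i0 r0]; split => //.
by apply: cP; rewrite ?creR ?cimR.
Qed.

Lemma ccvg_near T (F : set_system T) {FF : Filter F} (f : T -> CC R) (l : CC R) :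
  (forall e : R, 0 < e -> \forall t \near F, cabs (f t - l) < e) -> f @ F --> l.
Proof.
move=> H; apply/cvgrPdist_lt => e /cgt0[-> e0].
move: (H _ e0); apply: filterS => t ft.
by rewrite distrC -cabsE ltcR.
Qed.

Lemma ccvg T (F : set_system T) {FF : Filter F} (f : T -> CC R) (l : CC R) :
  (fun t => cre (f t)) @ F --> cre l -> (fun t => cim (f t)) @ F --> cim l -> f @ F --> l.
Proof.
move=> f1 f2; apply: ccvg_near => e e0.
have e2 : 0 < e / 2 by rewrite divr_gt0.
move/cvgrPdist_lt : f1 => /(_ _ e2) f1; move/cvgrPdist_lt : f2 => /(_ _ e2) f2.
near=> t; rewrite (le_lt_trans (cabs_le _))// creD creN cimD cimN (splitr e) ltrD//.
  by rewrite distrC; near: t.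
by rewrite distrC; near: t.
Unshelve. all: by end_near. Qed.

Lemma cabs_near0 (e : R) : 0 < e -> \forall h \near (0 : CC R), cabs h < e.
Proof.
move=> e0; have : (h : CC R) @[h --> (0 : CC R)] --> (0 : CC R) by exact: cvg_id.
move=> /cvgr0_norm_lt/(_ e%:C); rewrite ltcR => /(_ e0).
by apply: filterS => h; rewrite -cabsE ltcR.
Qed.

Lemma derivable_cdiffq (f : CC R -> CC R) (z l : CC R) :
  (h^-1 * (f (h + z) - f z) : CC R) @[h --> (0 : CC R)^'] --> l -> derivable f z 1.
Proof.
move=> H; apply/cvg_ex; exists l; apply: cvg_trans H.
by apply: near_eq_cvg; apply: nearW => h /=; rewrite [h *: 1]mulr1.
Qed.

Lemma derivable_cexp (z : CC R) : derivable (@cexp R) z 1.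
Proof.
apply: (@derivable_cdiffq _ _ (cexp z)); apply: ccvg_near => e e0.
pose k := 4 * expR 1 * (expR (cre z)) : R.
have k0 : 0 < k by rewrite !mulr_gt0// expR_gt0.
have d0 : 0 < Num.min 1 (e / k) by rewrite lt_min ltr01 divr_gt0.
have N : \forall h \near (0 : CC R)^', cabs h < Num.min 1 (e / k).
  by apply: nbhs_dnbhs; exact: cabs_near0.
near=> h.
have h0 : h != 0 by near: h; exact: nbhs_dnbhs_neq.
have : cabs h < Num.min 1 (e / k) by near: h; exact: N.
rewrite lt_min => /andP[h1 he].
have hp : 0 < cabs h.
  rewrite lt_neqAle cabs_ge0 andbT eq_sym; apply/eqP => c0.
  move/eqP : h0; apply; apply: cP; rewrite ?cre0 ?cim0; apply/eqP.
    by rewrite -normr_le0 -c0 cre_le_cabs.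
  by rewrite -normr_le0 -c0 cim_le_cabs.
have -> : h^-1 * (cexp (h + z) - cexp z) - cexp z = h^-1 * cexp z * (cexp h - 1 - h).
  by rewrite cexpD; move: (cexp h) (cexp z) => a b; field.
rewrite [ltLHS]cabsM [X in X * _]cabsM cabsV cabs_cexp.
apply: (le_lt_trans (_ : _ <= (cabs h)^-1 * expR (cre z) * (4 * expR 1 * cabs h ^+ 2))).
  by rewrite ler_wpM2l ?mulr_ge0 ?invr_ge0 ?expR_ge0 ?cabs_ge0// cexp_quad// ltW.
have -> : (cabs h)^-1 * expR (cre z) * (4 * expR 1 * cabs h ^+ 2) = cabs h * k.
  by rewrite /k; move: (expR 1) (expR _) => a b; field; rewrite gt_eqF.
by rewrite -ltr_pdivlMr.
Unshelve. all: by end_near. Qed.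

Lemma cre_csqrt_gt0' (z : CC R) : 0 < cre z -> 0 < cre (csqrt z).
Proof. by move=> z0; rewrite cre_csqrt sqrtr_gt0 divr_gt0// ltr_wpDl// cabs_ge0. Qed.

(** Difference of squares. The denominator is bounded below for every u because no principal root
    has negative real part, so continuity and differentiability at z both follow. *)
Lemma csqrt_sub (u z : CC R) : 0 < cre (csqrt z) ->
  csqrt u - csqrt z = (u - z) / (csqrt u + csqrt z) /\
  cre (csqrt z) <= cabs (csqrt u + csqrt z).
Proof.
move=> p0.
have P : cre (csqrt z) <= cre (csqrt u + csqrt z) by rewrite creD lerDr cre_csqrt_ge0.
have s0 : csqrt u + csqrt z != 0 by apply: cre_neq0; rewrite gt_eqF// (lt_le_trans p0).
split.
  apply: (mulIf s0); rewrite divfK//.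
  by rewrite -subr_sqr !csqrtK.
by rewrite (le_trans P)// (le_trans (ler_norm _))// cre_le_cabs.
Qed.

Lemma continuous_csqrt (z : CC R) : 0 < cre (csqrt z) -> csqrt x @[x --> z] --> csqrt z.
Proof.
move=> p0; apply: (@ccvg_near (CC R) (nbhs (z : CC R)) (nbhs_filter z)) => e e0.
have : (h : CC R) @[h --> z] --> z by exact: cvg_id.
move=> /cvgrPdist_lt/(_ (e * cre (csqrt z))%:C).
rewrite ltcR => /(_ (mulr_gt0 e0 p0)); apply: filterS => u.
rewrite distrC -cabsE ltcR => uz.
have [-> H] := csqrt_sub u p0.
rewrite [ltLHS]cabsM cabsV.
have q0 : 0 < cabs (csqrt u + csqrt z) by rewrite (lt_le_trans p0).
by rewrite ltr_pdivrMr// (lt_le_trans uz)// ler_wpM2l// ltW.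
Qed.

Lemma derivable_csqrt (z : CC R) : 0 < cre (csqrt z) -> derivable (@csqrt R) z 1.
Proof.
move=> p0; apply: (@derivable_cdiffq _ _ (csqrt z + csqrt z)^-1).
have s0 : csqrt z + csqrt z != 0 by apply: cre_neq0; rewrite gt_eqF// creD addr_gt0.
have : ((csqrt (h + z) + csqrt z)^-1 : CC R) @[h --> (0 : CC R)^'] --> (csqrt z + csqrt z)^-1.
  apply: (@cvgV _ _ _ _ (fun h : CC R => csqrt (h + z) + csqrt z)) => //.
  apply: cvgD; last exact: cvg_cst.
  apply: (@cvg_comp _ _ _ (fun h : CC R => h + z) (@csqrt R) _ (nbhs z)).
    apply: cvg_within_filter.
    apply: (@ccvg_near (CC R) (nbhs (0 : CC R)) (nbhs_filter 0)) => e /cabs_near0.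
    by apply: filterS => h he; rewrite addrK.
  exact: continuous_csqrt.
apply: cvg_trans; apply: near_eq_cvg; near=> h.
have h0 : h != 0 by near: h; exact: nbhs_dnbhs_neq.
have [-> H] := csqrt_sub (h + z) p0.
by rewrite addrK mulKf.
Unshelve. all: by end_near. Qed.

End complex_topology.

(** * Holomorphy of the beam off the branch disc *)

Section beam_regularity.
Context {R : realType}.

Lemma differentiable_csqr (z : CC R) : differentiable (fun x : CC R => x ^+ 2 : CC R) z.
Proof. exact: (@differentiableX _ (CC R) id 1). Qed.

Lemma differentiable_beamB (w : R) (rho : R * R) (z : CC R) :
  0 < cre (rtilde rho z) -> differentiable (beamB w rho) z.
Proof.
move=> p0.
have dr : differentiable (rtilde rho) z.
  apply: (@differentiable_comp _ (CC R) (CC R) (CC R)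
    (fun x : CC R => (norm2 rho ^+ 2)%:C + x ^+ 2 : CC R) (@csqrt R)).
    apply: (@differentiableD _ (CC R) (CC R) (cst ((norm2 rho ^+ 2)%:C : CC R)) (fun x : CC R => x ^+ 2 : CC R)).
      exact: differentiable_cst.
    exact: differentiable_csqr.
  by apply/derivable1_diffP; exact: derivable_csqrt.
apply: (@differentiableM _ (CC R) (fun x => cexp (Ci * w%:C * rtilde rho x))
  (fun x => ((4 * pi)%:C * rtilde rho x)^-1)).
  apply: (@differentiable_comp _ (CC R) (CC R) (CC R)
    (fun x : CC R => Ci * w%:C * rtilde rho x : CC R) (@cexp R)).
    exact: (@differentiableZ _ (CC R) (CC R) (rtilde rho) (Ci * w%:C) z dr).
  by apply/derivable1_diffP; exact: derivable_cexp.
apply: (@differentiableV _ (CC R) (fun x => (4 * pi)%:C * rtilde rho x)).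
  exact: (@differentiableZ _ (CC R) (CC R) (rtilde rho) (4 * pi)%:C z dr).
apply: mulf_neq0; first by rewrite realc_eq0 mulf_neq0// gt_eqF// pi_gt0.
by apply: cre_neq0; rewrite gt_eqF.
Qed.

(** There are two ways to avoid the cut: off the plane Re z = 0 the radicand is not real, and on it
    outside the disc the radicand is positive. *)
Lemma cre_rtilde_gt0 (rho : R * R) (z : CC R) : cim z != 0 ->
  (cre z != 0) || (`|cim z| < norm2 rho) -> 0 < cre (rtilde rho z).
Proof.
move=> y0; have [x0|x0] := eqVneq (cre z) 0; rewrite /= => H; last first.
  apply: cre_csqrt_gt0; rewrite cimD cimR add0r expr2 cimM [cim _ * _]mulrC.
  by rewrite -mulr2n mulrn_eq0/= mulf_neq0.
apply: cre_csqrt_gt0'; rewrite creD creR expr2 creM x0 mul0r sub0r subr_gt0.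
by rewrite -[X in X < _]expr2 -(real_normK (num_real (cim z))) ltrXn2r// ?nnegrE ?normr_ge0 ?norm2_ge0.
Qed.

Lemma analytic_continuation (a w : R) (rho : R * R) : 0 < a -> 0 < w -> a < norm2 rho ->
  exists r : R, 0 < r /\ exists G : CC R -> CC R,
    (forall z : CC R, cre z ^+ 2 + (cim z + a) ^+ 2 < r ^+ 2 -> derivable G z 1) /\
    (forall z : CC R, cre z ^+ 2 + (cim z + a) ^+ 2 < r ^+ 2 ->
       0 < cre z -> G z = Uplus w rho z) /\
    (forall z : CC R, cre z ^+ 2 + (cim z + a) ^+ 2 < r ^+ 2 ->
       cre z < 0 -> G z = Uplus w (opp2 rho) (- z)).
Proof.
move=> a0 w0 ar; pose r := Num.min a (norm2 rho - a).
(* In the ball of radius r about -ia the bound r <= a gives Im z < 0 and the bound r <= rho - a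
   gives |Im z| < rho, so the beam itself is the common continuation. *)
have r0 : 0 < r by rewrite lt_min a0 subr_gt0.
have ra : r <= a by rewrite ge_min lexx.
have rr : r <= norm2 rho - a by rewrite ge_min lexx orbT.
have D (z : CC R) : cre z ^+ 2 + (cim z + a) ^+ 2 < r ^+ 2 ->
    cim z < 0 /\ `|cim z| < norm2 rho.
  move=> zr; have : (cim z + a) ^+ 2 < r ^+ 2.
    by rewrite (le_lt_trans _ zr)// lerDr sqr_ge0.
  rewrite -(real_normK (num_real (cim z + a))) ltr_pXn2r ?nnegrE ?normr_ge0 ?ltW//.
  rewrite ltr_norml => /andP[l1 l2].
  have y0 : cim z < 0 by lra.
  by split => //; rewrite ltr0_norm//; lra.
exists r; split => //; exists (beamB w rho); split; [|split] => z /D[y0 yr].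
- apply/derivable1_diffP; apply: differentiable_beamB.
  by apply: cre_rtilde_gt0; [rewrite lt_eqF|rewrite yr orbT].
- by move=> z0; rewrite Uplus_beam// lt_eqF.
- move=> z0; rewrite Uplus_beam// ?beamB_opp// ?creN ?cimN ?oppr_gt0//.
  by rewrite oppr_eq0 lt_eqF.
Qed.

Lemma beamB_cvg (a w s : R) (rho : R * R) : 0 < a -> a < norm2 rho ->
  beamB w rho ((s * e) -i* a) @[e --> (0 : R)^'+] --> beamB w rho (0 -i* a).
Proof.
move=> a0 ar.
apply: (@cvg_comp _ _ _ (fun e : R => ((s * e) -i* a : CC R)) (beamB w rho) _ (nbhs (0 -i* a : CC R))).
  apply: ccvg => /=; rewrite /cre/cim/=; last exact: cvg_cst.
  apply: cvg_at_right_filter; rewrite -[X in _ --> X](mulr0 s).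
  by apply: cvgM; [exact: cvg_cst|exact: cvg_id].
apply: (@differentiable_continuous _ (CC R) (CC R)); apply: differentiable_beamB.
apply: cre_rtilde_gt0; first by rewrite /cim/= oppr_eq0 gt_eqF.
by rewrite /cim/= normrN gtr0_norm// ar orbT.
Qed.

Lemma boundary_values (a w : R) (rho : R * R) : 0 < a -> 0 < w -> a < norm2 rho ->
  exists l : CC R,
    Uplus w rho (e -i* a) @[e --> (0 : R)^'+] --> l /\
    Uplus w (opp2 rho) (- ((- e) -i* a)) @[e --> (0 : R)^'+] --> l.
Proof.
move=> a0 w0 ar; exists (beamB w rho (0 -i* a)); split.
  apply: cvg_trans (@beamB_cvg a w 1 rho a0 ar); apply: near_eq_cvg; near=> e.
  have e0 : 0 < e by near: e; exact: nbhs_right_gt.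
  by rewrite mul1r Uplus_beam// /cim/= oppr_eq0 gt_eqF.
apply: cvg_trans (@beamB_cvg a w (-1) rho a0 ar); apply: near_eq_cvg; near=> e.
have e0 : 0 < e by near: e; exact: nbhs_right_gt.
rewrite mulN1r Uplus_beam// ?beamB_opp// /cre /cim/= ?opprK//.
by rewrite gt_eqF.
Unshelve. all: by end_near. Qed.

End beam_regularity.

(** * The jump across the branch disc *)

Section jump.
Context {R : realType}.
Variables (a w : R) (rho : R * R).
Hypothesis a0 : 0 < a.

Let s := Num.sqrt (a ^+ 2 - norm2 rho ^+ 2).
(** For rho < a and e > 0 the radicand at e - ia and -e - ia is e^2 - s^2 -+ 2 i e a. [M] is its
    modulus, [P] and [Q] are the absolute values of the real and imaginary parts of its root. *)
Let M (e : R) := Num.sqrt ((e ^+ 2 - s ^+ 2) ^+ 2 + (2 * e * a) ^+ 2).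
Let P (e : R) := Num.sqrt ((M e + (e ^+ 2 - s ^+ 2)) / 2).
Let Q (e : R) := Num.sqrt ((M e - (e ^+ 2 - s ^+ 2)) / 2).

Let cM : continuous M.
Proof.
move=> e; apply: (@continuous_comp _ _ _ (fun e : R => (e ^+ 2 - s ^+ 2) ^+ 2 + (2 * e * a) ^+ 2) Num.sqrt); last exact: sqrt_continuous.
exact: (rdiff_continuous (rdiffD (rdiffX 2 (rdiffD (rdiffX 2 rdiffId) (rdiffC (- s ^+ 2))))
  (rdiffX 2 (rdiffM (rdiffM (rdiffC 2) rdiffId) (rdiffC a))))).
Qed.

Let cP' : continuous P.
Proof.
move=> e; apply: (@continuous_comp _ _ _ (fun e : R => (M e + (e ^+ 2 - s ^+ 2)) / 2) Num.sqrt); last exact: sqrt_continuous.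
apply: cvgM; last exact: cvg_cst.
apply: cvgD; first exact: cM.
by apply: cvgB; [exact: sqr_continuous|exact: cvg_cst].
Qed.

Let cQ' : continuous Q.
Proof.
move=> e; apply: (@continuous_comp _ _ _ (fun e : R => (M e - (e ^+ 2 - s ^+ 2)) / 2) Num.sqrt); last exact: sqrt_continuous.
apply: cvgM; last exact: cvg_cst.
apply: cvgB; first exact: cM.
by apply: cvgB; [exact: sqr_continuous|exact: cvg_cst].
Qed.

Lemma rtilde_above e : norm2 rho < a -> 0 < e ->
  rtilde rho (e -i* a) = P e -i* Q e /\ rtilde rho ((- e) -i* a) = P e +i* Q e.
Proof.
move=> ra e0.
have s2 : s ^+ 2 = a ^+ 2 - norm2 rho ^+ 2.
  by rewrite sqr_sqrtr// subr_ge0 lerXn2r ?nnegrE ?norm2_ge0 ?ltW.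
have X (x : R) : x ^+ 2 = e ^+ 2 -> cre ((norm2 rho ^+ 2)%:C + (x -i* a : CC R) ^+ 2) = e ^+ 2 - s ^+ 2.
  by move=> xe; rewrite creD creR expr2 creM /cre/cim/= s2 -xe; ring.
have Y (x : R) : cim ((norm2 rho ^+ 2)%:C + (x -i* a : CC R) ^+ 2) = - (2 * x * a).
  by rewrite cimD cimR expr2 cimM /cre/cim/=; ring.
have ea : 0 < 2 * e * a by rewrite !mulr_gt0.
split; rewrite /rtilde; apply: cP.
- by rewrite cre_csqrt /cabs Y X// sqrrN.
- rewrite cim_csqrt /cabs Y X// sqrrN oppr_lt0 ea mulN1r//.
- by rewrite cre_csqrt /cabs Y X// ?sqrrN// mulrN mulNr !sqrrN.
- rewrite cim_csqrt /cabs Y X// ?sqrrN// mulrN mulNr opprK ltNge (ltW ea)/= mul1r.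
  by rewrite sqrrN.
Qed.

(** Outside the disc the beam is continuous and both sides vanish. Inside, the root tends to -is
    from above and to +is from below; its sign also enters through the denominator, so the two
    exponentials e^{ws} and e^{-ws} add up to a cosh. *)
Lemma beam_jump : norm2 rho != a ->
  (beamB w rho (e -i* a) - beamB w rho ((- e) -i* a))
    @[e --> (0 : R)^'+] --> jumpJ rho a w.
Proof.
move=> ra; have [ar|ar] := ltP a (norm2 rho).
  rewrite /jumpJ /heaviside leNgt subr_lt0 ar/= mul0r mulr0 mul0r.
  rewrite -[X in _ --> X](subrr (beamB w rho (0 -i* a))).
  have c1 := @beamB_cvg _ a w 1 rho a0 ar; have c2 := @beamB_cvg _ a w (-1) rho a0 ar.
  apply: cvg_trans (cvgB c1 c2); apply: near_eq_cvg; near=> e.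
  by rewrite !fctE !(mul1r, mulN1r).
have {}ar : norm2 rho < a by rewrite lt_neqAle ra.
have s0 : 0 < s by rewrite sqrtr_gt0 subr_gt0 ltrXn2r ?nnegrE ?norm2_ge0// ltW.
have M0 : M 0 = s ^+ 2.
  by rewrite /M expr0n/= mulr0 mul0r expr0n/= addr0 sub0r sqrrN sqrtr_sqr ger0_norm ?sqr_ge0.
have P0 : P 0 = 0 by rewrite /P M0 expr0n/= sub0r subrr mul0r sqrtr0.
have Q0 : Q 0 = s.
  rewrite /Q M0 expr0n/= sub0r opprK (_ : (s ^+ 2 + s ^+ 2) / 2 = s ^+ 2); last by field.
  by rewrite sqrtr_sqr gtr0_norm.
(* Both one-sided limits at once: sg = -1 from above and sg = 1 from below. *)
have lim (sg : R) (sg0 : sg != 0) :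
   (cexp (Ci * w%:C * (P e +i* (sg * Q e))) / ((4 * pi)%:C * (P e +i* (sg * Q e))) : CC R)
   @[e --> (0 : R)^'+] -->
   (cexp (Ci * w%:C * (0 +i* (sg * s))) / ((4 * pi)%:C * (0 +i* (sg * s))) : CC R).
  have l : (P e +i* (sg * Q e) : CC R) @[e --> (0 : R)^'+] --> (0 +i* (sg * s) : CC R).
    apply: ccvg; rewrite /cre/cim/=.
      by apply: cvg_at_right_filter; rewrite -[X in _ --> X]P0; exact: cP'.
    apply: cvgM; first exact: cvg_cst.
    by apply: cvg_at_right_filter; rewrite -[X in _ --> X]Q0; exact: cQ'.
  apply: cvgM.
    apply: (@cvg_comp _ _ _ (fun e : R => Ci * w%:C * (P e +i* (sg * Q e)) : CC R) (@cexp R) _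
      (nbhs (Ci * w%:C * (0 +i* (sg * s)) : CC R))).
      by apply: cvgM; [exact: cvg_cst|exact: l].
    apply: (@differentiable_continuous _ (CC R) (CC R)); apply/derivable1_diffP.
    exact: derivable_cexp.
  apply: (@cvgV _ _ _ _ (fun e : R => (4 * pi)%:C * (P e +i* (sg * Q e)) : CC R)).
    apply: mulf_neq0; first by rewrite realc_eq0 mulf_neq0// gt_eqF// pi_gt0.
    apply/eqP => /(congr1 (@cim R)); rewrite /cim/= => /eqP.
    by rewrite mulf_eq0 (negbTE sg0) (gt_eqF s0).
  by apply: cvgM; [exact: cvg_cst|exact: l].
have n1 : -1 != 0 :> R by rewrite oppr_eq0 oner_eq0.
have c1 := lim _ n1; have c2 := lim 1 (oner_neq0 _).
have -> : jumpJ rho a w =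
  cexp (Ci * w%:C * (0 +i* (-1 * s))) / ((4 * pi)%:C * (0 +i* (-1 * s))) -
  cexp (Ci * w%:C * (0 +i* (1 * s))) / ((4 * pi)%:C * (0 +i* (1 * s))).
  rewrite /jumpJ -/s /heaviside subr_ge0 (ltW ar) /cosh mulN1r !mul1r.
  have sE (x : R) : (0 +i* x : CC R) = Ci * x%:C by apply: cP; rewrite !ccE /cre/cim/=; ring.
  have eE (x : R) : cexp (Ci * w%:C * (Ci * x%:C)) = (expR (- (w * x)))%:C.
    have -> : Ci * w%:C * (Ci * x%:C) = (- (w * x))%:C.
      rewrite (_ : Ci * w%:C * (Ci * x%:C) = (Ci * Ci) * (w%:C * x%:C)); last by ring.
      by rewrite CiCi mulN1r -realcM -realcN.
    by apply: cP; rewrite ?cre_cexp ?cim_cexp creR cimR ?cos0 ?sin0 ?mulr1 ?mulr0 ?creR ?cimR.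
  rewrite !sE !eE mulrN opprK.
  move: (expR (w * s)) (expR (- (w * s))) => E F.
  have sn : (s%:C : CC R) != 0 by rewrite realc_eq0 gt_eqF.
  have : (pi%:C : CC R) != 0 by rewrite realc_eq0 gt_eqF// pi_gt0.
  move: (@pi R) s sn => p t tn pn.
  rewrite !(realcM, realcV, realcN, realcn, realcD E F) !invfM CiV invrN.
  by field; rewrite tn pn.
apply: cvg_trans (cvgB c1 c2); apply: near_eq_cvg; near=> e.
have e0 : 0 < e by near: e; exact: nbhs_right_gt.
have [r1 r2] := rtilde_above ar e0.
by rewrite !fctE /beamB r1 r2 mulN1r mul1r.
Unshelve. all: by end_near. Qed.

End jump.

(** * Decay of J_0 and the spectral limits *)

Section bessel_decay.
Context {R : realType}.
Notation mu := (@lebesgue_measure R).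
Implicit Types x m t : R.

(* With y = J_0 and d = y', this is x (y^2 + d^2) + y d, an almost conserved
   energy of the Bessel equation y'' + y'/x + y = 0: its derivative is -y d / x. *)
Definition besE x : R :=
  x * (besj (x ^+ 2) ^+ 2 + 4 * x ^+ 2 * besg (x ^+ 2) ^+ 2) +
  2 * x * (besj (x ^+ 2) * besg (x ^+ 2)).

Lemma is_derive_besE x :
  is_derive x 1 besE (- (2 * besj (x ^+ 2) * besg (x ^+ 2))).
Proof.
have dx2 := dX 2 (dId x).
have dj := @dComp _ (@besj R) (fun s => s ^+ 2) x _ _ (is_derive_besj (x ^+ 2)) dx2.
have dg := @dComp _ (@besg R) (fun s => s ^+ 2) x _ _ (is_derive_besg (x ^+ 2)) dx2.
have H := dD (dM (dId x) (dD (dX 2 dj) (dM (dZ 4 dx2) (dX 2 dg))))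
  (dM (dZ 2 (dId x)) (dM dj dg)).
apply: (dEq H) => /=; have O := besODE (x ^+ 2).
move: (besj _) (besg _) (besh _) O => j g h O.
transitivity (- (2 * j * g) + (16 * x ^+ 2 * g + 4 * j) * (x ^+ 2 * h + g + j / 4)).
  by field.
by rewrite O addNr mulr0 addr0.
Qed.

(** The derivative -y d / x of the energy E has no sign, but for x >= 1 it is at most E / x^2 in
    absolute value, which is integrable at infinity. The factor exp (1/x) compensates exactly this
    rate, so the product decreases. *)
Lemma besE_decr x : 1 <= x -> besE x * expR x^-1 <= besE 1 * expR 1^-1.
Proof.
move=> x1.
have dL t : 1 <= t -> is_derive t 1 (fun s => besE s * expR s^-1)
    (- (2 * besj (t ^+ 2) * besg (t ^+ 2) + besE t / t ^+ 2) * expR t^-1).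
  move=> t1; have t0 : t != 0 by rewrite gt_eqF// (lt_le_trans ltr01).
  apply: (dEq (dM (is_derive_besE t) (dExp (dV (dId t) t0)))).
  by move: (expR _) (besE _) => e b; field.
have neg t : 1 <= t ->
    - (2 * besj (t ^+ 2) * besg (t ^+ 2) + besE t / t ^+ 2) * expR t^-1 <= 0.
  move=> t1; rewrite mulNr oppr_le0 mulr_ge0 ?expR_ge0//.
  have t0 : 0 < t by rewrite (lt_le_trans ltr01).
  rewrite -(pmulr_rge0 _ (exprn_gt0 2 t0)) /besE.
  move: (besj _) (besg _) => j g.
  (* After multiplication by t^2 the bracket is a combination of squares whose coefficients are
     nonnegative for t >= 1. *)
  have -> : t ^+ 2 * (2 * j * g +
      (t * (j ^+ 2 + 4 * t ^+ 2 * g ^+ 2) + 2 * t * (j * g)) / t ^+ 2) =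
    (t - 1) / 2 * (j ^+ 2 + (2 * t * g) ^+ 2) + (t + 1) / 2 * (j + 2 * t * g) ^+ 2.
    by field; rewrite gt_eqF.
  apply: addr_ge0; apply: mulr_ge0.
  - by rewrite divr_ge0// subr_ge0.
  - by rewrite addr_ge0 ?sqr_ge0.
  - by rewrite divr_ge0// addr_ge0// ltW.
  - exact: sqr_ge0.
apply: (@ler0_derive1_nincr R (fun s => besE s * expR s^-1) 1 x).
- by move=> t; rewrite in_itv/= => /andP[t1 _]; have [] := dL t (ltW t1).
- move=> t; rewrite in_itv/= => /andP[t1 _]; rewrite derive1E.
  by have [_ ->] := dL t (ltW t1); exact: neg (ltW t1).
- apply: derivable_within_continuous => t; rewrite in_itv/= => /andP[t1 _].
  by have [] := dL t t1.
- exact: lexx.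
- exact: x1.
- exact: lexx.
Qed.

Lemma bessel_energy_bound : exists2 K : R, 0 <= K &
  forall x, 1 <= x ->
    x * (besj (x ^+ 2) ^+ 2 + (2 * x * besg (x ^+ 2)) ^+ 2) <= K.
Proof.
have low x : 1 <= x ->
    x * (besj (x ^+ 2) ^+ 2 + (2 * x * besg (x ^+ 2)) ^+ 2) <= 2 * besE x.
  move=> x1; rewrite /besE; move: (besj _) (besg _) => j g.
  rewrite -subr_ge0.
  have -> : 2 * (x * (j ^+ 2 + 4 * x ^+ 2 * g ^+ 2) + 2 * x * (j * g)) -
      x * (j ^+ 2 + (2 * x * g) ^+ 2) =
    (x - 1) * (j ^+ 2 + (2 * x * g) ^+ 2) + (j + 2 * x * g) ^+ 2 by ring.
  by rewrite addr_ge0 ?sqr_ge0// mulr_ge0 ?subr_ge0// addr_ge0 ?sqr_ge0.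
have E0 x : 1 <= x -> 0 <= besE x.
  move=> x1; rewrite -(@pmulr_rge0 _ 2)//; apply: le_trans (low x x1).
  by rewrite mulr_ge0 ?addr_ge0 ?sqr_ge0// (le_trans _ x1).
exists (2 * (besE 1 * expR 1^-1)).
  by rewrite mulr_ge0// mulr_ge0 ?expR_ge0// E0.
move=> x x1; rewrite (le_trans (low x x1))// ler_wpM2l//.
apply: le_trans (besE_decr x1); rewrite ler_peMr ?E0//.
by rewrite -expR0 ler_expR invr_ge0 (le_trans _ x1).
Qed.

(** The energy bound gives J_0 and J_0' of order x^{-1/2}, hence j' = J_0' / (2x) of order x^{-3/2}.
    For x < 1 the bounds 1 and 1/4 suffice; the summand 1 in the constant accounts for them. *)
Lemma bessel_decay : exists2 C : R, 0 < C & forall x, 0 < x ->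
  `|besj (x ^+ 2)| * Num.sqrt x <= C /\
  `|besg (x ^+ 2)| * (x * Num.sqrt x) <= C.
Proof.
have [K K0 HK] := bessel_energy_bound.
exists (Num.sqrt K + 1); first by rewrite ltr_wpDl ?sqrtr_ge0.
move=> x x0; have X0 : 0 <= x ^+ 2 by rewrite sqr_ge0.
have sx : 0 <= Num.sqrt x := sqrtr_ge0 x.
have [x1|x1] := leP 1 x; last first.
  have s1 : Num.sqrt x <= 1 by rewrite -sqrtr1 ler_wsqrtr// ltW.
  have C1 : 1 <= Num.sqrt K + 1 by rewrite lerDr sqrtr_ge0.
  split; apply: le_trans C1.
    by rewrite mulr_ile1// besj_le1.
  apply: mulr_ile1; rewrite ?mulr_ge0 ?(ltW x0)//.
    by rewrite (le_trans (besg_le X0))// invf_le1// ler1n.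
  by rewrite mulr_ile1// ltW.
have H := HK x x1.
have KC : Num.sqrt K <= Num.sqrt K + 1 by rewrite lerDl.
split; apply: le_trans KC.
  rewrite -[leLHS]ger0_norm ?mulr_ge0// -sqrtr_sqr ler_wsqrtr// exprMn sqr_sqrtr ?(ltW x0)//.
  rewrite real_normK ?num_real//; apply: le_trans H.
  by rewrite mulrC ler_wpM2l ?(ltW x0)// lerDl sqr_ge0.
rewrite -[leLHS]ger0_norm; last by rewrite mulr_ge0// mulr_ge0// ltW.
rewrite -sqrtr_sqr ler_wsqrtr// exprMn real_normK ?num_real// exprMn sqr_sqrtr ?(ltW x0)//.
apply: le_trans H; move: (besj _) (besg _) => j g.
rewrite -subr_ge0.
have -> : x * (j ^+ 2 + (2 * x * g) ^+ 2) - g ^+ 2 * (x ^+ 2 * x) =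
  x * (j ^+ 2 + 3 * (x * g) ^+ 2) by ring.
by rewrite mulr_ge0 ?(ltW x0)// addr_ge0 ?sqr_ge0// mulr_ge0// sqr_ge0.
Qed.

Lemma inv_sqrt_cvg0 : (Num.sqrt (1 + x))^-1 @[x --> +oo] --> (0 : R).
Proof.
apply/cvgrPdist_le => e e0; near=> x.
have x0 : 0 <= x by near: x; exact: nbhs_pinfty_ge.
have s0 : 0 < Num.sqrt (1 + x) by rewrite sqrtr_gt0 ltr_pwDl.
rewrite sub0r normrN ger0_norm; last by rewrite invr_ge0 ltW.
rewrite invf_ple ?posrE//.
rewrite -[leLHS]ger0_norm; last by rewrite invr_ge0 ltW.
rewrite -sqrtr_sqr ler_wsqrtr//.
apply: (@le_trans _ _ x); last by rewrite lerDr.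
by near: x; apply: nbhs_pinfty_ge; exact: num_real.
Unshelve. all: by end_near. Qed.

(** The integrable majorant (1 + m)^{-3/2}, with primitive -2 (1 + m)^{-1/2}. *)
Definition pow32 m : R := ((1 + m) * Num.sqrt (1 + m))^-1.

Lemma pow32_ge0 m : 0 <= m -> 0 <= pow32 m.
Proof. by move=> m0; rewrite invr_ge0 mulr_ge0 ?sqrtr_ge0// addr_ge0. Qed.

Lemma integrable_pow32 : mu.-integrable `[0, +oo[ (EFin \o pow32).
Proof.
have t0 m : 0 <= m -> 0 < 1 + m by move=> m0; rewrite ltr_pwDl.
have s0 m : 0 <= m -> 0 < Num.sqrt (1 + m) by move=> m0; rewrite sqrtr_gt0 t0.
have dt m : is_derive m 1 (fun s : R => 1 + s) 1.
  by apply: (dEq (dD (dCst 1 m) (dId m))); rewrite add0r.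
have dF m : 0 <= m -> is_derive m 1 (fun s => - 2 * (Num.sqrt (1 + s))^-1) (pow32 m).
  move=> m0; have ds := dSqrt (dt m) (t0 m m0).
  apply: (dEq (dZ (- 2) (dV ds (lt0r_neq0 (s0 m m0))))).
  rewrite sqr_sqrtr; last by rewrite ltW// t0.
  rewrite /pow32; have := s0 m m0; have := t0 m m0.
  by move: (Num.sqrt _) => q ? ?; field; rewrite !gt_eqF.
have df m : 0 <= m -> derivable pow32 m 1.
  move=> m0; have ds := dSqrt (dt m) (t0 m m0).
  have nz : (1 + m) * Num.sqrt (1 + m) != 0 by rewrite mulf_neq0// gt_eqF ?t0 ?s0.
  by have [] := dV (dM (dt m) ds) nz.
have cf : {within `[0, +oo[, continuous pow32}.
  apply: derivable_within_continuous => m; rewrite in_itv/= andbT; exact: df.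
apply/integrableP; split.
  by apply/measurable_EFinP; apply: subspace_continuous_measurable_fun.
have -> : (\int[mu]_(x in `[0%R, +oo[) `|(EFin \o pow32) x| =
    \int[mu]_(x in `[0%R, +oo[) (pow32 x)%:E)%E.
  apply: eq_integral => m; rewrite inE/= in_itv/= andbT => m0.
  by rewrite /= ger0_norm// pow32_ge0.
have l : - 2 * (Num.sqrt (1 + x))^-1 @[x --> +oo] --> - 2 * (0 : R).
  apply: cvgM; first exact: cvg_cst.
  exact: inv_sqrt_cvg0.
rewrite (ge0_continuous_FTC2y _ cf l)//.
- by rewrite ltry.
- exact: pow32_ge0.
- by move=> m m0; have [] := dF m (ltW m0).
- have c0 : {for 0, continuous (fun s : R => - 2 * (Num.sqrt (1 + s))^-1)}.
    apply: differentiable_continuous; apply/derivable1_diffP.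
    by have [] := dF 0 (lexx 0).
  exact: (cvg_at_right_filter c0).
- move=> m; rewrite in_itv/= andbT => m0.
  by rewrite derive1E; have [_ ->] := dF m (ltW m0).
Qed.

End bessel_decay.

Section limit_kit.
Context {R : realType}.
Notation mu := (@lebesgue_measure R).

Lemma rdiffV (f : R -> R) : rdiff f -> (forall t, f t != 0) -> rdiff (fun s => (f s)^-1).
Proof.
by move=> df f0 t; have [l L] := df t; exists (- (l / f t ^+ 2)); exact: dV.
Qed.

Lemma cvg_cim T (F : set_system T) {FF : Filter F} (f : T -> CC R) (l : CC R) :
  f @ F --> l -> (fun t => cim (f t)) @ F --> cim l.
Proof.
move=> /cvgrPdist_lt fl; apply/cvgrPdist_lt => e e0.
have /fl : 0 < (e%:C : R[i]) by rewrite ltcR.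
apply: filterS => t; rewrite -cabsE ltcR => H.
by rewrite (le_lt_trans _ H)// -cimN -cimD cim_le_cabs.
Qed.

Lemma cintegralB d (T : measurableType d) (nu : {measure set T -> \bar R})
    (D : set T) (f g : T -> CC R) : measurable D -> cintegrable nu D f ->
  cintegrable nu D g ->
  cintegral nu D (fun x => f x - g x) = cintegral nu D f - cintegral nu D g.
Proof.
move=> mD [f1 f2] [g1 g2]; apply: cP.
  rewrite creD creN /cintegral !creE -RintegralB//.
  by apply: eq_Rintegral => x _; rewrite creD creN.
rewrite cimD cimN /cintegral !cimE -RintegralB//.
by apply: eq_Rintegral => x _; rewrite cimD cimN.
Qed.

Lemma cvg_cre T (F : set_system T) {FF : Filter F} (f : T -> CC R) (l : CC R) :
  f @ F --> l -> (fun t => cre (f t)) @ F --> cre l.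
Proof.
move=> /cvgrPdist_lt fl; apply/cvgrPdist_lt => e e0.
have /fl : 0 < (e%:C : R[i]) by rewrite ltcR.
apply: filterS => t; rewrite -cabsE ltcR => H.
by rewrite (le_lt_trans _ H)// -creN -creD cre_le_cabs.
Qed.

Lemma ccvgD T (F : set_system T) {FF : Filter F} (f g : T -> CC R) (l k : CC R) :
  f @ F --> l -> g @ F --> k -> (fun t => f t + g t) @ F --> (l + k : CC R).
Proof.
move=> fl gk; apply: ccvg.
  under eq_fun do rewrite creD; rewrite creD.
  by apply: cvgD; exact: cvg_cre.
under eq_fun do rewrite cimD; rewrite cimD.
by apply: cvgD; exact: cvg_cim.
Qed.

Lemma ccvgB T (F : set_system T) {FF : Filter F} (f g : T -> CC R) (l k : CC R) :
  f @ F --> l -> g @ F --> k -> (fun t => f t - g t) @ F --> (l - k : CC R).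
Proof.
move=> fl gk; apply: ccvg.
  under eq_fun do rewrite creD creN; rewrite creD creN.
  by apply: cvgB; exact: cvg_cre.
under eq_fun do rewrite cimD cimN; rewrite cimD cimN.
by apply: cvgB; exact: cvg_cim.
Qed.

Lemma ccvg_affine T (F : set_system T) {FF : Filter F} (c d : CC R)
    (f g : T -> CC R) (l : CC R) :
  f @ F --> l -> g @ F --> (0 : CC R) ->
  (fun t => c * (f t + g t - d)) @ F --> (c * (l - d) : CC R).
Proof.
move=> fl g0.
have H := @ccvgD _ _ FF f g l 0 fl g0.
have H2 := @ccvgB _ _ FF (fun t => f t + g t) (fun=> d) (l + 0) d H (cvg_cst d).
have {}H2 := H2 FF; rewrite addr0 in H2.
have [r i] : (fun t => cre (f t + g t - d)) @ F --> cre (l - d) /\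
    (fun t => cim (f t + g t - d)) @ F --> cim (l - d).
  by split; [exact: cvg_cre H2|exact: cvg_cim H2].
apply: ccvg.
  under eq_fun do rewrite creM; rewrite creM.
  by apply: cvgB; apply: cvgM => //; exact: cvg_cst.
under eq_fun do rewrite cimM; rewrite cimM.
by apply: cvgD; apply: cvgM => //; exact: cvg_cst.
Qed.

End limit_kit.

(** * Integration by parts in the evanescent integral *)

Section spectral.
Context {R : realType}.
Notation mu := (@lebesgue_measure R).
Notation mR := (measurableTypeR R).
Variables (w s : R).
Hypotheses (w0 : 0 < w) (s0 : 0 < s).
Implicit Types m : R.

Definition sN m : R := w ^+ 2 + m ^+ 2.
Definition sf m : R := besj (sN m * s ^+ 2).
Definition sg m : R := besg (sN m * s ^+ 2).
Definition sf' m : R := 2 * s ^+ 2 * m * sg m.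
(* [sR] is [sf'' + s^2 sf] rewritten with Bessel's equation. *)
Definition sR m : R :=
  s ^+ 2 * (w ^+ 2 / sN m) * sf m + 2 * s ^+ 2 * sg m * (1 - 2 * m ^+ 2 / sN m).

Lemma sN_gt0 m : 0 < sN m.
Proof. by rewrite ltr_pwDl ?exprn_gt0// sqr_ge0. Qed.

Let dsN m : is_derive m 1 (fun m => sN m * s ^+ 2) (2 * m * s ^+ 2).
Proof.
apply: (dEq (dM (dD (dCst (w ^+ 2) m) (dX 2 (dId m))) (dCst (s ^+ 2) m))).
by rewrite /= expr1; ring.
Qed.

Lemma is_derive_sf m : is_derive m 1 sf (sf' m).
Proof.
apply: (dEq (@dComp _ (@besj R) (fun m => sN m * s ^+ 2) m _ _ (is_derive_besj _) (dsN m))).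
by rewrite /sf' /sg; ring.
Qed.

Let dsg m : is_derive m 1 sg (besh (sN m * s ^+ 2) * (2 * m * s ^+ 2)).
Proof. exact: (@dComp _ (@besg R) (fun m => sN m * s ^+ 2) m _ _ (is_derive_besg _) (dsN m)). Qed.

Lemma is_derive_sf' m : is_derive m 1 sf' (sR m - s ^+ 2 * sf m).
Proof.
apply: (dEq (dM (dZ (2 * s ^+ 2) (dId m)) (dsg m))).
have O := besODE (sN m * s ^+ 2); have N0 := sN_gt0 m.
rewrite /sR /sf /sg; move: (besj _) (besg _) (besh _) O => j g h O.
have -> : h = - (j / 4 + g) / (sN m * s ^+ 2).
  rewrite opprD -O; field; rewrite gt_eqF//= gt_eqF//.
have NE : w ^+ 2 = sN m - m ^+ 2 by rewrite /sN addrK.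
rewrite NE; move: (sN m) N0 => N N0.
by field; rewrite !gt_eqF.
Qed.

Let rdsf : rdiff sf. Proof. by move=> m; exists (sf' m); exact: is_derive_sf. Qed.

Lemma rdiff_sR : rdiff sR.
Proof.
have rN : rdiff (fun m => (sN m)^-1).
  apply: rdiffV; last by move=> t; rewrite gt_eqF// sN_gt0.
  by apply: rdiffD; [exact: rdiffC|apply: rdiffX; exact: rdiffId].
have rg : rdiff sg by move=> m; eexists; exact: dsg.
apply: rdiffD.
  apply: rdiffM => //; apply: rdiffM; first exact: rdiffC.
  by apply: rdiffM => //; exact: rdiffC.
apply: rdiffM; first by apply: rdiffM => //; exact: rdiffC.
apply: (@rdiffD _ (fun=> 1) (fun m => - (2 * m ^+ 2 / sN m))); first exact: rdiffC.
have rm : rdiff (fun m => 2 * m ^+ 2 / sN m).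
  apply: rdiffM => //; apply: rdiffM; first exact: rdiffC.
  by apply: rdiffX; exact: rdiffId.
by move=> m; have [l L] := rm m; exists (- l); exact: dN.
Qed.

(** Comparing with 1 + m instead of m makes the decay estimates uniform down to m = 0. *)
Lemma sN_ge m : 0 <= m -> (Num.min 1 w / 2 * (1 + m)) ^+ 2 <= sN m.
Proof.
move=> m0; have q1 : Num.min 1 w <= 1 by rewrite ge_min lexx.
have qw : Num.min 1 w <= w by rewrite ge_min lexx orbT.
have q0 : 0 <= Num.min 1 w by rewrite le_min ler01 ltW.
move: (Num.min 1 w) q0 q1 qw => q q0 q1 qw.
have h1 : q ^+ 2 <= w ^+ 2 by rewrite lerXn2r ?nnegrE// ltW.
have h2 : q ^+ 2 * m ^+ 2 <= m ^+ 2 by rewrite ler_piMl ?sqr_ge0// expr_le1.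
have h3 : (q / 2 * (1 + m)) ^+ 2 <= q ^+ 2 + q ^+ 2 * m ^+ 2.
  rewrite -subr_ge0.
  have -> : q ^+ 2 + q ^+ 2 * m ^+ 2 - (q / 2 * (1 + m)) ^+ 2 =
     q ^+ 2 * ((1 + m ^+ 2) / 2 + (1 - m) ^+ 2 / 4) by field.
  by rewrite mulr_ge0 ?sqr_ge0// addr_ge0// divr_ge0// ?sqr_ge0// addr_ge0 ?sqr_ge0.
by rewrite (le_trans h3)// lerD.
Qed.

(** Each term of [sR] is O(m^{-3/2}): the first because w^2 / N is O(m^{-2}) and |f| <= 1, the
    second because j' is O(m^{-3/2}) and the last factor is at most 1 in absolute value. In [sf']
    the factor m costs one power of the decay of j'. *)
Lemma spectral_bounds : exists2 C : R, 0 <= C & forall m, 0 <= m ->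
  [/\ `|sf m| <= C * (Num.sqrt (1 + m))^-1, `|sf' m| <= C * (Num.sqrt (1 + m))^-1 &
      `|sR m| <= C * pow32 m].
Proof.
have [C1 C10 H] := @bessel_decay R.
pose c := Num.min 1 w / 2 : R.
have c0 : 0 < c by rewrite divr_gt0// lt_min ltr01.
(* The Bessel argument x = s sqrt N is at least k (1 + m), so sqrt k and k' = k^{3/2} convert powers
   of x into powers of 1 + m. *)
pose k := s * c; have k0 : 0 < k by rewrite mulr_gt0.
pose k' := k * Num.sqrt k; have k'0 : 0 < k' by rewrite mulr_gt0// sqrtr_gt0.
have sk0 : 0 < Num.sqrt k by rewrite sqrtr_gt0.
pose D1 := C1 / Num.sqrt k; pose D2 := 2 * s ^+ 2 * (C1 / k').
pose D3 := s ^+ 2 * w ^+ 2 / c ^+ 2.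
have D10 : 0 <= D1 by rewrite divr_ge0// ltW.
have D20 : 0 <= D2 by rewrite mulr_ge0 ?divr_ge0 ?(ltW C10) ?(ltW k'0)// mulr_ge0// sqr_ge0.
have D30 : 0 <= D3 by rewrite divr_ge0 ?sqr_ge0// mulr_ge0 ?sqr_ge0.
exists (D1 + (D2 + (D3 + D2))); first by rewrite !addr_ge0.
move=> m m0.
have t0 : 0 < 1 + m by rewrite ltr_pwDl.
have st0 : 0 < Num.sqrt (1 + m) by rewrite sqrtr_gt0.
pose x := s * Num.sqrt (sN m).
have x0 : 0 < x by rewrite mulr_gt0// sqrtr_gt0 sN_gt0.
have x2 : x ^+ 2 = sN m * s ^+ 2.
  by rewrite exprMn sqr_sqrtr ?(ltW (sN_gt0 m))// mulrC.
have [hj hg] := H x x0; rewrite x2 -/(sf m) -/(sg m) in hj hg.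
have kx : k * (1 + m) <= x.
  rewrite /k -mulrA ler_wpM2l ?(ltW s0)//.
  rewrite -[leLHS]ger0_norm; last by apply: mulr_ge0; exact: ltW.
  by rewrite -sqrtr_sqr ler_wsqrtr// sN_ge.
have kt0 : 0 <= k * (1 + m) by rewrite mulr_ge0// ltW.
have skx : Num.sqrt k * Num.sqrt (1 + m) <= Num.sqrt x.
  by rewrite -sqrtrM ?(ltW k0)// ler_wsqrtr.
have bf : `|sf m| <= D1 * (Num.sqrt (1 + m))^-1.
  rewrite ler_pdivlMr// ler_pdivlMr// -mulrA; apply: le_trans hj.
  by rewrite ler_wpM2l// mulrC.
have bg : `|sg m| <= C1 / k' * pow32 m.
  rewrite ler_pdivlMr ?mulr_gt0// ler_pdivlMr//; apply: le_trans hg.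
  rewrite -mulrA ler_wpM2l// /k'.
  have -> : (1 + m) * Num.sqrt (1 + m) * (k * Num.sqrt k) =
     (k * (1 + m)) * (Num.sqrt k * Num.sqrt (1 + m)) by ring.
  by apply: ler_pM => //; rewrite mulr_ge0// ltW.
have p0 := pow32_ge0 m0.
have it0 : 0 <= (Num.sqrt (1 + m))^-1 by rewrite invr_ge0 ltW.
split.
- by rewrite (le_trans bf)// ler_wpM2r// lerDl !addr_ge0.
- apply: (@le_trans _ _ (D2 * (Num.sqrt (1 + m))^-1)); last first.
    by rewrite ler_wpM2r// addrCA lerDl !addr_ge0.
  rewrite /sf' normrM normrM (ger0_norm m0) ger0_norm; last by rewrite mulr_ge0// sqr_ge0.
  apply: (@le_trans _ _ (2 * s ^+ 2 * (1 + m) * (C1 / k' * pow32 m))).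
    apply: ler_pM => //; first by rewrite mulr_ge0// mulr_ge0// sqr_ge0.
    by rewrite ler_wpM2l ?lerDr// mulr_ge0// sqr_ge0.
  rewrite /D2 /pow32 le_eqVlt; apply/orP; left; apply/eqP.
  by field; rewrite !gt_eqF.
- apply: (@le_trans _ _ ((D3 + D2) * pow32 m)); last first.
    by rewrite ler_wpM2r// addrA lerDr addr_ge0.
  have N0 := sN_gt0 m.
  rewrite /sR; apply: (le_trans (ler_normD _ _)); rewrite [leRHS]mulrDl; apply: lerD.
    rewrite normrM ger0_norm; last by rewrite mulr_ge0 ?sqr_ge0// divr_ge0 ?sqr_ge0// ltW.
    apply: (@le_trans _ _ (s ^+ 2 * (w ^+ 2 / sN m))).
      rewrite ler_piMr ?besj_le1//; last by rewrite mulr_ge0 ?sqr_ge0// ltW.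
      by rewrite mulr_ge0 ?sqr_ge0// divr_ge0 ?sqr_ge0// ltW.
    rewrite /D3 mulrA -[leRHS]mulrA ler_wpM2l//; first by rewrite mulr_ge0 ?sqr_ge0.
    rewrite -invfM lef_pV2 ?posrE//; last by rewrite mulr_gt0 ?exprn_gt0// mulr_gt0.
    apply: le_trans (sN_ge m0); rewrite -/c [leRHS]exprMn ler_wpM2l ?sqr_ge0//.
    rewrite expr2 ler_wpM2l ?(ltW t0)//.
    have t1 : 1 <= Num.sqrt (1 + m) by rewrite -[leLHS]sqrtr1 ler_wsqrtr// lerDl.
    by rewrite -[leRHS](sqr_sqrtr (ltW t0)) expr2 ler_peMr// ltW.
  rewrite normrM normrM ger0_norm; last by rewrite mulr_ge0// sqr_ge0.
  have u1 : `|1 - 2 * m ^+ 2 / sN m| <= 1.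
    have a0 : 0 <= m ^+ 2 / sN m by rewrite divr_ge0 ?sqr_ge0// ltW.
    have a1 : m ^+ 2 / sN m <= 1 by rewrite ler_pdivrMr// mul1r lerDr sqr_ge0.
    by rewrite -mulrA; move: (m ^+ 2 / _) a0 a1 => u u0 u1; rewrite ler_norml; apply/andP; split; lra.
  rewrite -[leRHS]mulr1; apply: ler_pM => //.
    by rewrite mulr_ge0// mulr_ge0// sqr_ge0.
  by rewrite /D2 -mulrA ler_wpM2l// mulr_ge0// sqr_ge0.
Qed.

(** The two integrations by parts are packed into one antiderivative: [sPhi] differentiates to (s^2
    + z^2) f e^{-zm} minus this residual. *)
Definition sRK (z : CC R) m : CC R := (sR m)%:C * cexp (- z * m%:C).
Definition sPhi (z : CC R) m : CC R :=
  - (((sf' m)%:C + z * (sf m)%:C) * cexp (- z * m%:C)).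

Lemma cdiff_sRK z : cdiff (sRK z).
Proof. by apply: cdiffM; [apply: cdiffR; exact: rdiff_sR|exact: cdiff_cexp_lin]. Qed.

Lemma sRK_integrable z : 0 <= cre z -> cintegrable mu `[0, +oo[ (sRK z).
Proof.
move=> z0; have [C C0 H] := spectral_bounds.
have [m1 m2] := cdiff_measurable `[0, +oo[%classic (cdiff_sRK z).
have iC : mu.-integrable `[0, +oo[ (EFin \o (fun m => C * pow32 m)).
  by apply: (integrableZl _ C (@integrable_pow32 R)); exact: measurable_itv.
apply: (cintegrable_le _ m1 m2 iC) => // m /in_set0y m0.
have [_ _ Hm] := H m m0.
rewrite /sRK [leLHS]cabsM cabsR cabs_cexp creM creN creR cimR mulr0 subr0 mulNr.
rewrite (le_trans _ Hm)// ler_piMr// -expR0 ler_expR oppr_le0 mulr_ge0//.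
Qed.

Lemma cder_sPhi z m : cder (sPhi z) m
  (((s ^+ 2)%:C + z ^+ 2) * evK w z s m - sRK z m).
Proof.
have dexp : cder (fun m : R => cexp (- z * m%:C)) m ((- z * 1) * cexp (- z * m%:C)).
  by apply: cderExp; apply: cderZ; apply: cderR; exact: dId.
have du := cderD (cderR (is_derive_sf' m)) (cderZ z (cderR (is_derive_sf m))).
have H := cderZ (-1) (cderM du dexp).
apply: (cderExt _ (cderEq H _)) => [t|]; first by rewrite mulN1r.
rewrite /sRK /evK -/(sN m) -/(sf m) realcB realcM.
by move: (cexp _) => e; ring.
Qed.

Lemma sPhi0 z : sPhi z 0 = - (z * (sf 0)%:C).
Proof. by rewrite /sPhi /sf' mulr0 mul0r mulr0 cexp0 mulr1 add0r. Qed.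

Lemma sPhi_bound : exists2 C : R, 0 <= C & forall z m, 0 <= cre z -> 0 <= m ->
  cabs (sPhi z m) <= C * (1 + cabs z) * (Num.sqrt (1 + m))^-1.
Proof.
have [C C0 H] := spectral_bounds; exists C => // z m z0 m0.
have [h1 h2 _] := H m m0.
rewrite /sPhi cabsN [leLHS]cabsM cabs_cexp creM creN creR cimR mulr0 subr0 mulNr.
apply: (@le_trans _ _ (cabs ((sf' m)%:C + z * (sf m)%:C))).
  by rewrite ler_piMr ?cabs_ge0// -expR0 ler_expR oppr_le0 mulr_ge0.
rewrite (le_trans (cabsD _ _))// [X in _ + X]cabsM !cabsR.
have -> : C * (1 + cabs z) * (Num.sqrt (1 + m))^-1 =
   C * (Num.sqrt (1 + m))^-1 + cabs z * (C * (Num.sqrt (1 + m))^-1) by ring.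
by rewrite lerD// ler_wpM2l// cabs_ge0.
Qed.

Lemma cdiff_spectral z : cdiff (fun m => ((s ^+ 2)%:C + z ^+ 2) * evK w z s m - sRK z m).
Proof.
rewrite (_ : (fun m => _) = (fun m => ((s ^+ 2)%:C + z ^+ 2) * evK w z s m + (-1) * sRK z m)).
  apply: cdiffD; apply: cdiffM.
  - by move=> t; exists 0; exact: cderCst.
  - exact: cdiff_evK.
  - by move=> t; exists 0; exact: cderCst.
  - exact: cdiff_sRK.
by apply/funext => m; rewrite mulN1r.
Qed.

Lemma spectral_finite z M : 0 <= M ->
  ((s ^+ 2)%:C + z ^+ 2) * cintegral mu `[0, M] (evK w z s) =
  cintegral mu `[0, M] (sRK z) + sPhi z M - sPhi z 0.
Proof.
move=> M0.
have [c1 c2] := cdiff_continuous (cdiff_spectral z).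
have := cintegral_FTC M0 c1 c2 (cder_sPhi z).
have i1 : cintegrable mu `[0, M] (evK w z s) by apply: cintegrable_itv; exact: cdiff_evK.
have i2 : cintegrable mu `[0, M] (sRK z) by apply: cintegrable_itv; exact: cdiff_sRK.
rewrite cintegralB//; last exact: cintegrableZl.
rewrite cintegralZl// => E.
by rewrite -addrA -E addrCA subrr addr0.
Qed.

Lemma spectral_infinite z : 0 < cre z ->
  ((s ^+ 2)%:C + z ^+ 2) * cintegral mu `[0, +oo[ (evK w z s) =
  cintegral mu `[0, +oo[ (sRK z) - sPhi z 0.
Proof.
move=> z0.
have i1 : cintegrable mu `[0, +oo[ (evK w z s) by exact: evK_integrable.
have i2 : cintegrable mu `[0, +oo[ (sRK z) by apply: sRK_integrable; exact: ltW.
have i1' : cintegrable mu `[0, +oo[ (fun m => ((s ^+ 2)%:C + z ^+ 2) * evK w z s m).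
  exact: cintegrableZl.
have [c1 c2] := cdiff_continuous (cdiff_spectral z).
have i3 : cintegrable mu `[0, +oo[ (fun m => ((s ^+ 2)%:C + z ^+ 2) * evK w z s m - sRK z m).
  have [x1 y1] := i1'; have [x2 y2] := i2; split.
    apply: (eq_integrable _ _ _ _ (integrableB _ x1 x2)) => // m _.
    by rewrite /= creD creN.
  apply: (eq_integrable _ _ _ _ (integrableB _ y1 y2)) => // m _.
  by rewrite /= cimD cimN.
have [C C0 HC] := sPhi_bound.
have lim0 : cabs (sPhi z n%:R) @[n --> \oo] --> 0.
  have K : (C * (1 + cabs z) * (Num.sqrt (1 + n%:R))^-1) @[n --> \oo] --> 0.
    rewrite -[X in _ --> X](mulr0 (C * (1 + cabs z))); apply: cvgM; first exact: cvg_cst.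
    apply: (@cvg_comp _ _ _ (fun n : nat => n%:R) (fun x : R => (Num.sqrt (1 + x))^-1)).
      exact: cvgr_idn.
    exact: inv_sqrt_cvg0.
  apply: (squeeze_cvgr _ (cvg_cst 0) K); apply: nearW => n.
  by rewrite cabs_ge0/= HC// ltW.
have := cintegral_FTC_y i3 c1 c2 (cder_sPhi z) lim0.
rewrite cintegralB// cintegralZl// => E'.
by rewrite -E' addrCA subrr addr0.
Qed.

Section limits.
Variable a : R.
Hypotheses (a0 : 0 < a) (sa : s != a).

Let z0 : CC R := 0 -i* a.
Let zn (n : nat) : CC R := (n.+1%:R^-1) -i* a.

(** The common value of the two limits: cutoff tending to infinity at z = -ia, and z = eps - ia with
    eps tending to 0. The denominator is s^2 - a^2. *)
Definition slim : CC R :=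
  ((s ^+ 2)%:C + z0 ^+ 2)^-1 * (cintegral mu `[0, +oo[ (sRK z0) - sPhi z0 0).

Let den_neq0 : ((s ^+ 2)%:C + z0 ^+ 2) != 0.
Proof.
apply: cre_neq0; rewrite creD creR expr2 creM /z0 /cre/cim/= mul0r sub0r mulrNN -expr2.
by rewrite subr_eq0 eqf_sqr negb_or sa/= gt_eqF// (lt_trans _ s0)// oppr_lt0.
Qed.

Lemma cvg_evK_segment (u : nat -> R) : u n @[n --> \oo] --> +oo ->
  (cintegral mu `[0, u n] (evK w z0 s) : CC R) @[n --> \oo] --> slim.
Proof.
move=> uy.
have cz : 0 <= cre z0 by rewrite /z0 /cre.
have [i1 i2] := sRK_integrable cz.
have sub n : `[0, u n] `<=` (`[0, +oo[%classic : set R).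
  by move=> x /=; rewrite !in_itv/= andbT => /andP[].
have nr (x : R) : (`[0, +oo[%classic : set R) x -> \forall n \near \oo, 0 <= x <= u n.
  move=> /in_set0y x0; move/cvgryPge : uy => /(_ x).
  by apply: filterS => n ->; rewrite x0.
have l1 : (cintegral mu `[0, u n] (sRK z0) : CC R) @[n --> \oo] --> cintegral mu `[0, +oo[ (sRK z0).
  apply: ccvg.
    exact: (@cvg_Rintegral_exhaust R _ (fun=> 0) u _ _ sub nr i1).
  exact: (@cvg_Rintegral_exhaust R _ (fun=> 0) u _ _ sub nr i2).
have [C C0 HC] := sPhi_bound.
have K : (C * (1 + cabs z0) * (Num.sqrt (1 + u n))^-1) @[n --> \oo] --> 0.
  rewrite -[X in _ --> X](mulr0 (C * (1 + cabs z0))); apply: cvgM; first exact: cvg_cst.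
  by apply: (@cvg_comp _ _ _ u (fun x : R => (Num.sqrt (1 + x))^-1) _ _ _ uy inv_sqrt_cvg0).
have upos : \forall n \near \oo, 0 <= u n by move/cvgryPge : uy => /(_ 0).
have l2 : (sPhi z0 (u n) : CC R) @[n --> \oo] --> (0 : CC R).
  apply: ccvg_near => e e0; move/cvgr0_norm_lt : K => /(_ e e0) K.
  near=> n; rewrite subr0; apply: (@le_lt_trans _ _ (C * (1 + cabs z0) * (Num.sqrt (1 + u n))^-1)).
    by apply: HC => //; near: n.
  by apply: (le_lt_trans (ler_norm _)); near: n.
rewrite /slim.
have l3 := @ccvg_affine _ _ _ _ ((s ^+ 2)%:C + z0 ^+ 2)^-1 (sPhi z0 0) _ _ _ l1 l2.
apply: cvg_trans (l3 eventually_filter); apply: near_eq_cvg; near=> n.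
by rewrite -spectral_finite ?mulKf//; near: n.
Unshelve. all: by end_near. Qed.

Lemma cvg_zn : (zn n : CC R) @[n --> \oo] --> z0.
Proof.
apply: ccvg; rewrite /zn /z0 /cre /cim/=; last exact: cvg_cst.
exact: cvg_harmonic.
Qed.

(** The majorant C (1 + m)^{-3/2} of the residual holds for all Re z >= 0, so dominated convergence
    applies up to the imaginary axis; the other terms are continuous in z. *)
Lemma cvg_evK_abel :
  (cintegral mu `[0, +oo[ (evK w (zn n) s) : CC R) @[n --> \oo] --> slim.
Proof.
have zp n : 0 < cre (zn n) by rewrite /zn /cre/= invr_gt0.
have [C C0 H] := spectral_bounds.
have iC : mu.-integrable `[0, +oo[ (EFin \o (fun m => C * pow32 m)).
  by apply: (integrableZl _ C (@integrable_pow32 R)); exact: measurable_itv.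
have B z m : 0 <= cre z -> (`[0, +oo[%classic : set R) m -> cabs (sRK z m) <= C * pow32 m.
  move=> z1 /in_set0y m0; have [_ _ Hm] := H m m0.
  rewrite /sRK [leLHS]cabsM cabsR cabs_cexp creM creN creR cimR mulr0 subr0 mulNr.
  by rewrite (le_trans _ Hm)// ler_piMr// -expR0 ler_expR oppr_le0 mulr_ge0// in_set0y.
have E z m : cre (sRK z m) = sR m * (expR (- (cre z * m)) * cos (cim z * m)) /\
             cim (sRK z m) = sR m * (expR (- (cre z * m)) * - sin (cim z * m)).
  rewrite /sRK creRM cimRM cre_cexp cim_cexp creM cimM creN cimN creR cimR.
  by rewrite !mulr0 subr0 add0r !mulNr cosN sinN.
have ex m : expR (- (cre (zn n) * m)) @[n --> \oo] --> expR (- (cre z0 * m)).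
  apply: (@cvg_comp _ _ _ (fun n => - (cre (zn n) * m)) expR _ (nbhs (- (cre z0 * m)))).
    apply: cvgN; apply: cvgM; last exact: cvg_cst.
    by rewrite /zn /z0 /cre/=; exact: cvg_harmonic.
  exact: continuous_expR.
have cE n : cim (zn n) = cim z0 by [].
have l1 : (cintegral mu `[0, +oo[ (sRK (zn n)) : CC R) @[n --> \oo] --> cintegral mu `[0, +oo[ (sRK z0).
  have cz : 0 <= cre z0 by rewrite /z0 /cre.
  apply: ccvg.
    apply: (@Rintegral_dominated _ _ mR mu _ (fun n m => cre (sRK (zn n) m))
      (fun m => cre (sRK z0 m)) _ _ _ _ _ iC) => //.
    - by move=> n; exact: (cdiff_measurable _ (cdiff_sRK (zn n))).1.
    - exact: (cdiff_measurable _ (cdiff_sRK z0)).1.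
    - move=> m _; under eq_fun do rewrite (E _ _).1 cE; rewrite (E _ _).1.
      by apply: cvgM; [exact: cvg_cst|apply: cvgM; [exact: ex|exact: cvg_cst]].
    - by move=> n m mI; rewrite (le_trans (cre_le_cabs _))// B// ltW.
  apply: (@Rintegral_dominated _ _ mR mu _ (fun n m => cim (sRK (zn n) m))
      (fun m => cim (sRK z0 m)) _ _ _ _ _ iC) => //.
  - by move=> n; exact: (cdiff_measurable _ (cdiff_sRK (zn n))).2.
  - exact: (cdiff_measurable _ (cdiff_sRK z0)).2.
  - move=> m _; under eq_fun do rewrite (E _ _).2 cE; rewrite (E _ _).2.
    by apply: cvgM; [exact: cvg_cst|apply: cvgM; [exact: ex|exact: cvg_cst]].
  - by move=> n m mI; rewrite (le_trans (cim_le_cabs _))// B// ltW.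
have ld : ((s ^+ 2)%:C + zn n ^+ 2 : CC R) @[n --> \oo] --> ((s ^+ 2)%:C + z0 ^+ 2 : CC R).
  apply: cvgD; first exact: cvg_cst.
  have -> : z0 ^+ 2 = z0 * z0 by rewrite expr2.
  rewrite (_ : (fun n => zn n ^+ 2) = (fun n => zn n * zn n)); last first.
    by apply/funext => n; rewrite expr2.
  by apply: cvgM; exact: cvg_zn.
have l3 : (((s ^+ 2)%:C + zn n ^+ 2)^-1 *
    (cintegral mu `[0, +oo[ (sRK (zn n)) - sPhi (zn n) 0) : CC R) @[n --> \oo] --> slim.
  apply: cvgM.
    exact: (@cvgV _ _ _ _ (fun n => (s ^+ 2)%:C + zn n ^+ 2 : CC R)).
  apply: ccvgB; first exact: l1.
  rewrite sPhi0 (_ : (fun n => sPhi (zn n) 0) = (fun n => - (zn n * (sf 0)%:C))); last first.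
    by apply/funext => n; rewrite sPhi0.
  by apply: cvgN; apply: cvgM; [exact: cvg_zn|exact: cvg_cst].
apply: cvg_trans l3; apply: near_eq_cvg; apply: nearW => n.
(* The imaginary part of the denominator is -2 a / (n + 1), hence nonzero. *)
rewrite -spectral_infinite// mulKf//; apply/eqP => D0.
have : cim ((s ^+ 2)%:C + zn n ^+ 2) = 0 by rewrite D0.
rewrite cimD cimR add0r expr2 cimM /zn /cre /cim/= => /eqP.
rewrite [- a / _]mulrC -mulr2n mulrn_eq0/= mulf_eq0 oppr_eq0.
by rewrite invr_eq0 pnatr_eq0 (gt_eqF a0).
Qed.

End limits.
End spectral.

(** * Spectral decomposition of the jump *)

Section indicator_integrals.
Context {R : realType}.
Notation mu := (@lebesgue_measure R).
Notation mR := (measurableTypeR R).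

Section general.
Context d (T : measurableType d) (nu : {measure set T -> \bar R}).

Lemma Rintegral_indic_setI (D E : set T) (f : T -> R) :
  Rintegral nu D (fun x => \1_E x * f x) = Rintegral nu (D `&` E) f.
Proof.
rewrite Rintegral_mkcondr; apply: eq_Rintegral => x _.
by rewrite patchE indicE; case: ifP => _; rewrite ?mul1r ?mul0r.
Qed.

Lemma integrable_indic_setI (D E : set T) (f : T -> R) : measurable D -> measurable E ->
  nu.-integrable (D `&` E) (EFin \o f) ->
  nu.-integrable D (EFin \o (fun x => \1_E x * f x)).
Proof.
move=> mD mE; rewrite integrable_mkcond; last exact: measurableI.
move=> H; apply/(integrable_mkcond _ mD); move: H; congr (_.-integrable _ _).
apply/funext => x; rewrite !patchE in_setI /= indicE.
by case: (x \in D); case: (x \in E); rewrite //= ?mul1r ?mul0r.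
Qed.

Lemma cintegral_indic_setI (D E : set T) (f : T -> CC R) :
  cintegral nu D (fun x => (\1_E x)%:C * f x) = cintegral nu (D `&` E) f.
Proof.
rewrite /cintegral -!Rintegral_indic_setI; congr (_ +i* _); apply: eq_Rintegral => x _.
  by rewrite creRM.
by rewrite cimRM.
Qed.

Lemma cintegrable_indic_setI (D E : set T) (f : T -> CC R) : measurable D -> measurable E ->
  cintegrable nu (D `&` E) f -> cintegrable nu D (fun x => (\1_E x)%:C * f x).
Proof.
move=> mD mE [f1 f2]; split.
  apply: (eq_integrable _ _ _ _ (integrable_indic_setI mD mE f1)) => // x _.
  by rewrite creRM.
apply: (eq_integrable _ _ _ _ (integrable_indic_setI mD mE f2)) => // x _.
by rewrite cimRM.
Qed.

Lemma cintegrable_indic_setIE (D E : set T) (f : T -> CC R) : measurable D -> measurable E ->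
  cintegrable nu D (fun x => (\1_E x)%:C * f x) -> cintegrable nu (D `&` E) f.
Proof.
move=> mD mE H; have mDE := measurableI _ _ mD mE.
apply: ceq_integrable (cintegrableS mD mDE (@subIsetl _ D E) H) => // x [_ Ex].
by rewrite indicE mem_set// mul1r.
Qed.

Lemma cintegralR (D : set T) (g : T -> R) :
  cintegral nu D (fun x => (g x)%:C) = (Rintegral nu D g)%:C.
Proof.
apply: cP; rewrite /cintegral ?creR ?cimR//= /Rintegral.
by rewrite /cim/= integral0.
Qed.

End general.

Lemma itv0y_ray (M : R) : `]0, +oo[ `&` `]-oo, M] = (`]0, M]%classic : set R).
Proof.
apply/seteqP; split=> x /=; rewrite !in_itv/= andbT; first by move=> [-> ->].
by move=> /andP[-> ->].
Qed.

Lemma itvwy_ray (w M : R) : `]w, +oo[ `&` `]-oo, M] = (`]w, M]%classic : set R).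
Proof.
apply/seteqP; split=> x /=; rewrite !in_itv/= andbT; first by move=> [-> ->].
by move=> /andP[-> ->].
Qed.

Lemma itv0y_oray (M : R) : `]0, +oo[ `&` `]-oo, M[ = (`]0, M[%classic : set R).
Proof.
apply/seteqP; split=> x /=; rewrite !in_itv/= andbT; first by move=> [-> ->].
by move=> /andP[-> ->].
Qed.

Lemma cintegral_oc_cc (f : R -> CC R) (b : R) : cmeas [set: mR] f ->
  cintegrable mu `]0, b] f ->
  cintegrable mu `[0, b] f /\ cintegral mu `]0, b] f = cintegral mu `[0, b] f.
Proof.
move=> [m1 m2] [i1 i2].
have I (h : R -> R) : measurable_fun [set: mR] h -> mu.-integrable `]0, b] (EFin \o h) ->
    mu.-integrable `[0, b] (EFin \o h).
  move=> mh /integrableP[_ ih].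
  apply/integrableP; split; first by apply: measurable_funTS; exact/measurable_EFinP.
  move: ih; rewrite integral_itv_obnd_cbnd//.
  by apply: measurable_funTS; apply: measurableT_comp => //; exact/measurable_EFinP.
split; first by split; exact: I.
by rewrite /cintegral !Rintegral_itv_obnd_cbnd.
Qed.

End indicator_integrals.

(** * The spectral integral evaluated by the jump *)

Section spectral_value.
Context {R : realType}.
Notation mu := (@lebesgue_measure R).
Notation mR := (measurableTypeR R).
Variables (a w : R) (rho : R * R).
Hypotheses (a0 : 0 < a) (w0 : 0 < w) (r0 : 0 < norm2 rho) (ra : norm2 rho != a).
Local Notation s := (norm2 rho).

Lemma weyl_beam (sigma : R * R) (zeta : CC R) : 0 < cre zeta -> cim zeta != 0 ->
  (4 * pi)%:C * beamB w sigma zeta =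
  Ci * cintegral mu `[0, w] (prK w zeta (norm2 sigma)) +
  cintegral mu `[0, +oo[ (evK w zeta (norm2 sigma)).
Proof.
move=> z0 y0; have W := weyl_identity (norm2 sigma) w0 z0 y0.
have p0 : ((4 * pi)%:C : CC R) != 0 by rewrite realc_eq0 mulf_neq0// gt_eqF// pi_gt0.
rewrite /beamB /rtilde invfM [X in _ * X = _]mulrCA mulVKf//.
Qed.

Definition jumpR : R :=
  heaviside (a - s) / (2 * pi * Num.sqrt (a ^+ 2 - s ^+ 2)) *
  cosh (w * Num.sqrt (a ^+ 2 - s ^+ 2)).

Lemma jumpJE : jumpJ rho a w = Ci * jumpR%:C.
Proof. by rewrite /jumpJ /jumpR [(_ * cosh _)%:C]realcM mulrA. Qed.

(** Limit of the real part of the propagating integral as zeta tends to i sg, where e^{i zeta m}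
    becomes e^{- sg m}. *)
Definition pexp (sg : R) : R := Rintegral mu `[0, w]
  (fun m => besj ((w ^+ 2 - m ^+ 2) * s ^+ 2) * expR (- sg * m)).

Lemma besj_prop_le1 m : 0 <= m <= w -> `|besj ((w ^+ 2 - m ^+ 2) * s ^+ 2)| <= 1.
Proof.
move=> /andP[m0 mw]; rewrite besj_le1// mulr_ge0 ?sqr_ge0// subr_ge0.
by rewrite lerXn2r ?nnegrE// ltW.
Qed.

Lemma rdiff_besj_prop : rdiff (fun m => besj ((w ^+ 2 - m ^+ 2) * s ^+ 2)).
Proof.
apply: (rdiff_comp (f := @besj R)); first exact: rdiff_besj.
apply: rdiffM; last exact: rdiffC.
by move=> t; exists (0 - 2%:R * t ^+ 1 * 1); exact: (dB (dCst _ _) (dX 2 (dId t))).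
Qed.

Lemma rdiff_pexp (sg : R) :
  rdiff (fun m => besj ((w ^+ 2 - m ^+ 2) * s ^+ 2) * expR (- sg * m)).
Proof.
apply: rdiffM; first exact: rdiff_besj_prop.
by move=> t; eexists; exact: (dExp (dZ (- sg) (dId t))).
Qed.

Lemma cvg_prK (sg : R) :
  cre (cintegral mu `[0, w] (prK w (n.+1%:R^-1 +i* sg) s)) @[n --> \oo] --> pexp sg.
Proof.
have E n m : cre (prK w (n.+1%:R^-1 +i* sg) s m) =
    besj ((w ^+ 2 - m ^+ 2) * s ^+ 2) * (expR (- sg * m) * cos (n.+1%:R^-1 * m)).
  rewrite /prK creRM cre_cexp; congr (_ * (expR _ * cos _)).
    by rewrite !creM cimM creR cimR creI cimI /cre/cim/=; ring.
  by rewrite !cimM creM creR cimR creI cimI /cre/cim/=; ring.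
pose B : R := expR (`|sg| * w).
have iB : mu.-integrable `[0, w] (EFin \o (fun=> B)).
  by apply: continuous_integrable_itv => x; exact: cvg_cst.
apply: (@Rintegral_dominated _ _ mR mu _
  (fun n m => cre (prK w (n.+1%:R^-1 +i* sg) s m)) _ _ _ _ _ _ iB) => //.
- by move=> n; exact: (cdiff_measurable _ (cdiff_prK w _ s)).1.
- apply: measurable_funTS; apply: continuous_measurable_fun.
  exact: rdiff_continuous (rdiff_pexp sg).
- move=> m _; under eq_fun do rewrite E.
  apply: cvgM; first exact: cvg_cst.
  rewrite -[X in _ --> X]mulr1; apply: cvgM; first exact: cvg_cst.
  rewrite -[X in _ --> X]cos0; apply: (@cvg_comp _ _ _ (fun n : nat => n.+1%:R^-1 * m) cos _ (nbhs (0 : R))).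
    have h : n.+1%:R^-1 * m @[n --> \oo] --> (0 * m : R).
      by apply: cvgM; [exact: cvg_harmonic|exact: cvg_cst].
    by rewrite mul0r in h.
  exact: continuous_cos.
- move=> n m /in_set0b mI; rewrite E normrM -[B]mul1r; apply: ler_pM => //.
    exact: besj_prop_le1.
  rewrite normrM ger0_norm ?expR_ge0// -[leRHS]mulr1; apply: ler_pM; rewrite ?expR_ge0//.
    rewrite ler_expR (le_trans (ler_norm _))// normrM normrN.
    by case/andP: mI => m0 mw; rewrite ler_wpM2l// ger0_norm.
  by rewrite ler_norml cos_geN1 cos_le1.
Qed.

Lemma cim_evK (zeta : CC R) m : cim (evK w zeta s m) =
  besj ((w ^+ 2 + m ^+ 2) * s ^+ 2) * (expR (- (cre zeta * m)) * - sin (cim zeta * m)).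
Proof.
rewrite /evK cimRM cim_cexp creM cimM creN cimN creR cimR.
by rewrite !mulr0 subr0 add0r !mulNr sinN.
Qed.

Lemma cim_evK_conj n :
  cim (cintegral mu `[0, +oo[ (evK w (n.+1%:R^-1 +i* a) s)) =
  - cim (cintegral mu `[0, +oo[ (evK w (n.+1%:R^-1 -i* a) s)).
Proof.
have z0 : 0 < cre (n.+1%:R^-1 -i* a : CC R) by rewrite /cre/= invr_gt0.
have [_ i2] := evK_integrable w z0 s.
rewrite -mulN1r /cintegral !cimE -RintegralZl//.
apply: eq_Rintegral => m _.
by rewrite !cim_evK /cre/cim/= [- a * m]mulNr sinN; ring.
Qed.

(** The limit of Im (4 pi (B(e - ia) - B(-e - ia))) is computed twice, by Weyl's identity and by the
    jump formula. The evanescent integrals at e - ia and e + ia have opposite imaginary parts, hence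
    the factor 2. *)
Lemma spectral_value : pexp (- a) - pexp a + 2 * cim (slim w s a) = 4 * pi * jumpR.
Proof.
pose D (n : nat) := cim ((4 * pi)%:C *
  (beamB w rho (n.+1%:R^-1 -i* a) - beamB w rho ((- n.+1%:R^-1) -i* a))).
have DE n : D n = cre (cintegral mu `[0, w] (prK w (n.+1%:R^-1 +i* (- a)) s)) -
    cre (cintegral mu `[0, w] (prK w (n.+1%:R^-1 +i* a) s)) +
    2 * cim (cintegral mu `[0, +oo[ (evK w (n.+1%:R^-1 -i* a) s)).
  have e0 : 0 < n.+1%:R^-1 :> R by rewrite invr_gt0.
  rewrite /D.
  (* The reflection z -> -z brings the point below the disc into Re zeta > 0, where Weyl's identity
     applies. *)
  have -> : beamB w rho ((- n.+1%:R^-1) -i* a) = beamB w (opp2 rho) (n.+1%:R^-1 +i* a).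
    rewrite -[in LHS]beamB_opp; congr beamB.
    by apply: cP; rewrite ?creN ?cimN /cre/cim/= opprK.
  rewrite mulrBr !weyl_beam ?norm2_opp2; try by rewrite /cre.
  - rewrite cimD cimN cimD [X in _ - X]cimD cim_evK_conj !cimM !creI !cimI !mul0r !mul1r !add0r.
    by ring.
  - by rewrite /cim/= gt_eqF.
  - by rewrite /cim/= oppr_eq0 gt_eqF.
have l1 : D n @[n --> \oo] --> pexp (- a) - pexp a + 2 * cim (slim w s a).
  under eq_fun do rewrite DE.
  apply: cvgD; first by apply: cvgB; exact: cvg_prK.
  apply: cvgM; first exact: cvg_cst.
  exact: (cvg_cim (cvg_evK_abel w0 r0 a0 ra)).
have l2 : D n @[n --> \oo] --> 4 * pi * jumpR.
  have J : cim (beamB w rho (e -i* a) - beamB w rho ((- e) -i* a)) @[e --> (0 : R)^'+] -->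
      cim (jumpJ rho a w).
    by apply: cvg_cim; exact: beam_jump.
  have E : cim (jumpJ rho a w) = jumpR by rewrite jumpJE cimMR cimI mul1r.
  rewrite E in J; move/cvg_at_rightP : J => J.
  under eq_fun do rewrite /D cimRM.
  apply: cvgM; first exact: cvg_cst.
  apply: (J (fun n => n.+1%:R^-1)); split; first by move=> n; rewrite invr_gt0.
  exact: cvg_harmonic.
exact: cvg_unique l1 l2.
Qed.

Definition psinh : R := Rintegral mu `[0, w]
  (fun m => besj ((w ^+ 2 - m ^+ 2) * s ^+ 2) * ((expR (a * m) - expR (- (a * m))) / 2)).

Lemma psinhE : psinh = (pexp (- a) - pexp a) / 2.
Proof.
have i (sg : R) : mu.-integrable `[0, w]
    (EFin \o (fun m => besj ((w ^+ 2 - m ^+ 2) * s ^+ 2) * expR (- sg * m))).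
  by apply: continuous_integrable_itv; exact: rdiff_continuous (rdiff_pexp sg).
rewrite /pexp -RintegralB// mulrC -RintegralZl//; last first.
  by apply: (eq_integrable _ _ _ _ (integrableB _ (i (- a)) (i a))) => // m _.
apply: eq_Rintegral => m _; rewrite opprK mulNr.
by move: (besj _) (expR _) (expR _) => j x y; field.
Qed.

(** The Abel limit has fixed the imaginary part of [slim] through the jump; the truncated limit
    shows that a sharp cutoff gives the same value. *)
Lemma cvg_spectral :
  psinh + Rintegral mu `[0, M] (fun m => besj ((w ^+ 2 + m ^+ 2) * s ^+ 2) * sin (a * m))
    @[M --> +oo] --> 2 * pi * jumpR.
Proof.
have -> : 2 * pi * jumpR = psinh + cim (slim w s a).
  rewrite psinhE; have := spectral_value.
  by move: (pexp _) (pexp _) (cim _) (@pi R) jumpR => x y z p j; lra.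
apply: cvgD; first exact: cvg_cst.
apply/cvg_pinftyP => u uy.
have C : cim (cintegral mu `[0, u n] (evK w (0 -i* a) s)) @[n --> \oo] --> cim (slim w s a).
  by apply: cvg_cim; exact: cvg_evK_segment.
apply: cvg_trans C; apply: near_eq_cvg; apply: nearW => n.
rewrite /cintegral cimE; apply: eq_Rintegral => m _.
by rewrite cim_evK /cre/cim/= mul0r oppr0 expR0 mul1r mulNr sinN opprK.
Qed.

End spectral_value.

(** * Truncated spectral integrals on the half-line and in the plane *)

Section jump_kernel.
Context {R : realType}.
Notation mu := (@lebesgue_measure R).
Notation mR := (measurableTypeR R).

Lemma cexp_real (x : R) : cexp (x%:C : CC R) = (expR x)%:C.
Proof.
by apply: cP; rewrite ?cre_cexp ?cim_cexp creR cimR ?cos0 ?sin0 ?mulr1 ?mulr0 ?creR ?cimR.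
Qed.

Let two_neq0 : (2 : CC R) != 0.
Proof. by rewrite -realcn realc_eq0 pnatr_eq0. Qed.

Lemma csin_real (x : R) : csin (x%:C : CC R) = (sin x)%:C.
Proof.
have n2 : 2 * Ci != 0 :> CC R by rewrite mulf_neq0// Ci_neq0.
apply: (mulIf n2); rewrite divfK// -realcn.
have E (y : R) : cre (cexp (Ci * y%:C) : CC R) = cos y /\ cim (cexp (Ci * y%:C) : CC R) = sin y.
  by rewrite cre_cexp cim_cexp creM cimM creR cimR creI cimI !(mul0r, mulr0, subr0, add0r, mul1r, expR0, oppr0, addr0).
have -> : - (Ci * x%:C) = Ci * (- x)%:C :> CC R by rewrite realcN mulrN.
apply: cP.
  rewrite creD creN !(E _).1 cosN subrr creRM creRM creI; ring.
by rewrite cimD cimN !(E _).2 sinN cimRM cimRM cimI; ring.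
Qed.

(** For mu = -iq the quotient sin (mu a) / mu is sinh (a q) / q, so the kernel is real below the
    frequency as well as above it. *)
Lemma csin_imag (q a : R) : 0 < q ->
  csin (- (Ci * q%:C) * a%:C) / (- (Ci * q%:C)) =
  ((expR (a * q) - expR (- (a * q))) / 2 / q)%:C :> CC R.
Proof.
move=> q0.
have nq : - (Ci * q%:C) != 0 :> CC R.
  by rewrite oppr_eq0 mulf_neq0 ?Ci_neq0// realc_eq0 gt_eqF.
have n2 : 2 * Ci != 0 :> CC R by rewrite mulf_neq0// Ci_neq0.
have ZE : Ci * (- (Ci * q%:C) * a%:C) = (a * q)%:C :> CC R.
  rewrite (_ : Ci * (- (Ci * q%:C) * a%:C) = - (Ci * Ci) * (a%:C * q%:C)); last by ring.
  by rewrite CiCi opprK mul1r -realcM.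
rewrite /csin ZE -realcN !cexp_real.
apply: (mulIf nq); rewrite [LHS]divfK//; apply: (mulIf n2); rewrite [LHS]divfK//.
move: (expR (a * q)) (expR (- (a * q))) => E F; rewrite -realcB.
rewrite (_ : _ * - (Ci * q%:C) * (2 * Ci) = ((E - F) / 2 / q)%:C * q%:C * 2 * (- (Ci * Ci))); last by ring.
rewrite CiCi opprK mulr1 -realcn -!realcM; congr (_%:C).
by field; rewrite gt_eqF.
Qed.

Definition jkap (a w r : R) : CC R := csin (nuf w r * a%:C) / nuf w r.

Definition J1n (a w s r : R) : CC R :=
  (r / (2 * pi))%:C * (besselJ0 (r * s))%:C * jkap a w r.

Lemma cmeas_jkap a w : cmeas [set: mR] (jkap a w).
Proof.
have mn := cmeas_nuf w.
have mz : cmeas [set: mR] (fun r : mR => Ci * (nuf w r * a%:C)).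
  by apply: cmeasM; [exact: cmeasC|apply: cmeasM => //; exact: cmeasC].
apply: cmeasM; last exact: cmeasV.
apply: cmeasM; last exact: cmeasC.
apply: cmeasD; first exact: cmeasExp.
by apply: cmeasN; apply: cmeasExp; exact: cmeasN.
Qed.

Lemma cmeas_J1n a w s : cmeas [set: mR] (J1n a w s).
Proof.
apply: cmeasM; last exact: cmeas_jkap.
apply: cmeasM; apply: cmeasR.
  by apply: measurable_funM => //; exact: measurable_cst.
rewrite (_ : (fun r : mR => _) = (fun r => besj ((r * s) ^+ 2))); last first.
  by apply/funext => r; rewrite besselJ0E.
apply: continuous_measurable_fun; apply: rdiff_continuous.
apply: (rdiff_comp (f := @besj R)); first exact: rdiff_besj.
by apply: rdiffX; apply: rdiffM; [exact: rdiffId|exact: rdiffC].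
Qed.

Section radial.
Variables (a w : R) (rho : R * R).
Hypotheses (w0 : 0 < w).
Local Notation s := (norm2 rho).

Definition jprop (m : R) : R := (2 * pi)^-1 *
  (besj ((w ^+ 2 - m ^+ 2) * s ^+ 2) * ((expR (a * m) - expR (- (a * m))) / 2)).
Definition jevan (m : R) : R := (2 * pi)^-1 *
  (besj ((w ^+ 2 + m ^+ 2) * s ^+ 2) * sin (a * m)).

Lemma rdiff_psinh : rdiff (fun m =>
  besj ((w ^+ 2 - m ^+ 2) * s ^+ 2) * ((expR (a * m) - expR (- (a * m))) / 2)).
Proof.
apply: rdiffM; first exact: rdiff_besj_prop.
move=> t; eexists.
exact: (dM (dB (dExp (dZ a (dId t))) (dExp (dN (dZ a (dId t))))) (dCst 2^-1 t)).
Qed.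

Lemma rdiff_pevan : rdiff (fun m => besj ((w ^+ 2 + m ^+ 2) * s ^+ 2) * sin (a * m)).
Proof.
apply: rdiffM.
  apply: (rdiff_comp (f := @besj R)); first exact: rdiff_besj.
  apply: rdiffM; last exact: rdiffC.
  by apply: rdiffD; [exact: rdiffC|apply: rdiffX; exact: rdiffId].
by move=> t; eexists; exact: (dSin (dZ a (dId t))).
Qed.

Lemma cdiff_jprop : cdiff (fun m => (jprop m)%:C).
Proof. by apply: cdiffR; apply: rdiffM; [exact: rdiffC|exact: rdiff_psinh]. Qed.

Lemma cdiff_jevan : cdiff (fun m => (jevan m)%:C).
Proof. by apply: cdiffR; apply: rdiffM; [exact: rdiffC|exact: rdiff_pevan]. Qed.

Lemma J1n_propE r : (`]0, w[%classic : set R) r ->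
  (r / Num.sqrt (w ^+ 2 - r ^+ 2))%:C * (jprop (Num.sqrt (w ^+ 2 - r ^+ 2)))%:C = J1n a w s r.
Proof.
rewrite /= in_itv/= => /andP[r0 rw]; have [nE q0] := nuf_prop w0 r0 rw.
rewrite /J1n /jkap nE csin_imag// /jprop besselJ0E.
rewrite sqr_sqrtr; last by rewrite subr_ge0 lerXn2r ?nnegrE ?ltW.
rewrite (_ : w ^+ 2 - (w ^+ 2 - r ^+ 2) = r ^+ 2); last by ring.
rewrite -exprMn; move: (Num.sqrt _) q0 => q q0.
rewrite -!realcM; congr (_%:C).
move: (expR _) (expR _) (besj _) (@pi_gt0 R) => E F B.
by move: (@pi R) => p p0; field; rewrite !gt_eqF.
Qed.

Lemma J1n_evanE r : (`]w, +oo[%classic : set R) r ->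
  (r / Num.sqrt (r ^+ 2 - w ^+ 2))%:C * (jevan (Num.sqrt (r ^+ 2 - w ^+ 2)))%:C = J1n a w s r.
Proof.
rewrite /= in_itv/= andbT => rw; have [nE q0] := nuf_evan w0 rw.
rewrite /J1n /jkap nE -(realcM _ a) csin_real /jevan besselJ0E.
rewrite sqr_sqrtr; last by rewrite subr_ge0 lerXn2r ?nnegrE ?ltW// (lt_trans w0).
rewrite (_ : w ^+ 2 + (r ^+ 2 - w ^+ 2) = r ^+ 2); last by ring.
rewrite -exprMn (mulrC a); move: (Num.sqrt _) q0 => q q0.
rewrite -realcV -!realcM; congr (_%:C).
move: (sin _) (besj _) (@pi_gt0 R) => E B.
by move: (@pi R) => p p0; field; rewrite !gt_eqF.
Qed.

Lemma J1n_prop : cintegrable mu `]0, w[ (J1n a w s) /\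
  cintegral mu `]0, w[ (J1n a w s) = ((2 * pi)^-1 * psinh a w rho)%:C.
Proof.
have mK : cmeas [set: mR] (fun m => (jprop m)%:C) by exact: cdiff_cmeas cdiff_jprop.
have iC : cintegrable mu `[0, w] (fun m => (jprop m)%:C) by exact: cintegrable_itv cdiff_jprop.
have iK : cintegrable mu `]0, w[ (fun m => (jprop m)%:C).
  by apply: cintegrableS iC => //; exact: subset_itv_oo_cc.
have [j e] := cintegral_prop w0 mK iK.
split; first by apply: ceq_integrable j => //; exact: J1n_propE.
apply: etrans (etrans _ e) _; first by apply: ceq_integral => r rI; rewrite J1n_propE.
rewrite cintegral_oo_cc// cintegralR; congr (_%:C).
rewrite /psinh -RintegralZl//.
by apply: continuous_integrable_itv; exact: rdiff_continuous rdiff_psinh.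
Qed.

(** The substitution is available on the full half-line only, so the cutoff is carried by an
    indicator: r <= T corresponds to m <= sqrt (T^2 - w^2). *)
Lemma J1n_evan T : w < T -> cintegrable mu `]w, T] (J1n a w s) /\
  cintegral mu `]w, T] (J1n a w s) =
  ((2 * pi)^-1 * Rintegral mu `[0, Num.sqrt (T ^+ 2 - w ^+ 2)]
     (fun m => besj ((w ^+ 2 + m ^+ 2) * s ^+ 2) * sin (a * m)))%:C.
Proof.
move=> wT; set M := Num.sqrt _.
pose G m : CC R := (\1_(`]-oo, M]%classic : set R) m)%:C * (jevan m)%:C.
have mJ : cmeas [set: mR] (fun m => (jevan m)%:C) by exact: cdiff_cmeas cdiff_jevan.
have mG : cmeas [set: mR] G.
  by apply: cmeasM => //; apply: cmeasR; exact: measurable_indic.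
have iC : cintegrable mu `[0, M] (fun m => (jevan m)%:C) by exact: cintegrable_itv cdiff_jevan.
have iO : cintegrable mu `]0, M] (fun m => (jevan m)%:C).
  by apply: cintegrableS iC => //; exact: subset_itv_oc_cc.
have iG : cintegrable mu `]0, +oo[ G.
  by apply: cintegrable_indic_setI => //; rewrite itv0y_ray.
have [j e] := cintegral_evan w0 mG iG.
have E r : (`]w, +oo[%classic : set R) r ->
    (r / Num.sqrt (r ^+ 2 - w ^+ 2))%:C * G (Num.sqrt (r ^+ 2 - w ^+ 2)) =
    (\1_(`]-oo, T]%classic : set R) r)%:C * J1n a w s r.
  move=> rI; rewrite -J1n_evanE// /G mulrCA; congr (_%:C * _).
  move: rI; rewrite /= in_itv/= andbT => wr.
  have r1 : 0 <= r by rewrite (le_trans (ltW w0))// ltW.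
  have T1 : 0 <= T by rewrite (le_trans (ltW w0))// ltW.
  have key : (Num.sqrt (r ^+ 2 - w ^+ 2) <= M) = (r <= T).
    rewrite /M ler_sqrt; last by rewrite subr_ge0 lerXn2r ?nnegrE// ltW.
    by rewrite lerD2r ler_sqr ?nnegrE.
  rewrite !indicE; congr (_%:R); congr nat_of_bool.
  by apply/idP/idP; rewrite !inE/= !in_itv/= key.
have jT : cintegrable mu `]w, +oo[ (fun r => (\1_(`]-oo, T]%classic : set R) r)%:C * J1n a w s r).
  exact: ceq_integrable j.
split.
  by rewrite -itvwy_ray; exact: cintegrable_indic_setIE.
rewrite -itvwy_ray -cintegral_indic_setI.
apply: etrans (etrans _ e) _; first by apply: ceq_integral => r rI; rewrite E.
rewrite cintegral_indic_setI itv0y_ray (cintegral_oc_cc mJ iO).2 cintegralR; congr (_%:C).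
rewrite -RintegralZl//.
by apply: continuous_integrable_itv; exact: rdiff_continuous rdiff_pevan.
Qed.

Lemma J1n_large T : w < T -> cintegrable mu `[0, T] (J1n a w s) /\
  cintegral mu `[0, T] (J1n a w s) =
  ((2 * pi)^-1 * (psinh a w rho + Rintegral mu `[0, Num.sqrt (T ^+ 2 - w ^+ 2)]
     (fun m => besj ((w ^+ 2 + m ^+ 2) * s ^+ 2) * sin (a * m))))%:C.
Proof.
move=> wT; have [i1 e1] := J1n_prop; have [i2 e2] := J1n_evan wT.
have wT' : (BRight w <= BRight T)%O by rewrite bnd_simp ltW.
have [i3 e3] := cintegrable_split w0 wT' (cmeas_J1n a w s) i1 i2.
have [i4 e4] := cintegral_oc_cc (cmeas_J1n a w s) i3.
by split => //; rewrite -e4 e3 e1 e2 -realcD -mulrDr.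
Qed.

Lemma J1n_integrable T : 0 < T -> cintegrable mu `[0, T] (J1n a w s).
Proof.
(* T may lie below w; integrability is inherited from the longer interval ending at T + w. *)
move=> T0; have wT : w < T + w by rewrite ltrDr.
apply: cintegrableS (J1n_large wT).1 => //; apply: subset_itvl.
by rewrite bnd_simp lerDl ltW.
Qed.

Lemma cvg_J1n : 0 < a -> 0 < s -> s != a ->
  (Ci * cintegral mu `[0, T] (J1n a w s) : CC R) @[T --> +oo] --> jumpJ rho a w.
Proof.
move=> a0 s0 sa.
pose I (M : R) := psinh a w rho + Rintegral mu `[0, M]
  (fun m => besj ((w ^+ 2 + m ^+ 2) * s ^+ 2) * sin (a * m)).
have IE : I M @[M --> +oo] --> 2 * pi * jumpR a w rho by exact: cvg_spectral.
have sy : Num.sqrt (T ^+ 2 - w ^+ 2) @[T --> +oo] --> +oo.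
  apply/cvgryPge => A; near=> T.
  have TA : `|A| + w <= T by near: T; apply: nbhs_pinfty_ge; exact: num_real.
  rewrite (le_trans (ler_norm A))// -[leLHS]ger0_norm// -sqrtr_sqr ler_wsqrtr//.
  rewrite lerBrDr (@le_trans _ _ ((`|A| + w) ^+ 2))//.
    by have := mulr_ge0 (normr_ge0 A) (ltW w0); rewrite sqrrD; move: (`|A|) => v; lra.
  have v0 : 0 <= `|A| + w by rewrite addr_ge0// ltW.
  by rewrite lerXn2r ?nnegrE// (le_trans v0).
have L : (2 * pi)^-1 * I (Num.sqrt (T ^+ 2 - w ^+ 2)) @[T --> +oo] --> jumpR a w rho.
  have -> : jumpR a w rho = (2 * pi)^-1 * (2 * pi * jumpR a w rho).
    by rewrite mulKf// mulf_neq0// gt_eqF// pi_gt0.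
  apply: cvgM; first exact: cvg_cst.
  exact: (cvg_comp _ _ sy IE).
have C : (Ci * ((2 * pi)^-1 * I (Num.sqrt (T ^+ 2 - w ^+ 2)))%:C : CC R) @[T --> +oo] -->
    jumpJ rho a w.
  rewrite jumpJE; apply: ccvg.
    under eq_fun do rewrite creMR creI mul0r; rewrite creMR creI mul0r; exact: cvg_cst.
  by under eq_fun do rewrite cimMR cimI mul1r; rewrite cimMR cimI mul1r.
apply: cvg_trans C; apply: near_eq_cvg; near=> T.
have wT : w < T by near: T; apply: nbhs_pinfty_gt; exact: num_real.
by rewrite (J1n_large wT).2.
Unshelve. all: by end_near. Qed.

End radial.

Section planar.
Variables (a w : R) (rho : R * R).
Hypothesis (w0 : w != 0).
Local Notation s := (norm2 rho).
Let W0 : 0 < `|w|. Proof. by rewrite normr_gt0. Qed.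

(** The radial formulas hold for positive frequency; kernel and jump are even in w, which reduces w
    < 0 to |w|. *)
Lemma nuf_norm r : nuf `|w| r = nuf w r.
Proof. by rewrite /nuf real_normK ?num_real. Qed.

Lemma jumpJ_norm : jumpJ rho a `|w| = jumpJ rho a w.
Proof.
rewrite /jumpJ; congr (_ * (_%:C)); rewrite /cosh.
have [//|wn] := leP 0 w; first by move=> w1; rewrite ger0_norm.
by rewrite ltr0_norm// mulNr opprK addrC.
Qed.

Lemma J1_integrandE h : 0 <= h -> J1n a `|w| s h = J1_integrand rho a w h.
Proof. by move=> h0; rewrite /J1n /J1_integrand /jkap nuf_norm mufE. Qed.

Lemma J1_integrable T : 0 < T -> cintegrable mu `[0, T] (J1_integrand rho a w).
Proof.
move=> T0; apply: ceq_integrable (J1n_integrable a rho W0 T0) => // h /in_set0b/andP[h0 _].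
exact: J1_integrandE.
Qed.

Lemma J1_integralE T : cintegral mu `[0, T] (J1_integrand rho a w) =
  cintegral mu `[0, T] (J1n a `|w| s).
Proof.
by apply: ceq_integral => h /in_set0b/andP[h0 _]; rewrite J1_integrandE.
Qed.

(** The planar integrand is of size |sin (a m)| / m at infinity and not absolutely integrable, so
    the integral over R^2 is a limit over discs. On a disc the indicator is radial and [chankel]
    applies. *)
Definition jdisc (T : R) : set (R * R) := [set h | norm2 h < T].

Lemma measurable_jdisc T : measurable (jdisc T : set (mR * mR)).
Proof.
rewrite -[jdisc T]setTI (_ : jdisc T = (@norm2 R) @^-1` (`]-oo, T[%classic)); last first.
  by apply/seteqP; split => h /=; rewrite in_itv.
by apply: measurable_norm2 => //; exact: measurable_itv.
Qed.

Definition jprofile (T r : R) : CC R :=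
  (\1_(`]-oo, T[%classic : set R) r)%:C * (((2 * pi) ^+ 2)%:C^-1 * jkap a `|w| r).

Lemma cmeas_jprofile T : cmeas [set: mR] (jprofile T).
Proof.
apply: cmeasM; first by apply: cmeasR; exact: measurable_indic.
by apply: cmeasM; [exact: cmeasC|exact: cmeas_jkap].
Qed.

Lemma jprofile_radial T (sigma : R * R) : 0 < T ->
  cintegrable mu `]0, +oo[ (fun r => r%:C * jprofile T r * (besselJ0 (r * norm2 sigma))%:C) /\
  (2 * pi)%:C *
    cintegral mu `]0, +oo[ (fun r => r%:C * jprofile T r * (besselJ0 (r * norm2 sigma))%:C) =
  cintegral mu `[0, T] (J1n a `|w| (norm2 sigma)).
Proof.
move=> T0; have iC := J1n_integrable a sigma W0 T0.
have p0 : ((2 * pi)%:C : CC R) != 0 by rewrite realc_eq0 mulf_neq0// gt_eqF// pi_gt0.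
have iO : cintegrable mu `]0, T[ (J1n a `|w| (norm2 sigma)).
  by apply: cintegrableS iC => //; exact: subset_itv_oo_cc.
pose f r : CC R := (\1_(`]-oo, T[%classic : set R) r)%:C * J1n a `|w| (norm2 sigma) r.
have iF : cintegrable mu `]0, +oo[ f.
  by apply: cintegrable_indic_setI => //; rewrite itv0y_oray.
have fE r : (2 * pi)%:C^-1 * f r = r%:C * jprofile T r * (besselJ0 (r * norm2 sigma))%:C.
  rewrite /f /J1n /jprofile realcX [(r / _)%:C]realcM realcV.
  move: (jkap _ _ _) (besselJ0 _) (\1_ _ _) ((2 * pi)%:C : CC R) p0 => K B i p p0.
  by field.
have iZ : cintegrable mu `]0, +oo[ (fun r => (2 * pi)%:C^-1 * f r) by exact: cintegrableZl.
split; first by apply: ceq_integrable iZ => // r _; exact: fE.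
have -> : cintegral mu `]0, +oo[ (fun r => r%:C * jprofile T r * (besselJ0 (r * norm2 sigma))%:C)
    = cintegral mu `]0, +oo[ (fun r => (2 * pi)%:C^-1 * f r).
  by apply: ceq_integral => r _; rewrite fE.
rewrite cintegralZl// mulVKf// cintegral_indic_setI itv0y_oray.
exact: cintegral_oo_cc.
Qed.

Lemma J2_integrandE T h : (\1_(jdisc T) h)%:C * J2_integrand rho a w h =
  jprofile T (norm2 h) * cexp (Ci * (dot2 h rho)%:C).
Proof.
rewrite /J2_integrand /jprofile /jkap nuf_norm mufE ?norm2_ge0//.
have -> : \1_(jdisc T) h = \1_(`]-oo, T[%classic : set R) (norm2 h) :> R.
  rewrite !indicE; congr (_%:R); congr nat_of_bool.
move: (csin _ / _) (cexp _) (\1_ _ _)%:C => x y z.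
by rewrite -!mulrA; congr (_ * (_ * _)); rewrite mulrC.
Qed.

Lemma J2_integral T : 0 < T ->
  cintegrable (@leb2 R) (jdisc T) (J2_integrand rho a w) /\
  cintegral (@leb2 R) (jdisc T) (J2_integrand rho a w) =
  cintegral mu `[0, T] (J1_integrand rho a w).
Proof.
move=> T0; have [_ e] := jprofile_radial rho T0.
(* At the origin the Bessel factor is 1, which gives the integrability of the bare profile. *)
have [i0 _] := jprofile_radial (0, 0) T0.
have n0 : norm2 (0, 0) = 0 :> R by rewrite /norm2/= expr0n addr0 sqrtr0.
have iF : cintegrable mu `]0, +oo[ (fun r => r%:C * jprofile T r).
  apply: ceq_integrable i0 => // r _.
  by rewrite n0 mulr0 besselJ0E expr0n besj0 mulr1.
have [j E] := chankel rho (cmeas_jprofile T) iF.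
have jJ : cintegrable (@leb2 R) setT (fun h => (\1_(jdisc T) h)%:C * J2_integrand rho a w h).
  by apply: ceq_integrable j => // h _; rewrite J2_integrandE.
have mD := measurable_jdisc T.
split; first by rewrite -[jdisc T]setTI; exact: cintegrable_indic_setIE.
rewrite J1_integralE -e -[RHS]E -[in LHS](setTI (jdisc T)) -cintegral_indic_setI.
by apply: ceq_integral => h _; rewrite J2_integrandE.
Qed.

Lemma cvg_J1 : 0 < a -> 0 < s -> s != a ->
  (Ci * cintegral mu `[0, T] (J1_integrand rho a w) : CC R) @[T --> +oo] --> jumpJ rho a w.
Proof.
move=> a0 s0 sa; rewrite -jumpJ_norm.
apply: cvg_trans (cvg_J1n W0 a0 s0 sa); apply: near_eq_cvg; apply: nearW => T.
by rewrite J1_integralE.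
Qed.

Lemma cvg_J2 : 0 < a -> 0 < s -> s != a ->
  (Ci * cintegral (@leb2 R) (jdisc T) (J2_integrand rho a w) : CC R)
    @[T --> +oo] --> jumpJ rho a w.
Proof.
move=> a0 s0 sa; apply: cvg_trans (cvg_J1 a0 s0 sa); apply: near_eq_cvg; near=> T.
have T0 : 0 < T by near: T; apply: nbhs_pinfty_gt; exact: num_real.
by rewrite (J2_integral T0).2.
Unshelve. all: by end_near. Qed.

End planar.
End jump_kernel.

(** Reflection of z changes both rho and zeta, hence [opp2 rho]. The spectral formulas are limits of
    truncated integrals because absolute convergence fails. At rho = 0 even these limits do not
    exist, since the evanescent part is then proportional to (1 - cos (a M)) / a with M tending to
    infinity; at rho = a the jump density is singular. *)
Theorem theorem6 (R : realType) (a : R) (ha : 0 < a) :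
  (* U^+ = U^+_prop + U^+_evan  (omega > 0, xi > 0, zeta = xi - i a),
     all integrals absolutely convergent *)
  (forall (w xi : R) (rho : R * R), 0 < w -> 0 < xi ->
     cintegrable (@leb2 R) setT (Uplus_integrand w rho (xi -i* a)) /\
     cintegrable (@lebesgue_measure R) `]0, w[ (Uprop_integrand w rho (xi -i* a)) /\
     cintegrable (@lebesgue_measure R) `]w, +oo[ (Uevan_integrand w rho (xi -i* a)) /\
     Uplus w rho (xi -i* a) = Uprop w rho (xi -i* a) + Uevan w rho (xi -i* a)) /\
  (* the four cases *)
  (forall (w xi : R) (rho : R * R), 0 < w -> 0 < xi ->
     beamB w rho (xi -i* a) = Uplus w rho (xi -i* a)) /\
  (forall (w xi : R) (rho : R * R), 0 < w -> xi < 0 ->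
     beamB w rho (xi -i* a) = Uplus w (opp2 rho) (- (xi -i* a))) /\
  (forall (w xi : R) (rho : R * R), w < 0 -> 0 < xi ->
     beamB w rho (xi -i* a) = cconj (Uplus `|w| rho (xi +i* a))) /\
  (forall (w xi : R) (rho : R * R), w < 0 -> xi < 0 ->
     beamB w rho (xi -i* a) = cconj (Uplus `|w| (opp2 rho) (- (xi +i* a)))) /\
  (* for rho > a: U^+(z) and U^+(-z) are analytic continuations of one
     another across xi = 0 (holomorphic in zeta near -ia), with equal
     boundary values on xi = 0 *)
  (forall (w : R) (rho : R * R), 0 < w -> a < norm2 rho ->
     (exists r : R, 0 < r /\ exists G : CC R -> CC R,
        (forall z : CC R, cre z ^+ 2 + (cim z + a) ^+ 2 < r ^+ 2 ->
           derivable G z 1) /\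
        (forall z : CC R, cre z ^+ 2 + (cim z + a) ^+ 2 < r ^+ 2 ->
           0 < cre z -> G z = Uplus w rho z) /\
        (forall z : CC R, cre z ^+ 2 + (cim z + a) ^+ 2 < r ^+ 2 ->
           cre z < 0 -> G z = Uplus w (opp2 rho) (- z))) /\
     (exists l : CC R,
        Uplus w rho (e -i* a) @[e --> (0 : R)^'+] --> l /\
        Uplus w (opp2 rho) (- ((- e) -i* a)) @[e --> (0 : R)^'+] --> l)) /\
  (* the jump across the branch cut and its spectral decompositions *)
  (forall (w : R) (rho : R * R), w != 0 -> norm2 rho != a ->
     (beamB w rho (e -i* a) - beamB w rho ((- e) -i* a))
        @[e --> (0 : R)^'+] --> jumpJ rho a w /\
     (0 < norm2 rho ->
     (forall T : R, 0 < T ->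
        cintegrable (@leb2 R) [set h | norm2 h < T] (J2_integrand rho a w)) /\
     (Ci * cintegral (@leb2 R) [set h | norm2 h < T] (J2_integrand rho a w))
        @[T --> +oo] --> jumpJ rho a w /\
     (forall T : R, 0 < T ->
        cintegrable (@lebesgue_measure R) `[0, T] (J1_integrand rho a w)) /\
     (Ci * cintegral (@lebesgue_measure R) `[0, T] (J1_integrand rho a w))
        @[T --> +oo] --> jumpJ rho a w)).
Proof.
split; first by move=> w xi rho w0 x0; exact: Uplus_split.
split.
  by move=> w xi rho w0 x0; rewrite Uplus_beam// /cim/= oppr_eq0 gt_eqF.
split.
  move=> w xi rho w0 x0; rewrite Uplus_beam ?beamB_opp//.
    by rewrite /cre/= oppr_gt0.
  by rewrite /cim/= opprK gt_eqF.
split.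
  move=> w xi rho w0 x0; rewrite ltr0_norm// Uplus_beam ?oppr_gt0//; last first.
    by rewrite /cim/= gt_eqF.
  rewrite beamB_conj; last 2 first.
  - by rewrite /cre/= gt_eqF.
  - by rewrite /cim/= oppr_eq0 gt_eqF.
  by congr (cconj (beamB _ _ _)); apply: cP; rewrite ?creJ ?cimJ /cre/cim/= ?opprK.
split.
  move=> w xi rho w0 x0; rewrite ltr0_norm// Uplus_beam ?oppr_gt0//; last first.
    by rewrite /cim/= oppr_eq0 gt_eqF.
  rewrite beamB_opp beamB_conj; last 2 first.
  - by rewrite /cre/= lt_eqF.
  - by rewrite /cim/= oppr_eq0 gt_eqF.
  by congr (cconj (beamB _ _ _)); apply: cP; rewrite ?creJ ?cimJ /cre/cim/= ?opprK.
split.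
  move=> w rho w0 ar; split; first exact: analytic_continuation.
  exact: boundary_values.
move=> w rho w0 ra; split; first exact: beam_jump.
move=> r0; split; first by move=> T T0; have [] := J2_integral a rho w0 T0.
split; first exact: cvg_J2.
split; first by move=> T T0; exact: J1_integrable.
exact: cvg_J1.
Qed.
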